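(* Let $M$ be the Grassmannian $\mathrm{Gr}^+(2,\mathbb R^5)$ or $\mathrm{Gr}^+(2,\mathbb R^6)$, with its $\mathrm{SO}(n)$-invariant symplectic structure and its torus action ($n=5$ or $n=6$ respectively). There exists an equivariant symplectic embedding into $M$ of a disjoint union of two symplectic balls with linear torus actions and with equal radii, such that the complement of the image has zero volume. A fortiori, each of these Grassmannians admits a full packing by two equal symplectic balls.
   Context: $\mathrm{Gr}^+(2,\mathbb R^n)$ is the Grassmannian of all oriented real $2$-planes in $\mathbb R^n$, together with its canonical (unique up to multiplication by a constant) $\mathrm{SO}(n)$-invariant symplectic structure, and with the action of the $\lfloor n/2\rfloor$-dimensional maximal torus $T$ of $\mathrm{SO}(n)$ given by restricting the standard action of $\mathrm{SO}(n)$. A symplectic ball is a ball $\{z\in\mathbb C^m:|z|<r\}$ centered at the origin, with the standard symplectic form, where $2m=\dim M$; a linear action on it is the restriction of a linear symplectic (unitary) representation of $T$ on $\mathbb C^m$. Volume is with respect to the Liouville measure of $M$. A symplectic manifold $M$ admits a full packing by $k$ equal balls if for every $\epsilon>0$ there exists a symplectic embedding into $M$ of a disjoint union of $k$ symplectic balls with equal radii such that the complement of the image has volume less than $\epsilon$. *)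

(* Defs.v *)
(* MathComp + MathComp-Analysis, over an arbitrary R : realType *)
From HB Require Import structures.
From mathcomp Require Import all_boot all_order all_algebra all_fingroup.
From mathcomp Require Import ring lra.
From mathcomp Require Import all_classical all_reals all_analysis.

Set Implicit Arguments.
Unset Strict Implicit.
Unset Printing Implicit Defensive.

Import Order.TTheory GRing.Theory Num.Theory.
Import numFieldNormedType.Exports.

Local Open Scope classical_set_scope.
Local Open Scope ring_scope.

Section Smooth.
Variables (R : realType) (V W : normedModType R).

(* Only used on open sets U. *)
Fixpoint of_class_C (k : nat) (U : set V) (f : V -> W) : Prop :=
  match k with
  | 0 => forall x, U x -> {for x, continuous f}
  | k'.+1 => (forall x, U x -> differentiable f x) /\
             (forall v : V, of_class_C k' U ('D_v f))
  end.

Definition smooth_on (U : set V) (f : V -> W) : Prop :=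
  forall k, of_class_C k U f.

End Smooth.

(* A manifold is given as a submanifold S of a normed space E; its dimension
   is d. A 2-form on S is a function omega : E -> E -> E -> R of which only the
   values omega A u v with A in S and u, v tangent to S at A are relevant. *)
Section Submanifolds.
Variables (R : realType) (E : normedModType R).

Definition tangent (S : set E) (A v : E) : Prop :=
  exists gamma : R -> E,
    [/\ smooth_on setT gamma, forall t, S (gamma t),
        gamma 0 = A & 'D_1 gamma 0 = v].

(* As d is the dimension of S, such a phi is automatically an open embedding
   of U into S, i.e. the inverse of a chart. *)
Definition parametrization (d : nat) (S : set E) (U : set 'cV[R]_d)
    (phi : 'cV[R]_d -> E) : Prop :=
  [/\ open U, smooth_on U phi, (forall x, U x -> S (phi x)),
      (forall x y, U x -> U y -> phi x = phi y -> x = y) &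
      (forall x u, U x -> 'D_u phi x = 0 -> u = 0)].

(* phi^*omega, evaluated on the constant vector fields u and v *)
Definition pullback (d : nat) (omega : E -> E -> E -> R)
    (phi : 'cV[R]_d -> E) (u v : 'cV[R]_d) : 'cV[R]_d -> R :=
  fun x => omega (phi x) ('D_u phi x) ('D_v phi x).

Definition symplectic_form (d : nat) (S : set E) (omega : E -> E -> E -> R)
    : Prop :=
  [/\ (forall A, S A -> forall (c : R) (u v w : E),
         tangent S A u -> tangent S A v -> tangent S A w ->
         omega A (c *: u + v) w = c * omega A u w + omega A v w),
      (forall A, S A -> forall u, tangent S A u -> omega A u u = 0),
      (forall A, S A -> forall u, tangent S A u ->
         (forall v, tangent S A v -> omega A u v = 0) -> u = 0),
      (forall (U : set 'cV[R]_d) phi, parametrization S U phi ->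
         forall u v, smooth_on U (pullback omega phi u v)) &
      (forall (U : set 'cV[R]_d) phi, parametrization S U phi ->
         forall u v w x, U x ->
           'D_u (pullback omega phi v w) x + 'D_v (pullback omega phi w u) x
           + 'D_w (pullback omega phi u v) x = 0)].

End Submanifolds.

Section Liouville.
Variables (R : realType) (E : normedModType R) (m : nat).

(* The value of phi^*(omega^m / m!) on the canonical basis of R^(2m), that is,
   the Pfaffian of the Gram matrix of phi^*omega (up to the global sign
   (-1)^(m(m-1)/2) due to the numbering x_1 .. x_m, y_1 .. y_m of the
   coordinates). *)
Definition liouville_density (omega : E -> E -> E -> R)
    (phi : 'cV[R]_(m + m) -> E) (x : 'cV[R]_(m + m)) : R :=
  let e (i : 'I_(m + m)) : 'cV[R]_(m + m) := delta_mx i 0 in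
  (2 ^+ m * m`!%:R)^-1 *
  \sum_(s : 'S_(m + m)) (-1) ^+ s *
    \prod_(i < m)
      pullback omega phi (e (s (lshift m i))) (e (s (rshift m i))) x.

Definition box (a b : 'cV[R]_(m + m)) : set 'cV[R]_(m + m) :=
  [set x | forall i, a i 0 <= x i 0 <= b i 0].

Definition box_volume (a b : 'cV[R]_(m + m)) : R :=
  \prod_i (b i 0 - a i 0).

(* The (outer) Liouville measure of A, as an upper Riemann-Lebesgue sum: A is
   covered by countably many parametrized closed boxes phi_k(box a_k b_k), each
   of which is counted with weight
     vol(box a_k b_k) * sup_(box a_k b_k) |phi_k^*(omega^m / m!)|.
   The density being continuous, boxes can be subdivided so as to make the
   weights arbitrarily close to the integrals of the density; on Borel sets the
   infimum is therefore the integral of |omega^m / m!|. *)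
Definition liouville_volume (S : set E) (omega : E -> E -> E -> R)
    (A : set E) : \bar R :=
  ereal_inf [set vol : \bar R |
    exists (phi : nat -> 'cV[R]_(m + m) -> E) (U : nat -> set 'cV[R]_(m + m))
           (a b : nat -> 'cV[R]_(m + m)),
    [/\ (forall k, parametrization S (U k) (phi k)),
        (forall k i, a k i 0 <= b k i 0),
        (forall k, box (a k) (b k) `<=` U k),
        A `<=` \bigcup_k (phi k @` box (a k) (b k)) &
        vol = (\sum_(0 <= k <oo)
                (box_volume (a k) (b k))%:E *
                ereal_sup [set `|liouville_density omega (phi k) x|%:E
                          | x in box (a k) (b k)])%E]].

End Liouville.

(* C^m is 'cV[R]_(m + m): z = x + i y is encoded as col_mx x y. *)
Section Balls.
Variables (R : realType) (m : nat).

Definition Cball (r : R) : set 'cV[R]_(m + m) :=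
  [set z | \sum_i z i 0 ^+ 2 < r ^+ 2].

Definition std_mx : 'M[R]_(m + m) := block_mx 0 1%:M (- 1%:M) 0.

(* sum_k dx_k /\ dy_k *)
Definition std_form (u v : 'cV[R]_(m + m)) : R := (u^T *m std_mx *m v) 0 0.

(* U(m), as the intersection of O(2m) and Sp(2m) *)
Definition unitary_mx (S : 'M[R]_(m + m)) : Prop :=
  S^T *m S = 1%:M /\ S^T *m std_mx *m S = std_mx.

Definition unitary_rep (n : nat) (T : set 'M[R]_n)
    (rho : 'M[R]_n -> 'M[R]_(m + m)) : Prop :=
  [/\ (forall t, T t -> unitary_mx (rho t)),
      (forall s t, T s -> T t -> rho (s *m t) = rho s *m rho t) &
      {within T, continuous rho}].

Variable (E : normedModType R).

(* f is an injective immersion between manifolds of the same dimension 2m,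
   hence an open embedding. *)
Definition symplectic_ball_embedding (S : set E) (omega : E -> E -> E -> R)
    (r : R) (f : 'cV[R]_(m + m) -> E) : Prop :=
  [/\ smooth_on (Cball r) f, (forall z, Cball r z -> S (f z)),
      (forall z w, Cball r z -> Cball r w -> f z = f w -> z = w) &
      (forall z u v, Cball r z -> pullback omega f u v z = std_form u v)].

(* a symplectic embedding of a disjoint union of k balls of radius r *)
Definition ball_packing (S : set E) (omega : E -> E -> E -> R) (k : nat)
    (r : R) (f : 'I_k -> 'cV[R]_(m + m) -> E) : Prop :=
  [/\ 0 < r, (forall i, symplectic_ball_embedding S omega r (f i)) &
      trivIset setT (fun i => f i @` Cball r)].

Definition packing_complement (S : set E) (k : nat) (r : R)
    (f : 'I_k -> 'cV[R]_(m + m) -> E) : set E :=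
  S `\` \bigcup_i (f i @` Cball r).

Definition full_packing (S : set E) (omega : E -> E -> E -> R) (k : nat)
    : Prop :=
  forall eps : R, 0 < eps ->
    exists (r : R) (f : 'I_k -> 'cV[R]_(m + m) -> E),
      ball_packing S omega r f /\
      (liouville_volume m S omega (packing_complement S r f) < eps%:E)%E.

End Balls.

Section Grassmannian.
Variables (R : realType) (n : nat).

Definition SO : set 'M[R]_n := [set g | g *m g^T = 1%:M /\ \det g = 1].

Definition orthonormal2 (x y : 'cV[R]_n) : Prop :=
  [/\ x^T *m x = 1%:M, y^T *m y = 1%:M & x^T *m y = 0].

(* the bivector x /\ y, as a skew-symmetric matrix *)
Definition wedge (x y : 'cV[R]_n) : 'M[R]_n := x *m y^T - y *m x^T.

(* Gr^+(2, R^n): the oriented plane with oriented orthonormal basis (x, y) is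
   represented by its unit bivector x /\ y (Plucker embedding); this is
   well-defined and faithful by wedge_eqP below. The manifold structure is the
   one of a submanifold of 'M[R]_n. *)
Definition Gr : set 'M[R]_n :=
  [set A | exists x y, orthonormal2 x y /\ A = wedge x y].

Definition SO_act (g A : 'M[R]_n) : 'M[R]_n := g *m A *m g^T.

Lemma SO_act_wedge (g : 'M[R]_n) (x y : 'cV[R]_n) :
  SO_act g (wedge x y) = wedge (g *m x) (g *m y).
Proof. by rewrite /SO_act /wedge mulmxBr mulmxBl !trmx_mul !mulmxA. Qed.

Lemma wedge_mulr (x y : 'cV[R]_n) : orthonormal2 x y ->
  wedge x y *m y = x /\ wedge x y *m x = - y.
Proof.
move=> [xx yy xy]; have yx : y^T *m x = 0.
  by rewrite -[LHS]trmxK trmx_mul trmxK xy trmx0.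
by rewrite /wedge !mulmxBl -!mulmxA xx yy xy yx !mulmx0 !mulmx1 subr0 sub0r.
Qed.

Lemma wedge_eqP (x y x' y' : 'cV[R]_n) :
  orthonormal2 x y -> orthonormal2 x' y' ->
  wedge x y = wedge x' y' <->
  exists a b : R, [/\ a ^+ 2 + b ^+ 2 = 1, x' = a *: x + b *: y &
                      y' = - b *: x + a *: y].
Proof.
move=> oxy oxy'; have [xx yy xy] := oxy; have [xx' _ _] := oxy'.
have [ey' ex'] := wedge_mulr oxy'.
have yx : y^T *m x = 0 by rewrite -[LHS]trmxK trmx_mul trmxK xy trmx0.
split=> [eW | [a [b [ab -> ->]]]]; last first.
  apply/matrixP => i j; rewrite !mxE !big_ord1 !mxE.
  transitivity ((a ^+ 2 + b ^+ 2) * (x i 0 * y j 0 - y i 0 * x j 0)).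
    by rewrite ab mul1r.
  ring.
pose a := (y^T *m y') 0 0; pose b := - (x^T *m y') 0 0.
have Wz z : wedge x y *m z = (y^T *m z) 0 0 *: x - (x^T *m z) 0 0 *: y.
  by rewrite /wedge mulmxBl -!mulmxA [y^T *m z]mx11_scalar
    [x^T *m z]mx11_scalar !mul_mx_scalar !mxE !eqxx !mulr1n.
have defx' : x' = a *: x + b *: y by rewrite -ey' -eW Wz /b scaleNr.
exists a, b; split=> //.
- have := congr1 (fun M : 'M[R]_1 => M 0 0) xx'; rewrite defx'.
  rewrite [(_ + _)^T]raddfD /= ![(_ *: _)^T]linearZ /= mulmxDl
    !mulmxDr -!scalemxAl -!scalemxAr.
  rewrite xx yy xy yx !mxE /= => H; apply: etrans H; ring.
- rewrite -[LHS]opprK -ex' -eW Wz defx' !mulmxDr -!scalemxAr xx yy xy yx.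
  by apply/matrixP=> i j; rewrite !mxE /=; ring.
Qed.

(* An SO(n)-invariant symplectic structure on Gr; the action of g is the
   restriction of a linear map, which is therefore its own differential. The
   multiples c * tr(A (u v - v u)), c != 0, of the Kirillov-Kostant-Souriau form
   are of this kind. *)
Definition invariant_symplectic_form
    (omega : 'M[R]_n -> 'M[R]_n -> 'M[R]_n -> R) : Prop :=
  symplectic_form ((n - 2) + (n - 2)) Gr omega /\
  (forall g A u v, SO g -> Gr A -> tangent Gr A u -> tangent Gr A v ->
     omega (SO_act g A) (SO_act g u) (SO_act g v) = omega A u v).

(* The rotation of angle theta_k in the oriented plane (e_2k, e_2k+1), for
   each k < n./2 (basis vectors numbered from 0); when n is odd the last basis
   vector is fixed. *)
Definition torus_mx (theta : nat -> R) : 'M[R]_n :=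
  \matrix_(i, j)
    if i == j then (if (i./2 < n./2)%N then cos (theta i./2) else 1)
    else if i./2 == j./2 then
      (if (i < j)%N then - sin (theta i./2) else sin (theta i./2))
    else 0.

Definition torus : set 'M[R]_n := range torus_mx.

End Grassmannian.

(* Main.v *)
(* Half of Gr^+(2, R^n), namely {A | A_12 > 0}, is an explicit symplectic ball
   (m = n - 2 is its complex dimension).  Write z = p + i q and Z = (p q), an
   m x 2 matrix, and let N be the symmetric positive 2 x 2 matrix with
   (1 - N) (1 + tr N - N) = Z^T Z, which exists for |z|^2 < 2.  The columns of
   col_mx N (Z (1 + N) / sqrt (det (1 + N))) form an orthonormal frame (X, Y), and
   dX /\ dY pulls back to dp /\ dq.  The map z |-> X /\ Y is a bijection onto
   {A_12 > 0}: a plane with A_12 > 0 has exactly one oriented orthonormal basis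
   whose upper 2 x 2 block is symmetric positive.  It is equivariant, the rotation
   of (e_1, e_2) acting on C^m by scalars.  An element of SO(n) reversing the
   orientation of (e_1, e_2) maps this ball onto {A_12 < 0}.  An invariant
   symplectic form being a multiple of the Kirillov form, rescaling z (and
   replacing A by - A if the multiple is negative) makes both embeddings
   symplectic.

   The complement lies in {A_12 = 0}, which is covered by countably many
   parametrized boxes having an edge of length 0: every such A has an entry
   A_ij != 0 and an entry A_kl = 0 with i, j, k, l distinct, and in the ball
   around e_i /\ e_j the equation A_kl = 0 is the quadratic cone
   p_k q_l = q_k p_l. *)
Require Import Defs.
From mathcomp Require Import all_boot all_order all_algebra.
From mathcomp Require Import ring lra.
From mathcomp Require Import all_classical all_reals all_analysis.

Set Implicit Arguments.
Unset Strict Implicit.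
Unset Printing Implicit Defensive.

Import Order.TTheory GRing.Theory Num.Theory.
Import numFieldNormedType.Exports.

Local Open Scope classical_set_scope.
Local Open Scope ring_scope.

(** * Smooth maps *)

(** The equation for [N] expresses orthonormality of the frame. The Gram matrix of the columns is
    N^2 + (1 + N) Z^T Z (1 + N) / det (1 + N); setting it to 1 gives Z^T Z = (1 - N) det (1 + N) (1
    + N)^-1, and for 2 x 2 matrices the adjugate det (1 + N) (1 + N)^-1 is 1 + tr N - N. An
    invariant form is pinned down at the plane e_1 /\ e_2, whose stabilizer contains SO(m) acting
    diagonally on the tangent space R^m + R^m. For m >= 3 an SO(m)-invariant bilinear form on R^m is
    a multiple of the dot product; alternation and nondegeneracy leave one nonzero scalar, which
    transitivity carries to all planes. The obstacle is that [symplectic_form] grants linearity in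
    the left argument only, and omega u u = 0 does not yield the right one by itself: it is
    extracted from closedness by comparing two parametrizations. No integral is computed: a box with
    an edge of length 0 has weight 0 in [liouville_volume] whatever the density is. *)

Section SmoothMaps.
Variables (R : realType) (V : normedModType R).

(** The first-order expansion of [f] at [x] serves for [g] as well, and uniqueness of the
    differential identifies its linear part. Needed because the later formulas for derivatives hold
    on an open set only. *)
Lemma near_eq_differentiable (W : normedModType R) (f g : V -> W) (x : V) :
  {near x, f =1 g} -> differentiable f x -> differentiable g x.
Proof.
move=> fg df.
have dg : g \o shift x = cst (g x) + 'd f x +o_ 0 id.
  apply/eqaddoP => eps eps0.
  have /eqaddoP/(_ _ eps0) := diff_locally df; apply: filter_app.
  have : \forall t \near 0, f (t + x) = g (t + x).
    by have := fg; rewrite (near_shift 0) /= subr0.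
  apply: filterS => t /= e.
  by rewrite !fctE /= e (nbhs_singleton fg).
have dfg := diff_unique (diff_continuous df) dg.
by apply/diff_locallyP; rewrite dfg; split=> //; exact: diff_continuous.
Qed.

Lemma derive_eq_on (W : normedModType R) (U : set V) (f g : V -> W) (v x : V) :
  open U -> {in U, f =1 g} -> U x -> 'D_v f x = 'D_v g x.
Proof.
move=> oU fg Ux; apply: near_eq_derive; near=> y; apply: fg; rewrite inE.
by near: y; apply: open_nbhs_nbhs.
Unshelve. all: by end_near. Qed.

Lemma of_class_C_ext (W : normedModType R) (U : set V) (f g : V -> W) k :
  open U -> {in U, f =1 g} -> of_class_C k U f -> of_class_C k U g.
Proof.
move=> oU; have nU x : U x -> \forall y \near x, U y.
  by move=> Ux; apply: open_nbhs_nbhs.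
elim: k f g => [|k IH] f g fg /=.
  move=> cf x Ux; have fgx : {near x, f =1 g}.
    by apply: filterS (nU x Ux) => y Uy; apply: fg; rewrite inE.
  apply: cvg_trans; first exact: (near_eq_cvg fgx).
  by rewrite -(nbhs_singleton fgx); exact: cf.
move=> [df Cf]; split=> [x Ux|v].
  apply: near_eq_differentiable (df x Ux).
  by apply: filterS (nU x Ux) => y Uy; apply: fg; rewrite inE.
apply: IH (Cf v) => x; rewrite inE => Ux.
exact: (derive_eq_on _ oU fg).
Qed.

Lemma smooth_ext (W : normedModType R) (U : set V) (f g : V -> W) :
  open U -> {in U, f =1 g} -> smooth_on U f -> smooth_on U g.
Proof. by move=> oU fg sf k; apply: of_class_C_ext (sf k). Qed.

Lemma of_class_CW (W : normedModType R) (U : set V) (f : V -> W) k :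
  of_class_C k.+1 U f -> of_class_C k U f.
Proof.
elim: k f => [|k IH] f [df Cf].
  by move=> x Ux; apply: differentiable_continuous; apply: df.
by split=> // v; apply: IH; exact: Cf.
Qed.

Lemma smooth_differentiable (W : normedModType R) (U : set V) (f : V -> W) x :
  smooth_on U f -> U x -> differentiable f x.
Proof. by move=> /(_ 1%N)[df _]; exact: df. Qed.

Lemma smooth_derivable (W : normedModType R) (U : set V) (f : V -> W) x v :
  smooth_on U f -> U x -> derivable f x v.
Proof. by move=> sf Ux; apply/diff_derivable/(smooth_differentiable sf). Qed.

Lemma smooth_cst (W : normedModType R) (U : set V) (w : W) :
  smooth_on U (cst w).
Proof.
move=> k; elim: k w => [|k IH] w /=; first by move=> x _; apply: cst_continuous.
split=> [x _|v]; first exact: differentiable_cst.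
by rewrite (_ : 'D_v (cst w) = cst 0) //; apply/funext => x; exact: derive_cst.
Qed.

Lemma of_class_CD (W : normedModType R) (U : set V) (f g : V -> W) k :
  open U -> of_class_C k U f -> of_class_C k U g -> of_class_C k U (f + g).
Proof.
move=> oU; elim: k f g => [|k IH] f g /=.
  by move=> cf cg x Ux; apply: cvgD; [exact: cf | exact: cg].
move=> [df Cf] [dg Cg]; split=> [x Ux|v].
  by apply: differentiableD; [exact: df | exact: dg].
apply: (@of_class_C_ext _ _ ('D_v f + 'D_v g)) => //; last exact: IH.
move=> x; rewrite inE => Ux; rewrite deriveD //; apply: diff_derivable;
  [exact: df | exact: dg].
Qed.

Lemma of_class_CZ (W : normedModType R) (U : set V) (f : V -> R) (w : W) k :
  open U -> of_class_C k U f -> of_class_C k U (fun x => f x *: w).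
Proof.
move=> oU; elim: k f => [|k IH] f /=.
  by move=> cf x Ux; apply: cvgZr_tmp; exact: cf.
move=> [df Cf]; split=> [x Ux|v]; first exact/differentiableZl/df.
apply: (@of_class_C_ext _ _ (fun x => 'D_v f x *: w)) => //; last exact: IH.
move=> x; rewrite inE => Ux.
have dfx := df x Ux.
by rewrite deriveE // deriveE ?diffZl //; exact: differentiableZl.
Qed.

Lemma of_class_CM (U : set V) (f g : V -> R) k :
  open U -> of_class_C k U f -> of_class_C k U g -> of_class_C k U (f * g).
Proof.
move=> oU; elim: k f g => [|k IH] f g /=.
  by move=> cf cg x Ux; apply: cvgM; [exact: cf | exact: cg].
move=> [df Cf] [dg Cg]; split=> [x Ux|v].
  by apply: differentiableM; [exact: df | exact: dg].
apply: (@of_class_C_ext _ _ (f * 'D_v g + g * 'D_v f)) => //.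
  move=> x; rewrite inE => Ux; rewrite deriveM //; apply: diff_derivable;
    [exact: df | exact: dg].
(* The Leibniz rule keeps undifferentiated factors of class k + 1, which are lowered to class k
   before the induction hypothesis applies. *)
by apply: of_class_CD => //; apply: IH => //; apply: of_class_CW; split.
Qed.

Lemma smoothD (W : normedModType R) (U : set V) (f g : V -> W) :
  open U -> smooth_on U f -> smooth_on U g -> smooth_on U (fun x => f x + g x).
Proof. by move=> oU sf sg k; apply: (of_class_CD oU (sf k) (sg k)). Qed.

Lemma smoothZ (W : normedModType R) (U : set V) (f : V -> R) (w : W) :
  open U -> smooth_on U f -> smooth_on U (fun x => f x *: w).
Proof. by move=> oU sf k; apply: of_class_CZ. Qed.

Lemma smoothM (U : set V) (f g : V -> R) :
  open U -> smooth_on U f -> smooth_on U g -> smooth_on U (fun x => f x * g x).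
Proof. by move=> oU sf sg k; apply: (of_class_CM oU (sf k) (sg k)). Qed.

Lemma smoothMl (U : set V) (a : R) (f : V -> R) :
  open U -> smooth_on U f -> smooth_on U (fun x => a * f x).
Proof. by move=> oU sf; apply: (smoothM oU (smooth_cst U a) sf). Qed.

Lemma smoothN (U : set V) (f : V -> R) :
  open U -> smooth_on U f -> smooth_on U (fun x => - f x).
Proof.
move=> oU /(smoothMl (-1) oU); apply: smooth_ext => // x _.
by rewrite mulN1r.
Qed.

Lemma smoothB (U : set V) (f g : V -> R) :
  open U -> smooth_on U f -> smooth_on U g -> smooth_on U (fun x => f x - g x).
Proof. by move=> oU sf sg; apply: smoothD => //; exact: smoothN. Qed.

Lemma of_class_C_sum (W : normedModType R) (U : set V) (I : Type) (r : seq I)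
    (f : I -> V -> W) k :
  open U -> (forall i, of_class_C k U (f i)) ->
  of_class_C k U (fun x => \sum_(i <- r) f i x).
Proof.
move=> oU Cf; elim: r => [|i r IH].
  apply: of_class_C_ext (smooth_cst U (0 : W) k) => // x _.
  by rewrite big_nil.
apply: of_class_C_ext (of_class_CD oU (Cf i) IH) => // x _.
by rewrite big_cons.
Qed.

Lemma smooth_sum (W : normedModType R) (U : set V) (I : Type) (r : seq I)
    (f : I -> V -> W) :
  open U -> (forall i, smooth_on U (f i)) ->
  smooth_on U (fun x => \sum_(i <- r) f i x).
Proof. by move=> oU sf k; apply: of_class_C_sum => // i; exact: sf. Qed.

Lemma derive_rsqrt (f : V -> R) x v : 0 < f x -> differentiable f x ->
  differentiable (fun y => (Num.sqrt (f y))^-1) x /\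
  'D_v (fun y => (Num.sqrt (f y))^-1) x =
    - 2^-1 * ((Num.sqrt (f x))^-1) ^+ 3 * 'D_v f x.
Proof.
move=> f0 df; have s0 : Num.sqrt (f x) != 0 by rewrite gt_eqF // sqrtr_gt0.
have dsqrt : differentiable (@Num.sqrt R) (f x).
  by apply/derivable1_diffP; apply: ex_derive; exact: is_derive1_sqrt.
have dc : differentiable (@Num.sqrt R \o f) x by exact: differentiable_comp.
have dV : differentiable (fun y => (Num.sqrt (f y))^-1) x.
  exact: (differentiableV dc).
split=> //; rewrite (@deriveV _ _ (@Num.sqrt R \o f)) //; last first.
  exact: diff_derivable.
have -> : 'D_v (@Num.sqrt R \o f) x = (2 * Num.sqrt (f x))^-1 * 'D_v f x.
  rewrite deriveE // diff_comp // deriveE //= deriv1E; last first.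
    exact/derivable1_diffP.
  by rewrite derive1E derive_sqrt //; exact: mulrC.
by rewrite /= /GRing.scale /=; field; rewrite s0.
Qed.

(** With g = f^(-1/2), the derivative of g is -1/2 g^3 times that of f, so an induction on the class
    closes on g itself. The square root is obtained afterwards as f g. *)
Lemma smooth_rsqrt (U : set V) (f : V -> R) : open U ->
  smooth_on U f -> (forall x, U x -> 0 < f x) ->
  smooth_on U (fun x => (Num.sqrt (f x))^-1).
Proof.
move=> oU sf f0; elim=> [|k IH].
  move=> x Ux; apply: differentiable_continuous.
  exact: (derive_rsqrt 0 (f0 x Ux) (smooth_differentiable sf Ux)).1.
split=> [x Ux|v].
  exact: (derive_rsqrt 0 (f0 x Ux) (smooth_differentiable sf Ux)).1.
set g := (fun x => (Num.sqrt (f x))^-1) in IH *.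
apply: (@of_class_C_ext _ _ (cst (- 2^-1) * (g * (g * g)) * 'D_v f)) => //.
  move=> x; rewrite inE => Ux.
  rewrite (derive_rsqrt v (f0 x Ux) (smooth_differentiable sf Ux)).2.
  by rewrite !exprS expr0 mulr1.
by do !apply: of_class_CM => //; [apply: smooth_cst | exact: (sf k.+1).2].
Qed.

Lemma smooth_sqrt (U : set V) (f : V -> R) : open U ->
  smooth_on U f -> (forall x, U x -> 0 < f x) ->
  smooth_on U (fun x => Num.sqrt (f x)).
Proof.
move=> oU sf f0.
apply: smooth_ext (smoothM oU sf (smooth_rsqrt oU sf f0)) => // x.
rewrite inE => /f0 fx0.
by rewrite -{1}(sqr_sqrtr (ltW fx0)) expr2 mulfK // gt_eqF // sqrtr_gt0.
Qed.

Lemma smooth_mx (p q : nat) (U : set V) (f : V -> 'M[R]_(p, q)) : open U ->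
  (forall i j, smooth_on U (fun x => f x i j)) -> smooth_on U f.
Proof.
move=> oU sf.
apply: (@smooth_ext _ _
  (fun x => \sum_i \sum_j f x i j *: (delta_mx i j : 'M[R]_(p, q)))) => //.
  by move=> x _; rewrite -matrix_sum_delta.
by do 2!apply: smooth_sum => // ?; exact: smoothZ.
Qed.

Lemma smooth_coord (p q : nat) (U : set V) (f : V -> 'M[R]_(p, q)) i j :
  open U -> smooth_on U f -> smooth_on U (fun x => f x i j).
Proof.
move=> oU sf k; elim: k f {sf}(sf k) => [|k IH] f /=.
  move=> cf x Ux.
  exact: (@continuous_comp _ _ _ f (fun M => M i j) _ (cf x Ux)
            (@coord_continuous _ _ _ _ _ _)).
move=> [df Cf]; split=> [x Ux|v].
  exact: (@differentiable_comp _ _ _ _ f (fun M => M i j) _ (df x Ux)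
            (@differentiable_coord _ _ _ _ _ _)).
apply: (@of_class_C_ext _ _ (fun x => ('D_v f x) i j)) => //; last exact: IH.
move=> x; rewrite inE => Ux; rewrite derive_mx ?mxE //.
exact/diff_derivable/df.
Qed.

Lemma derive_coord (p q : nat) (f : V -> 'M[R]_(p, q)) x v i j :
  derivable f x v -> ('D_v f x) i j = 'D_v (fun y => f y i j) x.
Proof. by move=> df; rewrite derive_mx // mxE. Qed.

(** A linear map out of a matrix space is a finite combination of coordinates, so continuity is not
    assumed; it is recovered later as the class 0 case of this lemma. *)
Lemma smooth_linear_mx (p q p' q' : nat) (U : set V) (f : V -> 'M[R]_(p, q))
    (L : {linear 'M[R]_(p, q) -> 'M[R]_(p', q')}) :
  open U -> smooth_on U f -> smooth_on U (fun x => L (f x)).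
Proof.
move=> oU sf.
apply: (@smooth_ext _ _
  (fun x => \sum_i \sum_j f x i j *: L (delta_mx i j))) => //.
  move=> x _; rewrite {2}(matrix_sum_delta (f x)) linear_sum.
  apply: eq_bigr => i _; rewrite linear_sum; apply: eq_bigr => j _.
  by rewrite linearZ.
by do 2!apply: smooth_sum => // ?; apply: smoothZ => //; exact: smooth_coord.
Qed.

Lemma smooth_id (U : set V) : smooth_on U (fun x : V => x).
Proof.
case=> [|k] /=; first by move=> x _.
split=> [x _|v]; first exact: ex_diff.
rewrite (_ : 'D_v _ = cst v); first exact: smooth_cst.
by apply/funext => x; exact: derive_id.
Qed.

Lemma derive_comp_diff (W W' : normedModType R) (f : W -> W') (g : V -> W) x v :
  differentiable g x -> differentiable f (g x) ->
  'D_v (fun y => f (g y)) x = 'D_('D_v g x) f (g x).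
Proof.
move=> dg df; rewrite (deriveE v dg) (deriveE _ df).
have dfg : differentiable (f \o g) x by exact: differentiable_comp.
by rewrite (deriveE v dfg) diff_comp.
Qed.

End SmoothMaps.

Lemma linear_mx_continuous (R : realType) (p q p' q' : nat)
  (L : {linear 'M[R]_(p, q) -> 'M[R]_(p', q')}) : continuous L.
Proof.
move=> M.
exact: (smooth_linear_mx L openT (@smooth_id _ _ setT) 0%N).
Qed.

Lemma derive_linear_mx (R : realType) (V : normedModType R) (p q p' q' : nat)
    (f : V -> 'M[R]_(p, q)) (L : {linear 'M[R]_(p, q) -> 'M[R]_(p', q')}) x v :
  differentiable f x -> 'D_v (fun y => L (f y)) x = L ('D_v f x).
Proof.
move=> df; have cL := @linear_mx_continuous _ _ _ _ _ L.
rewrite (derive_comp_diff v df (linear_differentiable _ cL)).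
by rewrite deriveE ?diff_lin //; exact: linear_differentiable.
Qed.

(** After reduction to a scalar outer function [h], the chain rule writes the derivative as a sum of
    coordinates of 'D_v g times partial derivatives of [h] composed with [g]. These are composites
    of the same shape, so the induction runs over all [h] with [g] fixed. *)
Lemma smooth_comp (R : realType) (V : normedModType R) (p q p' q' : nat)
    (U : set V) (U' : set 'M[R]_(p, q))
    (f : 'M[R]_(p, q) -> 'M[R]_(p', q')) (g : V -> 'M[R]_(p, q)) :
  open U -> open U' -> (forall x, U x -> U' (g x)) ->
  smooth_on U' f -> smooth_on U g -> smooth_on U (fun x => f (g x)).
Proof.
move=> oU oU' gU sf sg; apply: smooth_mx => // a b.
move: (smooth_coord a b oU' sf); set h := (fun _ => _) => sh.
change (smooth_on U (fun x => h (g x))); move: h sh => h {sf} sh k.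
elim: k h sh => [|k IH] h sh /=.
  move=> x Ux; apply: (@continuous_comp _ _ _ g h); first exact: (sg 0%N).
  exact/(sh 0%N)/gU.
have dg x : U x -> differentiable g x by exact: (smooth_differentiable sg).
have dh x : U x -> differentiable h (g x).
  by move=> Ux; apply: (smooth_differentiable sh); exact: gU.
split=> [x Ux|v].
  exact: (@differentiable_comp _ _ _ _ g h _ (dg x Ux) (dh x Ux)).
apply: (@of_class_C_ext _ _ _ _ (fun x => \sum_i \sum_j
    ('D_v g x) i j * 'D_(delta_mx i j) h (g x))) => //.
  move=> x; rewrite inE => Ux.
  rewrite (derive_comp_diff v (dg x Ux) (dh x Ux)).
  rewrite (deriveE _ (dh x Ux)) {2}(matrix_sum_delta ('D_v g x)) linear_sum.
  apply: eq_bigr => i _; rewrite linear_sum; apply: eq_bigr => j _.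
  by rewrite linearZ (deriveE _ (dh x Ux)).
have sDg : smooth_on U ('D_v g) by move=> l; exact: (sg l.+1).2.
have sDh w : smooth_on U' ('D_w h) by move=> l; exact: (sh l.+1).2.
do 2!apply: of_class_C_sum => // ?.
apply: of_class_CM => //; first exact: smooth_coord.
exact: (IH _ (sDh _)).
Qed.

(** * Linear algebra *)

Section DotProduct.
Variable R : realType.

Definition dot n (u v : 'cV[R]_n) : R := \sum_i u i 0 * v i 0.

Lemma trmx_mulE n (u v : 'cV[R]_n) : u^T *m v = (dot u v)%:M.
Proof.
apply/matrixP => i j; rewrite !ord1 !mxE eqxx mulr1n.
by apply: eq_bigr => k _; rewrite mxE.
Qed.

Lemma dotC n (u v : 'cV[R]_n) : dot u v = dot v u.
Proof. by apply: eq_bigr => i _; rewrite mulrC. Qed.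

Lemma dotDl n (u v w : 'cV[R]_n) : dot (u + v) w = dot u w + dot v w.
Proof. by rewrite -big_split; apply: eq_bigr => i _; rewrite mxE mulrDl. Qed.

Lemma dotZl n a (u v : 'cV[R]_n) : dot (a *: u) v = a * dot u v.
Proof. by rewrite mulr_sumr; apply: eq_bigr => i _; rewrite mxE mulrA. Qed.

Lemma dotNl n (u v : 'cV[R]_n) : dot (- u) v = - dot u v.
Proof. by rewrite -scaleN1r dotZl mulN1r. Qed.

Lemma dotBl n (u v w : 'cV[R]_n) : dot (u - v) w = dot u w - dot v w.
Proof. by rewrite dotDl dotNl. Qed.

Lemma dotDr n (u v w : 'cV[R]_n) : dot w (u + v) = dot w u + dot w v.
Proof. by rewrite dotC dotDl !(dotC w). Qed.

Lemma dotZr n a (u v : 'cV[R]_n) : dot v (a *: u) = a * dot v u.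
Proof. by rewrite dotC dotZl dotC. Qed.

Lemma dotNr n (u v : 'cV[R]_n) : dot v (- u) = - dot v u.
Proof. by rewrite dotC dotNl dotC. Qed.

Lemma dotBr n (u v w : 'cV[R]_n) : dot w (u - v) = dot w u - dot w v.
Proof. by rewrite dotDr dotNr. Qed.

Lemma dot0l n (u : 'cV[R]_n) : dot 0 u = 0.
Proof. by rewrite -(scale0r 0) dotZl mul0r. Qed.

Lemma dot0r n (u : 'cV[R]_n) : dot u 0 = 0.
Proof. by rewrite dotC dot0l. Qed.

Definition dotE := (dotDl, dotDr, dotBl, dotBr, dotNl, dotNr, dotZl, dotZr).

Lemma dot_mulmxl n p (g : 'M[R]_(n, p)) u v :
  dot (g *m u) v = dot u (g^T *m v).
Proof.
have : (g *m u)^T *m v = u^T *m (g^T *m v) by rewrite trmx_mul mulmxA.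
by rewrite !trmx_mulE => /matrixP/(_ 0 0); rewrite !mxE !mulr1n.
Qed.

Lemma dot_mulmx n p (g : 'M[R]_(p, n)) u v :
  g^T *m g = 1%:M -> dot (g *m u) (g *m v) = dot u v.
Proof. by move=> gg; rewrite dot_mulmxl mulmxA gg mul1mx. Qed.

Lemma dot_col_mx p q (u u' : 'cV[R]_p) (v v' : 'cV[R]_q) :
  dot (col_mx u v) (col_mx u' v') = dot u u' + dot v v'.
Proof.
rewrite /dot big_split_ord; congr (_ + _); apply: eq_bigr => i _.
  by rewrite !col_mxEu.
by rewrite !col_mxEd.
Qed.

Lemma dot_ge0 n (u : 'cV[R]_n) : 0 <= dot u u.
Proof. by apply: sumr_ge0 => i _; rewrite -expr2 sqr_ge0. Qed.

Lemma dot_eq0 n (u : 'cV[R]_n) : dot u u = 0 -> u = 0.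
Proof.
move=> /eqP; rewrite psumr_eq0; last by move=> i _; rewrite -expr2 sqr_ge0.
move=> /allP u0; apply/matrixP => i j; rewrite ord1 mxE.
by have := u0 i (mem_index_enum i); rewrite -expr2 sqrf_eq0 => /eqP.
Qed.

Lemma dot_delta n (i j : 'I_n) :
  dot (delta_mx i 0) (delta_mx j 0) = (i == j)%:R.
Proof.
rewrite /dot (bigD1 i) //= big1 => [|k ki]; rewrite !mxE !eqxx ?andbT.
  by rewrite mul1r addr0.
by rewrite (negbTE ki) mul0r.
Qed.

Lemma dot_deltal n (i : 'I_n) (v : 'cV[R]_n) : dot (delta_mx i 0) v = v i 0.
Proof.
rewrite /dot (bigD1 i) //= big1 => [|k ki]; rewrite !mxE !eqxx ?andbT.
  by rewrite mul1r addr0.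
by rewrite (negbTE ki) mul0r.
Qed.

Lemma cauchy_schwarz n (u v : 'cV[R]_n) :
  dot u v ^+ 2 <= dot u u * dot v v.
Proof.
have [/dot_eq0 -> | v0] := eqVneq (dot v v) 0.
  by rewrite !dot0r mulr0 expr0n.
have vp : 0 < dot v v by rewrite lt_def v0 dot_ge0.
have := dot_ge0 (dot v v *: u - dot u v *: v).
have -> : dot (dot v v *: u - dot u v *: v) (dot v v *: u - dot u v *: v) =
    dot v v * (dot u u * dot v v - dot u v ^+ 2).
  by rewrite !dotE (dotC v u); ring.
by rewrite pmulr_rge0 // subr_ge0.
Qed.

Lemma orthonormal2P n (x y : 'cV[R]_n) :
  orthonormal2 x y <-> [/\ dot x x = 1, dot y y = 1 & dot x y = 0].
Proof.
rewrite /orthonormal2 !trmx_mulE; split=> [[] | [-> -> ->]].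
  move=> /matrixP/(_ 0 0) + /matrixP/(_ 0 0) + /matrixP/(_ 0 0).
  by rewrite !mxE !mulr1n.
by split=> //; apply/matrixP => i j; rewrite !mxE mul0rn.
Qed.

Lemma wedgeE n (u v : 'cV[R]_n) i j :
  wedge u v i j = u i 0 * v j 0 - v i 0 * u j 0.
Proof. by rewrite !mxE !big_ord1 !mxE. Qed.

Lemma wedgeDl n (u v w : 'cV[R]_n) : wedge (u + v) w = wedge u w + wedge v w.
Proof. by apply/matrixP => i j; rewrite [RHS]mxE !wedgeE !mxE; ring. Qed.

Lemma wedgeZl n a (u v : 'cV[R]_n) : wedge (a *: u) v = a *: wedge u v.
Proof. by apply/matrixP => i j; rewrite [RHS]mxE !wedgeE !mxE; ring. Qed.

Lemma wedgeC n (u v : 'cV[R]_n) : wedge u v = - wedge v u.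
Proof. by rewrite /wedge opprB. Qed.

Lemma wedgeDr n (u v w : 'cV[R]_n) : wedge w (u + v) = wedge w u + wedge w v.
Proof. by rewrite wedgeC wedgeDl opprD -!(wedgeC w). Qed.

Lemma wedgeZr n a (u v : 'cV[R]_n) : wedge v (a *: u) = a *: wedge v u.
Proof. by rewrite wedgeC wedgeZl -scalerN -wedgeC. Qed.

Lemma wedgexx n (u : 'cV[R]_n) : wedge u u = 0.
Proof. by rewrite /wedge subrr. Qed.

Lemma wedge_rot n (x y : 'cV[R]_n) a b : a ^+ 2 + b ^+ 2 = 1 ->
  wedge (a *: x + b *: y) (- b *: x + a *: y) = wedge x y.
Proof.
move=> ab; apply/matrixP => i j; rewrite !wedgeE !mxE.
transitivity ((a ^+ 2 + b ^+ 2) * (x i 0 * y j 0 - y i 0 * x j 0)); first by ring.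
by rewrite ab mul1r.
Qed.

End DotProduct.

(** * Orthonormal families as columns of rotations *)

Section OrthogonalGroup.
Variable R : realType.

Lemma SO_trmx n (g : 'M[R]_n) : SO g -> SO g^T.
Proof.
by move=> [gg dg]; split; rewrite ?det_tr // trmxK; exact: mulmx1C.
Qed.

Lemma SO_trmxK n (g : 'M[R]_n) : SO g -> g^T *m g = 1%:M.
Proof. by case=> gg _; exact: mulmx1C. Qed.

Lemma SO_act_mul n (g h A : 'M[R]_n) :
  SO_act (g *m h) A = SO_act g (SO_act h A).
Proof. by rewrite /SO_act trmx_mul !mulmxA. Qed.

Lemma SO_actK n (g A : 'M[R]_n) : SO g -> SO_act g^T (SO_act g A) = A.
Proof.
move=> gSO; rewrite -SO_act_mul SO_trmxK // /SO_act.
by rewrite trmx1 mul1mx mulmx1.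
Qed.

Lemma SO_actVK n (g A : 'M[R]_n) : SO g -> SO_act g (SO_act g^T A) = A.
Proof. by move=> gSO; rewrite -{1}[g]trmxK SO_actK //; exact: SO_trmx. Qed.

Lemma Gr_SO_act n (g A : 'M[R]_n) : SO g -> Gr A -> Gr (SO_act g A).
Proof.
move=> gSO [x [y [/orthonormal2P[xx yy xy] ->]]].
exists (g *m x), (g *m y); split; last exact: SO_act_wedge.
by apply/orthonormal2P; rewrite !dot_mulmx //; exact: SO_trmxK.
Qed.

(** The witness is the reflection in the hyperplane orthogonal to u - v; when u = v there is no such
    hyperplane and the identity serves. *)
Lemma householder n (u v : 'cV[R]_n) : dot u u = dot v v ->
  exists h : 'M[R]_n, [/\ h *m h^T = 1%:M, h *m u = v &
    forall w, dot w u = 0 -> dot w v = 0 -> h *m w = w].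
Proof.
move=> uv; have [d0|d0] := eqVneq (dot (u - v) (u - v)) 0.
  exists 1%:M; split; rewrite ?trmx1 ?mulmx1 ?mul1mx //.
    by apply/eqP; rewrite -subr_eq0; apply/eqP; exact: dot_eq0.
  by move=> w _ _; rewrite mul1mx.
set d := u - v in d0 *; pose c := 2 / dot d d.
have hE w : (1%:M - c *: (d *m d^T)) *m w = w - (c * dot d w) *: d.
  rewrite mulmxBl mul1mx -scalemxAl -mulmxA trmx_mulE mul_mx_scalar.
  by rewrite scalerA.
have hT : (1%:M - c *: (d *m d^T))^T = 1%:M - c *: (d *m d^T).
  by rewrite linearB /= linearZ /= trmx1 trmx_mul trmxK.
exists (1%:M - c *: (d *m d^T)); split.
- have DD : (d *m d^T) *m (d *m d^T) = dot d d *: (d *m d^T).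
    by rewrite mulmxA -(mulmxA d) trmx_mulE mul_mx_scalar scalemxAl.
  rewrite hT mulmxBl mul1mx mulmxBr mulmx1 -scalemxAl -scalemxAr DD !scalerA.
  have -> : c * c * dot d d = 2 * c by rewrite /c; field.
  by apply/matrixP => i j; rewrite !mxE; ring.
- rewrite hE; have -> : c * dot d u = 1.
    rewrite /c; apply: (mulIf d0); rewrite mul1r mulrAC mulfVK //.
    rewrite /d !dotE uv (dotC v u); ring.
  by rewrite scale1r /d opprB addrC subrK.
- move=> w wu wv; rewrite hE dotC /d dotBr wu wv subrr mulr0 scale0r.
  by rewrite subr0.
Qed.

(** Induction on [k]: a matrix good for the first [k] vectors sends the next basis vector to a unit
    vector orthogonal to them, just as [x k] is; the reflection exchanging these two vectors leaves
    the earlier [x i] in place. *)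
Lemma orthogonal_frame n k (x : nat -> 'cV[R]_n) : (k <= n)%N ->
  (forall i j, (i < k)%N -> (j < k)%N -> dot (x i) (x j) = (i == j)%:R) ->
  exists2 g : 'M[R]_n, g *m g^T = 1%:M &
    forall i : 'I_n, (i < k)%N -> g *m delta_mx i 0 = x i.
Proof.
elim: k => [|k IH] kn ox; first by exists 1%:M; rewrite ?trmx1 ?mulmx1.
have [|g gg gx] := IH (ltnW kn).
  by move=> i j ik jk; apply: ox; exact: ltnW.
pose e : 'cV[R]_n := g *m delta_mx (Ordinal kn) 0.
have gg' := mulmx1C gg.
have [|h [hh he hw]] := @householder _ e (x k).
  by rewrite dot_mulmx // dot_delta eqxx ox // eqxx.
exists (h *m g).
  by rewrite trmx_mul mulmxA -(mulmxA h) gg mulmx1.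
move=> i; rewrite ltnS leq_eqVlt -mulmxA => /predU1P[ik|ik].
  by rewrite ik -he; congr (_ *m (_ *m delta_mx _ _)); apply: val_inj.
rewrite gx // hw //.
  rewrite -(gx i) // dot_mulmx // dot_delta.
  by rewrite -val_eqE /= (ltn_eqF ik).
by rewrite ox ?(ltn_eqF ik) // leqW.
Qed.

Lemma SO_frame n k (x : nat -> 'cV[R]_n) : (k < n)%N ->
  (forall i j, (i < k)%N -> (j < k)%N -> dot (x i) (x j) = (i == j)%:R) ->
  exists2 g : 'M[R]_n, SO g &
    forall i : 'I_n, (i < k)%N -> g *m delta_mx i 0 = x i.
Proof.
case: n x => // n x; rewrite ltnS => kn ox.
have [g gg gx] := orthogonal_frame (leqW kn) ox.
(* As fewer columns are prescribed than there are, the last one is free; scaling it by the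
   determinant, whose square is 1, corrects the orientation. *)
pose s : 'rV[R]_n.+1 := \row_i (if i == ord_max then \det g else 1).
have dg2 : \det g * \det g = 1 by rewrite -{2}det_tr -det_mulmx gg det1.
exists (g *m diag_mx s).
  split.
    rewrite trmx_mul tr_diag_mx mulmxA -(mulmxA g) mulmx_diag.
    rewrite (_ : diag_mx _ = 1%:M) ?mulmx1 //.
    apply/matrixP => i j; rewrite !mxE; case: (i == j) => //=.
    by case: (i == ord_max); rewrite ?mulr1 // dg2.
  rewrite det_mulmx det_diag (bigD1 ord_max) //= big1 => [|i /negbTE im].
    by rewrite mxE eqxx mulr1.
  by rewrite mxE im.
move=> i ik; rewrite -mulmxA -gx //; congr (_ *m _).
apply/matrixP => a b; rewrite mul_diag_mx !mxE ord1 eqxx andbT.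
case: (a =P i) => [->|]; rewrite ?mulr0 // mulr1 -val_eqE /=.
by rewrite ltn_eqF // (leq_trans ik).
Qed.

End OrthogonalGroup.

(** * Tangent vectors of the Grassmannian *)

Section Tangent.
Variable R : realType.

Definition gram n (u v : 'cV[R]_n) : R := dot u u * dot v v - dot u v ^+ 2.

(* Gram-Schmidt *)
Lemma Gr_gram n (u v : 'cV[R]_n) : 0 < gram u v ->
  Gr ((Num.sqrt (gram u v))^-1 *: wedge u v).
Proof.
move=> G0; have uu0 : 0 < dot u u.
  rewrite lt_def dot_ge0 andbT; apply/eqP => uu; move: G0.
  by rewrite /gram uu mul0r sub0r oppr_gt0 ltNge sqr_ge0.
set G := gram u v in G0 *.
have sG : Num.sqrt G ^+ 2 = G by rewrite sqr_sqrtr // ltW.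
have su : Num.sqrt (dot u u) ^+ 2 = dot u u by rewrite sqr_sqrtr // ltW.
have sG0 : Num.sqrt G != 0 by rewrite gt_eqF // sqrtr_gt0.
have su0 : Num.sqrt (dot u u) != 0 by rewrite gt_eqF // sqrtr_gt0.
pose s := Num.sqrt (dot u u).
exists (s^-1 *: u), ((s / Num.sqrt G) *: (v - (dot u v / dot u u) *: u)).
split; last first.
  rewrite wedgeZl wedgeZr wedgeDr -scaleNr wedgeZr wedgexx scaler0 addr0.
  by rewrite scalerA mulrA mulVf // mul1r.
have uun : dot u u != 0 by rewrite gt_eqF.
apply/orthonormal2P; split; rewrite !dotE.
- by rewrite mulrA -invfM -expr2 su mulVf.
- rewrite (dotC v u); transitivity (s ^+ 2 / Num.sqrt G ^+ 2 * (G / dot u u)).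
    by rewrite /G /gram; field; rewrite uun sG0.
  by rewrite su sG; field; rewrite uun gt_eqF.
- by rewrite mulfVK // subrr !mulr0.
Qed.

(** The curve is the normalized wedge of the lines x + t a and y + t b. [tangent] asks for a smooth
    curve defined at all times; the conditions on [a] and [b] reduce the Gram determinant to 1 + p
    t^2 + q t^4 with p, q >= 0, so the normalizing factor is smooth everywhere and stationary at t =
    0. *)
Lemma tangent_wedge n (x y a b : 'cV[R]_n) : orthonormal2 x y ->
  dot x a = 0 -> dot y b = 0 -> dot x b + dot y a = 0 ->
  tangent (@Gr R n) (wedge x y) (wedge a y + wedge x b).
Proof.
move=> /orthonormal2P[xx yy xy] xa yb xbya.
pose p := dot a a + dot b b; pose q := dot a a * dot b b - dot a b ^+ 2.
have p0 : 0 <= p by rewrite addr_ge0 ?dot_ge0.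
have q0 : 0 <= q by rewrite subr_ge0 cauchy_schwarz.
pose G (t : R) := 1 + p * (t * t) + q * ((t * t) * (t * t)).
have GE t : gram (x + t *: a) (y + t *: b) = G t.
  have ya : dot y a = - dot x b by apply/eqP; rewrite -addr_eq0 addrC xbya.
  rewrite /gram !dotE (dotC a x) (dotC b y) (dotC a y) xx yy xy xa yb ya /G /p /q.
  by ring.
have G0 t : 0 < G t.
  have tt0 : 0 <= t * t by rewrite -expr2 sqr_ge0.
  rewrite /G; apply: ltr_wpDr; first exact/mulr_ge0/mulr_ge0.
  by apply: ltr_wpDr; first exact: mulr_ge0.
pose W t := wedge (x + t *: a) (y + t *: b).
pose r t := (Num.sqrt (G t))^-1.
have sid : smooth_on setT (fun t : R => t) by exact: smooth_id.
have sc c : smooth_on setT (fun _ : R => c : R) by exact: smooth_cst.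
have sG : smooth_on setT G.
  by rewrite /G; do ![apply: smoothD | apply: smoothM]; try exact: openT.
have sr : smooth_on setT r by apply: smooth_rsqrt => //; exact: openT.
pose c t i j := wedge x y i j + (wedge a y + wedge x b) i j * t
                + wedge a b i j * (t * t).
have WE t i j : W t i j = c t i j.
  by rewrite /c /W [X in _ + X * t]mxE !wedgeE !mxE; ring.
have sW i j : smooth_on setT (fun t => W t i j).
  apply: (@smooth_ext _ _ _ _ (c^~ i ^~ j) _ openT); first by move=> t _; rewrite WE.
  by rewrite /c; do ![apply: smoothD | apply: smoothM]; try exact: openT.
exists (fun t => r t *: W t); split.
- apply: smooth_mx; first exact: openT.
  move=> i j; apply: smooth_ext openT _ (smoothM openT sr (sW i j)).
  by move=> t _; rewrite [RHS]mxE.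
- by move=> t; rewrite /r -GE; apply: Gr_gram; rewrite GE.
- by rewrite /r /G /W !mul0r !mulr0 !addr0 sqrtr1 invr1 scale1r !scale0r !addr0.
- have T0 : [set: R] 0 by [].
  have rd : derivable r 0 1.
    by apply: diff_derivable; apply: (smooth_differentiable sr T0).
  have cd i j : derivable (c^~ i ^~ j) 0 1.
    apply: diff_derivable; apply: (@smooth_differentiable _ _ _ setT _ _ _ T0).
    by rewrite /c; do ![apply: smoothD | apply: smoothM]; try exact: openT.
  have r'0 : 'D_1 r 0 = 0.
    have dG : differentiable G 0 by apply: (smooth_differentiable sG T0).
    rewrite /r (derive_rsqrt _ (G0 0) dG).2.
    suff -> : 'D_1 G 0 = 0 by rewrite mulr0.
    have : is_derive (0 : R) 1 G 0.
      by rewrite /G; apply: is_derive_eq; rewrite /GRing.scale /=; ring.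
    by move=> ?; exact: derive_val.
  have c'0 i j : 'D_1 (c^~ i ^~ j) 0 = (wedge a y + wedge x b) i j.
    have : is_derive (0 : R) 1 (c^~ i ^~ j) ((wedge a y + wedge x b) i j).
      by rewrite /c; apply: is_derive_eq; rewrite /GRing.scale /=; ring.
    by move=> ?; exact: derive_val.
  apply/matrixP => i j; rewrite derive_coord.
    rewrite (_ : (fun y => _) = r * (c^~ i ^~ j)); last first.
      by apply/funext => t; rewrite mxE WE.
    rewrite deriveM // r'0 c'0 scaler0 addr0 /r /G !mul0r !mulr0 !addr0.
    by rewrite sqrtr1 invr1 scale1r.
  apply/derivable_mxP => k l.
  rewrite (_ : (fun y => _) = r * (c^~ k ^~ l)); first exact: derivableM.
  by apply/funext => t; rewrite mxE WE.
Qed.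

End Tangent.

Section BasePoint.
Variables (R : realType) (m : nat).

Definition e1 : 'cV[R]_(2 + m) := delta_mx (lshift m 0) 0.
Definition e2 : 'cV[R]_(2 + m) := delta_mx (lshift m 1) 0.

Lemma orthonormal_e12 : orthonormal2 e1 e2.
Proof. by apply/orthonormal2P; rewrite !dot_delta !eqxx. Qed.

Lemma SO_frame2 (x y : 'cV[R]_(2 + m)) : (0 < m)%N -> orthonormal2 x y ->
  exists2 g, SO g & g *m e1 = x /\ g *m e2 = y.
Proof.
move=> m0 /orthonormal2P[xx yy xy].
have [||g gSO gx] := @SO_frame R _ 2 (fun k => if k is 0 then x else y).
- by rewrite -[X in (X < _)%N]addn0 ltn_add2l.
- by case=> [|[|i]] [|[|j]] // _ _; rewrite // dotC.
by exists g => //; split; rewrite gx.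
Qed.

Lemma Gr_plucker n (A : 'M[R]_n) a b k l : Gr A ->
  A a b * A k l - A a k * A b l + A a l * A b k = 0.
Proof. by move=> [x [y [_ ->]]]; rewrite !wedgeE; ring. Qed.

Lemma Gr_skew n (A : 'M[R]_n) i j : Gr A -> A i j + A j i = 0.
Proof. by move=> [x [y [_ ->]]]; rewrite !wedgeE; ring. Qed.

Lemma Gr_norm n (A : 'M[R]_n) : Gr A -> \sum_i \sum_j A i j * A i j = 2.
Proof.
move=> [x [y [/orthonormal2P[xx yy xy] ->]]].
transitivity (\sum_i (x i 0 * x i 0 * dot y y - (x i 0 * y i 0 * dot x y) *+ 2
   + y i 0 * y i 0 * dot x x)).
  apply: eq_bigr => i _; rewrite /dot !mulr_sumr -sumrMnl -sumrB -big_split /=.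
  by apply: eq_bigr => j _; rewrite wedgeE; ring.
rewrite xx yy xy; under eq_bigr => i _ do rewrite mulr0 mul0rn subr0 !mulr1.
by rewrite big_split /= -/(dot x x) -/(dot y y) xx yy.
Qed.

(* Differentiate the Pluecker relations, skew-symmetry and the norm. *)
Lemma tangent_e12 v : tangent (@Gr R (2 + m)) (wedge e1 e2) v ->
  [/\ v = wedge (v *m e2) e2 + wedge e1 (- (v *m e1)),
      dot e1 (v *m e2) = 0, dot e2 (v *m e2) = 0,
      dot e1 (v *m e1) = 0 & dot e2 (v *m e1) = 0].
Proof.
case=> gamma [sg Gg g0 g'0].
have T0 : [set: R] 0 by [].
have dg : derivable gamma 0 1.
  by apply: diff_derivable; apply: (smooth_differentiable sg T0).
have dgij i j : is_derive (0 : R) 1 (fun t => gamma t i j) (v i j).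
  apply: DeriveDef; first by move/derivable_mxP : dg.
  by rewrite -derive_coord // g'0.
pose i1 : 'I_(2 + m) := lshift m 0; pose i2 : 'I_(2 + m) := lshift m 1.
have A0 i j : wedge e1 e2 i j =
    (i == i1)%:R * (j == i2)%:R - (i == i2)%:R * (j == i1)%:R.
  by rewrite wedgeE !mxE !eqxx !andbT.
have skew i j : v i j = - v j i.
  have e : (fun t => gamma t i j) + (fun t => gamma t j i) = cst 0.
    by apply/funext => t /=; exact: Gr_skew.
  have := is_deriveD (dgij i j) (dgij j i); rewrite e => -[_].
  by rewrite derive_cst => /esym/eqP; rewrite addr_eq0 => /eqP.
(* Derivative of the Pluecker relation on the indices i1, i2, k, l: of its six entries only the one
   at (i1, i2) is nonzero at the base plane, so only [v k l] survives. *)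
have v0 k l : k != i1 -> k != i2 -> l != i1 -> l != i2 -> v k l = 0.
  move=> k1 k2 l1 l2.
  have e : ((fun t => gamma t i1 i2) * (fun t => gamma t k l)
    - (fun t => gamma t i1 k) * (fun t => gamma t i2 l))
    + (fun t => gamma t i1 l) * (fun t => gamma t i2 k) = cst 0.
    by apply/funext => t /=; exact: Gr_plucker.
  have : is_derive (0 : R) 1 (cst (0 : R)) (v k l).
    rewrite -e; apply: is_derive_eq.
    rewrite g0 !A0 !eqxx (negbTE k1) (negbTE k2) (negbTE l1) (negbTE l2).
    by rewrite /GRing.scale /=; ring.
  by case=> _; rewrite derive_cst.
(* Constancy of the norm makes [v] orthogonal to [wedge e1 e2]; by skew-symmetry this says that 4
   times the entry is 0. *)
have v12 : v i1 i2 = 0.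
  have e : \sum_i \sum_j ((fun t => gamma t i j) * (fun t => gamma t i j))
      = cst (2 : R).
    apply/funext => t /=; rewrite fct_sumE -(Gr_norm (Gg t)).
    by apply: eq_bigr => i _; rewrite fct_sumE.
  have : is_derive (0 : R) 1 (cst (2 : R))
      (\sum_i \sum_j (wedge e1 e2 i j * v i j) *+ 2).
    rewrite -e; apply: is_derive_eq.
    by do 2![apply: eq_bigr => ? _]; rewrite g0 /GRing.scale /= mulr2n.
  case=> _; rewrite derive_cst => /esym.
  have S a b :
      \sum_i \sum_j (i == a)%:R * (j == b)%:R * v i j *+ 2 = v a b *+ 2.
    rewrite (bigD1 a) //= [X in _ + X]big1 ?addr0 => [|i /negbTE ia].
      rewrite (bigD1 b) //= [X in _ + X]big1 ?addr0 => [|j /negbTE jb].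
        by rewrite !eqxx !mul1r.
      by rewrite jb mulr0 mul0r mul0rn.
    by rewrite big1 // => j _; rewrite ia !mul0r mul0rn.
  rewrite (_ : \sum_i _ = v i1 i2 *+ 2 - v i2 i1 *+ 2); last first.
    rewrite -!S -sumrB; apply: eq_bigr => i _; rewrite -sumrB.
    by apply: eq_bigr => j _; rewrite A0 mulrBl mulrnBl.
  rewrite (skew i2 i1) mulNrn opprK -mulrnDr => /eqP.
  by rewrite mulrn_eq0 => /eqP.
have v11 i : v i i = 0 by have := skew i i; lra.
have v21 : v i2 i1 = 0 by rewrite skew v12 oppr0.
rewrite /e1 /e2 -!colE !dot_deltal; split; rewrite ?mxE //.
apply/matrixP => i j; rewrite mxE !wedgeE !mxE !eqxx !andbT -/i1 -/i2.
have i12 : (i1 == i2) = false by [].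
have i21 : (i2 == i1) = false by [].
have [->|ni1] := eqVneq i i1.
  have [->|nj1] := eqVneq j i1; first by rewrite i12 v11 v12 /=; ring.
  have [->|nj2] := eqVneq j i2; first by rewrite i12 v11 v12 v21 /=; ring.
  by rewrite i12 (skew i1 j) v11 /=; ring.
have [->|ni2] := eqVneq i i2.
  have [->|nj1] := eqVneq j i1; first by rewrite i12 v11 v12 v21 /=; ring.
  have [->|nj2] := eqVneq j i2; first by rewrite v11 v21 /=; ring.
  by rewrite (skew i2 j) v21 /=; ring.
have [->|nj1] := eqVneq j i1; first by rewrite i12 /=; ring.
have [->|nj2] := eqVneq j i2; first by rewrite /=; ring.
by rewrite v0 //=; ring.
Qed.

End BasePoint.

(** * Rotation-invariant bilinear forms *)

Section InvariantForm.
Variable R : realType.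

Lemma bilinear_sum n (b : 'cV[R]_n -> R) (u : 'cV[R]_n) :
  (forall c v w, b (c *: v + w) = c * b v + b w) ->
  b u = \sum_i u i 0 * b (delta_mx i 0).
Proof.
move=> bl; have b0 : b 0 = 0.
  by have := bl (-1) 0 0; rewrite scaler0 addr0 mulN1r addNr.
rewrite {1}(matrix_sum_delta u).
elim/big_rec2: _ => [//|i a w _ IH].
by rewrite big_ord1 bl IH.
Qed.

(** Symmetry of [b] is not assumed. As n > 2, rotations carry (e_0, e_1) both to (e_i, e_j) and to
    (- e_i, e_j), so off-diagonal values equal their opposites; in dimension 2 the area form would
    survive. The factor is produced as a value [b u0 u0] so that alternation will later make it
    0. *)
Lemma SO_invariant_bilinear n (b : 'cV[R]_n -> 'cV[R]_n -> R) : (2 < n)%N ->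
  (forall c u v w, b (c *: u + v) w = c * b u w + b v w) ->
  (forall c u v w, b w (c *: u + v) = c * b w u + b w v) ->
  (forall g u v, SO g -> b (g *m u) (g *m v) = b u v) ->
  exists2 u0 : 'cV[R]_n, dot u0 u0 = 1 & forall u v, b u v = b u0 u0 * dot u v.
Proof.
move=> n2 bl br bg.
pose i0 : 'I_n := Ordinal (ltnW (ltnW n2)); pose i1 : 'I_n := Ordinal (ltnW n2).
exists (delta_mx i0 0); first by rewrite dot_delta eqxx.
have b_diag i : b (delta_mx i 0) (delta_mx i 0) =
                b (delta_mx i0 0) (delta_mx i0 0).
  have [||g gSO gi] := @SO_frame R n 1 (fun=> delta_mx i 0).
  - exact: ltnW.
  - by move=> [|k] [|l] //; rewrite dot_delta eqxx.
  by rewrite -[RHS](bg g) // gi.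
have b_off i j (c : R) : i != j -> c * c = 1 ->
    b (c *: delta_mx i 0) (delta_mx j 0) =
    b (delta_mx i0 0) (delta_mx i1 0).
  move=> ij cc.
  have [||g gSO gi] := @SO_frame R n 2
    (fun k => if k is 0 then c *: delta_mx i 0 else delta_mx j 0).
  - exact: n2.
  - by move=> [|[|k]] [|[|l]] // _ _; rewrite ?dotE !dot_delta ?eqxx
      ?(negbTE ij) ?(eq_sym j) ?(negbTE ij) ?mulr1 ?mulr0.
  by rewrite -[RHS](bg g) // !gi.
have b_offE i j : i != j -> b (delta_mx i 0) (delta_mx j 0) = 0.
  move=> ij; have := b_off i j (-1) ij; have := b_off i j 1 ij.
  rewrite mulrNN mulr1 scale1r => -> // /(_ erefl) e.
  have := bl (-1) (delta_mx i 0) 0 (delta_mx j 0).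
  have b0 : b 0 (delta_mx j 0) = 0.
    by have := bl (-1) 0 0 (delta_mx j 0); rewrite scaler0 addr0 mulN1r addNr.
  rewrite b0 !addr0 e -[in RHS](scale1r (delta_mx i 0)) b_off ?mulr1 //.
  by move=> /eqP; rewrite mulN1r -subr_eq0 opprK -mulr2n mulrn_eq0 => /eqP.
move=> u v; rewrite (@bilinear_sum n (b^~ v)) // /dot mulr_sumr.
apply: eq_bigr => i _; rewrite mulrCA; congr (_ * _).
rewrite (@bilinear_sum n (b _)) // (bigD1 i) //= big1 => [|j ji].
  by rewrite addr0 b_diag mulrC.
by rewrite b_offE ?mulr0 // eq_sym.
Qed.

End InvariantForm.

(** * The chart of the half A_12 > 0 *)

(** The pullback computation with derivatives replaced by numbers: [uk1], [uk2], [ub] stand for the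
    derivatives along u of the coefficients of 1 + N, [uD] and [uA] for those of det (1 + N) and det
    N, and the hypotheses are the constraints and their derivatives. The claim becomes an identity
    of rational functions. *)
Lemma symplectic_identity (R : realType) (m : nat)
    (p q u1 u2 v1 v2 : 'cV[R]_m) (k1 k2 b w : R)
    (uk1 uk2 ub uD uA vk1 vk2 vb vD vA : R) :
  let D := k1 * k2 - b ^+ 2 in let A := (k1 - 1) * (k2 - 1) - b ^+ 2 in
  D != 0 -> w * w = D^-1 ->
  dot p p = 1 - A + k2 - k1 -> dot q q = 1 - A + k1 - k2 -> dot p q = 2 * b ->
  uD = k1 * uk2 + k2 * uk1 - 2 * b * ub ->
  uA = (k1 - 1) * uk2 + (k2 - 1) * uk1 - 2 * b * ub ->
  vD = k1 * vk2 + k2 * vk1 - 2 * b * vb ->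
  vA = (k1 - 1) * vk2 + (k2 - 1) * vk1 - 2 * b * vb ->
  dot p u1 = (uk2 - uk1 - uA) / 2 -> dot q u2 = (uk1 - uk2 - uA) / 2 ->
  dot p u2 = 2 * ub - dot q u1 ->
  dot p v1 = (vk2 - vk1 - vA) / 2 -> dot q v2 = (vk1 - vk2 - vA) / 2 ->
  dot p v2 = 2 * vb - dot q v1 ->
  let xi dD dk1 db (a1 a2 : 'cV[R]_m) :=
    (- 2^-1 * D^-1 * dD) *: (k1 *: p - b *: q) +
    (dk1 *: p + k1 *: a1 - (db *: q + b *: a2)) in
  let eta dD dk2 db (a1 a2 : 'cV[R]_m) :=
    (- 2^-1 * D^-1 * dD) *: (k2 *: q - b *: p) +
    (dk2 *: q + k2 *: a2 - (db *: p + b *: a1)) in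
  dot (w *: xi uD uk1 ub u1 u2) (w *: eta vD vk2 vb v1 v2)
  - dot (w *: eta uD uk2 ub u1 u2) (w *: xi vD vk1 vb v1 v2)
  + (uk1 * - vb - - ub * vk1 + (- ub * vk2 - uk2 * - vb))
  = dot u1 v2 - dot u2 v1.
Proof.
move=> D A D0 ww pp qq pq uDE uAE vDE vAE pu1 qu2 pu2 pv1 qv2 pv2 xi eta.
(* The square root [w] occurs twice in each product, hence only through w * w. *)
rewrite !dotZl !dotZr !mulrA ww /xi /eta !dotE.
rewrite (dotC q p) (dotC u1 p) (dotC u1 q) (dotC u2 p) (dotC u2 q).
rewrite pp qq pq pu1 qu2 pu2 pv1 qv2 pv2 uDE uAE vDE vAE.
(* The six inner products that the constraints leave free become atoms for [field]. *)
move: (dot q u1) (dot q v1) (dot u1 v1) (dot u1 v2) (dot u2 v1) (dot u2 v2).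
move=> a1 a2 a3 a4 a5 a6.
rewrite /A /D; field.
exact: D0.
Qed.

Lemma derive_sqrt_comp (R : realType) (V : normedModType R) (f : V -> R) x v :
  0 < f x -> differentiable f x ->
  'D_v (fun y => Num.sqrt (f y)) x = 'D_v f x / (2 * Num.sqrt (f x)).
Proof.
move=> f0 df.
have dsqrt : differentiable (@Num.sqrt R) (f x).
  by apply/derivable1_diffP; apply: ex_derive; exact: is_derive1_sqrt.
rewrite (derive_comp_diff v df dsqrt) (deriveE _ dsqrt) deriv1E.
  by rewrite derive1E derive_sqrt.
exact/derivable1_diffP.
Qed.

Section Frame.
Variables (R : realType) (m : nat).
Implicit Types (z u : 'cV[R]_(m + m)) (p q : 'cV[R]_m) (s t : R).

Definition fvec s t p : 'cV[R]_(2 + m) :=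
  col_mx (\col_i if i == 0 then s else t) p.

Lemma fvec0E s t p : fvec s t p (lshift m 0) 0 = s.
Proof. by rewrite col_mxEu mxE. Qed.

Lemma fvec1E s t p : fvec s t p (lshift m 1) 0 = t.
Proof. by rewrite col_mxEu mxE. Qed.

Lemma fvec2E s t p i : fvec s t p (rshift 2 i) 0 = p i 0.
Proof. by rewrite col_mxEd. Qed.

Lemma fvec_eqP (x y : 'cV[R]_(2 + m)) :
  x (lshift m 0) 0 = y (lshift m 0) 0 -> x (lshift m 1) 0 = y (lshift m 1) 0 ->
  (forall i, x (rshift 2 i) 0 = y (rshift 2 i) 0) -> x = y.
Proof.
move=> xy0 xy1 xy2; apply/matrixP => i j; rewrite ord1.
case: (split_ordP i) => k -> //; case: k => [[|[|k]] hk] //.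
  by rewrite (_ : Ordinal hk = 0) //; exact: val_inj.
by rewrite (_ : Ordinal hk = 1) //; exact: val_inj.
Qed.

Lemma dot_fvec s t p s' t' p' :
  dot (fvec s t p) (fvec s' t' p') = s * s' + t * t' + dot p p'.
Proof.
rewrite dot_col_mx; congr (_ + _).
by rewrite /dot !big_ord_recl big_ord0 !mxE /= addr0.
Qed.

(** By Cayley-Hamilton the equation for N reads Z^T Z = (1 + tr N - det N) - 2 N. Its trace gives
    det N = [sqA]; its traceless part gives N up to tr N / 2, in terms of [sqR] + i [sqI], which is
    the sum of the z_k^2. The value of det N then fixes tr N / 2 as the positive square root
    [sqP]. *)
Definition sqA z := 1 - (dot (usubmx z) (usubmx z) + dot (dsubmx z) (dsubmx z)) / 2.
Definition sqR z := dot (usubmx z) (usubmx z) - dot (dsubmx z) (dsubmx z).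
Definition sqI z := 2 * dot (usubmx z) (dsubmx z).
Definition sqP z := Num.sqrt (sqA z + (sqR z ^+ 2 + sqI z ^+ 2) / 16).
Definition fk1 z := 1 + sqP z - sqR z / 4.
Definition fk2 z := 1 + sqP z + sqR z / 4.
Definition fkb z := sqI z / 4.
Definition fkD z := 1 + 2 * sqP z + sqA z.

(* 1 + N = [[fk1, - fkb], [- fkb, fk2]], det (1 + N) = fkD, det N = sqA and
   tr N = 2 sqP. *)
Definition frameX z :=
  fvec (fk1 z - 1) (- fkb z)
    ((Num.sqrt (fkD z))^-1 *: (fk1 z *: usubmx z - fkb z *: dsubmx z)).
Definition frameY z :=
  fvec (- fkb z) (fk2 z - 1)
    ((Num.sqrt (fkD z))^-1 *: (fk2 z *: dsubmx z - fkb z *: usubmx z)).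

Notation B := (@Cball R m (Num.sqrt 2)).

(** Origin of the radius: |z|^2 < 2 is exactly positivity of det N. *)
Lemma CballP z : B z <-> 0 < sqA z.
Proof.
rewrite /Cball /= sqr_sqrtr // big_split_ord /= /sqA.
have -> : dot (usubmx z) (usubmx z) = \sum_(i < m) z (lshift m i) 0 ^+ 2.
  by apply: eq_bigr => i _; rewrite mxE expr2.
have -> : dot (dsubmx z) (dsubmx z) = \sum_(i < m) z (rshift m i) 0 ^+ 2.
  by apply: eq_bigr => i _; rewrite mxE expr2.
by split=> h; lra.
Qed.

Lemma sqP_rad_gt0 z : B z -> 0 < sqA z + (sqR z ^+ 2 + sqI z ^+ 2) / 16.
Proof.
by move=> /CballP A0; rewrite ltr_wpDr // divr_ge0 // addr_ge0 // sqr_ge0.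
Qed.

Lemma sqP_gt0 z : B z -> 0 < sqP z.
Proof. by move=> /sqP_rad_gt0; rewrite sqrtr_gt0. Qed.

Lemma sqP2 z : B z -> sqP z ^+ 2 = sqA z + (sqR z ^+ 2 + sqI z ^+ 2) / 16.
Proof. by move=> /sqP_rad_gt0/ltW; exact: sqr_sqrtr. Qed.

Lemma fkD_gt0 z : B z -> 0 < fkD z.
Proof.
move=> Bz; have /CballP A0 := Bz; have P0 := sqP_gt0 Bz.
by rewrite /fkD; lra.
Qed.

Lemma fkDE z : B z -> fkD z = fk1 z * fk2 z - fkb z ^+ 2.
Proof.
move=> /sqP2 P2; rewrite /fkD /fk1 /fk2 /fkb.
have -> : sqA z = sqP z ^+ 2 - (sqR z ^+ 2 + sqI z ^+ 2) / 16 by rewrite P2; ring.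
by field.
Qed.

Lemma sqAE z : B z -> sqA z = (fk1 z - 1) * (fk2 z - 1) - fkb z ^+ 2.
Proof.
move=> /sqP2 P2; rewrite /fk1 /fk2 /fkb.
have -> : sqA z = sqP z ^+ 2 - (sqR z ^+ 2 + sqI z ^+ 2) / 16 by rewrite P2; ring.
by field.
Qed.

Lemma dot_uuE z : dot (usubmx z) (usubmx z) = 1 - sqA z + fk2 z - fk1 z.
Proof. by rewrite /fk1 /fk2 /sqA /sqR; field. Qed.

Lemma dot_ddE z : dot (dsubmx z) (dsubmx z) = 1 - sqA z + fk1 z - fk2 z.
Proof. by rewrite /fk1 /fk2 /sqA /sqR; field. Qed.

Lemma dot_udE z : dot (usubmx z) (dsubmx z) = 2 * fkb z.
Proof. by rewrite /fkb /sqI; field. Qed.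

Lemma rsqrt2 (x : R) : 0 < x -> (Num.sqrt x)^-1 * (Num.sqrt x)^-1 = x^-1.
Proof. by move=> x0; rewrite -invfM -expr2 sqr_sqrtr // ltW. Qed.

Lemma orthonormal_frame z : B z -> orthonormal2 (frameX z) (frameY z).
Proof.
move=> Bz; have D0 := fkD_gt0 Bz; have ww := rsqrt2 D0.
have D1 : fk1 z * fk2 z - fkb z ^+ 2 != 0 by rewrite -fkDE // gt_eqF.
apply/orthonormal2P; rewrite !dot_fvec !dotZl !dotZr !mulrA ww !dotE.
rewrite (dotC (dsubmx z) (usubmx z)) dot_uuE dot_ddE dot_udE sqAE // fkDE //.
by split; field.
Qed.

Lemma smooth_usubmx (W : normedModType R) (U : set W) (f : W -> 'cV[R]_(m + m)) i :
  open U -> smooth_on U f -> smooth_on U (fun x => usubmx (f x) i 0).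
Proof.
move=> oU sf; apply: smooth_ext oU _ (smooth_coord (lshift m i) 0 oU sf).
by move=> x _; rewrite [RHS]mxE.
Qed.

Lemma smooth_dsubmx (W : normedModType R) (U : set W) (f : W -> 'cV[R]_(m + m)) i :
  open U -> smooth_on U f -> smooth_on U (fun x => dsubmx (f x) i 0).
Proof.
move=> oU sf; apply: smooth_ext oU _ (smooth_coord (rshift m i) 0 oU sf).
by move=> x _; rewrite [RHS]mxE.
Qed.

Let smuu (U : set 'cV[R]_(m + m)) : open U ->
  smooth_on U (fun z => dot (usubmx z) (usubmx z)).
Proof.
move=> oU; apply: smooth_sum => // i.
by apply: smoothM => //; apply: smooth_usubmx => //; exact: smooth_id.
Qed.

Let smdd (U : set 'cV[R]_(m + m)) : open U ->
  smooth_on U (fun z => dot (dsubmx z) (dsubmx z)).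
Proof.
move=> oU; apply: smooth_sum => // i.
by apply: smoothM => //; apply: smooth_dsubmx => //; exact: smooth_id.
Qed.

Let smud (U : set 'cV[R]_(m + m)) : open U ->
  smooth_on U (fun z => dot (usubmx z) (dsubmx z)).
Proof.
move=> oU; apply: smooth_sum => // i.
by apply: smoothM => //; [apply: smooth_usubmx => //|apply: smooth_dsubmx => //];
  exact: smooth_id.
Qed.

Lemma smooth_sqA (U : set 'cV[R]_(m + m)) : open U -> smooth_on U sqA.
Proof.
move=> oU; apply: smoothB => //; first exact: smooth_cst.
apply: smoothM => //; last exact: smooth_cst.
by apply: smoothD => //; [exact: smuu | exact: smdd].
Qed.

Lemma open_Cball (r : R) : open (@Cball R m r).
Proof.
have c : continuous (fun z : 'cV[R]_(m + m) => \sum_i z i 0 ^+ 2).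
  move=> z; apply: differentiable_continuous.
  apply: (@smooth_differentiable _ _ _ setT) => //.
  apply: smooth_sum; first exact: openT.
  move=> i; apply: (@smoothM _ _ _ _ (fun z : 'cV[R]_(m + m) => z i 0));
    try exact: openT; apply: smooth_coord; try exact: openT; exact: smooth_id.
exact: (@open_comp _ _ (fun z : 'cV[R]_(m + m) => \sum_i z i 0 ^+ 2)
  [set x | x < r ^+ 2] (fun z _ => c z) (@open_lt R (r ^+ 2))).
Qed.

Let oB : open B. Proof. exact: open_Cball. Qed.

Lemma smooth_sqR : smooth_on B sqR.
Proof. by apply: smoothB => //; [exact: smuu | exact: smdd]. Qed.

Lemma smooth_sqI : smooth_on B sqI.
Proof. by apply: smoothMl => //; exact: smud. Qed.

Lemma smooth_sqP_rad :
  smooth_on B (fun z => sqA z + (sqR z ^+ 2 + sqI z ^+ 2) / 16).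
Proof.
apply: smoothD => //; first exact: smooth_sqA.
apply: smoothM => //; last exact: smooth_cst.
have sR := smooth_sqR; have sI := smooth_sqI.
by apply: smoothD => //; apply: smoothM.
Qed.

Lemma smooth_sqP : smooth_on B sqP.
Proof. exact: smooth_sqrt oB smooth_sqP_rad sqP_rad_gt0. Qed.

Lemma smooth_fk1 : smooth_on B fk1.
Proof.
apply: smoothB => //; last first.
  by apply: smoothM => //; [exact: smooth_sqR | exact: smooth_cst].
by apply: smoothD => //; [exact: smooth_cst|exact: smooth_sqP].
Qed.

Lemma smooth_fk2 : smooth_on B fk2.
Proof.
apply: smoothD => //; last first.
  by apply: smoothM => //; [exact: smooth_sqR | exact: smooth_cst].
by apply: smoothD => //; [exact: smooth_cst|exact: smooth_sqP].
Qed.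

Lemma smooth_fkb : smooth_on B fkb.
Proof. by apply: smoothM => //; [exact: smooth_sqI|exact: smooth_cst]. Qed.

Lemma smooth_fkD : smooth_on B fkD.
Proof.
apply: smoothD => //; last exact: smooth_sqA.
apply: smoothD => //; first exact: smooth_cst.
by apply: smoothMl => //; exact: smooth_sqP.
Qed.

Lemma smooth_rsqrt_fkD : smooth_on B (fun z => (Num.sqrt (fkD z))^-1).
Proof. exact: smooth_rsqrt oB smooth_fkD fkD_gt0. Qed.

Lemma smooth_fvec (W : normedModType R) (U : set W) (s t : W -> R)
    (f : W -> 'cV[R]_m) :
  open U -> smooth_on U s -> smooth_on U t ->
  (forall i, smooth_on U (fun x => f x i 0)) ->
  smooth_on U (fun x => fvec (s x) (t x) (f x)).
Proof.
move=> oU ss st sf; apply: smooth_mx => // i j; rewrite ord1.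
case: (split_ordP i) => k ->; last first.
  by apply: smooth_ext oU _ (sf k) => x _; rewrite col_mxEd.
have [->|k0] := eqVneq k 0.
  by apply: smooth_ext oU _ ss => x _; rewrite fvec0E.
by apply: smooth_ext oU _ st => x _; rewrite col_mxEu mxE (negbTE k0).
Qed.

Lemma smooth_frameX : smooth_on B frameX.
Proof.
apply: smooth_fvec => //.
- by apply: smoothB => //; [exact: smooth_fk1|exact: smooth_cst].
- by apply: smoothN => //; exact: smooth_fkb.
move=> i; apply: (@smooth_ext _ _ _ _ (fun z => (Num.sqrt (fkD z))^-1 *
    (fk1 z * usubmx z i 0 - fkb z * dsubmx z i 0))) => //.
  by move=> z _; rewrite !mxE.
apply: smoothM => //; first exact: smooth_rsqrt_fkD.
apply: smoothB => //; apply: smoothM => //.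
- exact: smooth_fk1.
- by apply: smooth_usubmx => //; exact: smooth_id.
- exact: smooth_fkb.
- by apply: smooth_dsubmx => //; exact: smooth_id.
Qed.

Lemma smooth_frameY : smooth_on B frameY.
Proof.
apply: smooth_fvec => //.
- by apply: smoothN => //; exact: smooth_fkb.
- by apply: smoothB => //; [exact: smooth_fk2|exact: smooth_cst].
move=> i; apply: (@smooth_ext _ _ _ _ (fun z => (Num.sqrt (fkD z))^-1 *
    (fk2 z * dsubmx z i 0 - fkb z * usubmx z i 0))) => //.
  by move=> z _; rewrite !mxE.
apply: smoothM => //; first exact: smooth_rsqrt_fkD.
apply: smoothB => //; apply: smoothM => //.
- exact: smooth_fk2.
- by apply: smooth_dsubmx => //; exact: smooth_id.
- exact: smooth_fkb.
- by apply: smooth_usubmx => //; exact: smooth_id.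
Qed.

End Frame.

(** * Moving frames and the tangent space at the base plane *)

Section KirillovForm.
Variables (R : realType) (m : nat).
Implicit Types (p q : 'cV[R]_m) (x y a b u v : 'cV[R]_(2 + m)).

Definition lift2 p : 'cV[R]_(2 + m) := col_mx 0 p.

(* [a] and [b] are the velocities of a moving orthonormal frame at (x, y). *)
Definition frame_velocity n (x y a b : 'cV[R]_n) : Prop :=
  [/\ dot x a = 0, dot y b = 0 & dot x b + dot y a = 0].

Lemma e1E : e1 R m = col_mx (delta_mx 0 0) 0.
Proof.
apply/matrixP => i j; rewrite ord1 mxE; case: (split_ordP i) => k ->.
  by rewrite col_mxEu mxE (inj_eq (@lshift_inj _ _)).
by rewrite col_mxEd mxE eq_sym eq_lrshift.
Qed.

Lemma e2E : e2 R m = col_mx (delta_mx 1 0) 0.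
Proof.
apply/matrixP => i j; rewrite ord1 mxE; case: (split_ordP i) => k ->.
  by rewrite col_mxEu mxE (inj_eq (@lshift_inj _ _)).
by rewrite col_mxEd mxE eq_sym eq_lrshift.
Qed.

Lemma lift2_split u :
  u = dot (e1 R m) u *: e1 R m + dot (e2 R m) u *: e2 R m + lift2 (dsubmx u).
Proof.
rewrite /e1 /e2 !dot_deltal -{1}(vsubmxK u).
rewrite -/(e1 R m) -/(e2 R m) e1E e2E !scale_col_mx !scaler0 !add_col_mx.
rewrite !addr0 add0r; congr col_mx; apply/matrixP => i j; rewrite ord1 !mxE.
have [->|->] : i = 0 \/ i = 1.
  by case: i => [[|[|//]] hi]; [left | right]; exact: val_inj.
  by rewrite /= mulr1 mulr0 addr0.
by rewrite /= mulr1 mulr0 add0r.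
Qed.

Lemma dot_e1_lift2 p : dot (e1 R m) (lift2 p) = 0.
Proof. by rewrite e1E dot_col_mx dot0l dot0r addr0. Qed.

Lemma dot_e2_lift2 p : dot (e2 R m) (lift2 p) = 0.
Proof. by rewrite e2E dot_col_mx dot0l dot0r addr0. Qed.

Lemma dot_lift2 p q : dot (lift2 p) (lift2 q) = dot p q.
Proof. by rewrite dot_col_mx dot0l add0r. Qed.

(** Tangent vectors at the base plane are encoded as pairs (p, q), the velocities of [e1] and [e2]
    transverse to the plane. *)
Definition base_tangent p q :=
  wedge (lift2 p) (e2 R m) + wedge (e1 R m) (lift2 q).

Lemma base_tangentP p q :
  tangent (@Gr R (2 + m)) (wedge (e1 R m) (e2 R m)) (base_tangent p q).
Proof.
apply: tangent_wedge; first exact: orthonormal_e12.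
- exact: dot_e1_lift2.
- exact: dot_e2_lift2.
by rewrite dot_e1_lift2 dot_e2_lift2 addr0.
Qed.

(** The in-plane part of [a] is a multiple of [e2] and that of [b] a multiple of [e1]. Wedging with
    [e2], respectively [e1], removes them, and in the pairing they meet orthogonal vectors only. *)
Lemma frame_velocity_e12 a b : frame_velocity (e1 R m) (e2 R m) a b ->
  wedge a (e2 R m) + wedge (e1 R m) b = base_tangent (dsubmx a) (dsubmx b) /\
  forall a' b', frame_velocity (e1 R m) (e2 R m) a' b' ->
    dot a b' - dot b a' =
    dot (dsubmx a) (dsubmx b') - dot (dsubmx b) (dsubmx a').
Proof.
move=> [a1 b2 ab].
have aE := lift2_split a; have bE := lift2_split b.
rewrite a1 scale0r add0r in aE; rewrite b2 scale0r addr0 in bE.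
split=> [|a' b' [a1' b2' ab']].
  rewrite {1}aE {1}bE wedgeDl wedgeZl wedgeDr wedgeZr !wedgexx !scaler0 !add0r.
  by [].
have aE' := lift2_split a'; have bE' := lift2_split b'.
rewrite a1' scale0r add0r in aE'; rewrite b2' scale0r addr0 in bE'.
have /orthonormal2P[_ _ e12] := orthonormal_e12 R m.
rewrite {1}aE {1}bE {1}aE' {1}bE' !dotE !dot_lift2.
rewrite !(dotC (lift2 _) (e1 R m)) !(dotC (lift2 _) (e2 R m)).
rewrite !dot_e1_lift2 !dot_e2_lift2 (dotC (e2 R m) (e1 R m)) e12.
by rewrite !mulr0 !addr0 !mulr0 !add0r.
Qed.

End KirillovForm.

(** * Derivative of the frame and pullback of the Kirillov form *)

Section FrameDerivative.
Variables (R : realType) (m : nat).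
Implicit Types (z u v : 'cV[R]_(m + m)).
Notation B := (@Cball R m (Num.sqrt 2)).

Lemma derive_usubmx z u i :
  is_derive z u (fun y : 'cV[R]_(m + m) => usubmx y i 0) (usubmx u i 0).
Proof.
rewrite (_ : (fun y => _) =
    (fun y : 'cV[R]_(m + m) => y (lshift m i) 0)); last first.
  by apply/funext => y; rewrite mxE.
apply: DeriveDef; first exact/diff_derivable/differentiable_coord.
by rewrite -(@derive_coord _ _ _ _ id) ?derive_id ?mxE.
Qed.

Lemma derive_dsubmx z u i :
  is_derive z u (fun y : 'cV[R]_(m + m) => dsubmx y i 0) (dsubmx u i 0).
Proof.
rewrite (_ : (fun y => _) =
    (fun y : 'cV[R]_(m + m) => y (rshift m i) 0)); last first.
  by apply/funext => y; rewrite mxE.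
apply: DeriveDef; first exact/diff_derivable/differentiable_coord.
by rewrite -(@derive_coord _ _ _ _ id) ?derive_id ?mxE.
Qed.

Lemma is_derive_dot n (f g : 'cV[R]_(m + m) -> 'cV[R]_n) (df dg : 'cV[R]_n) z u :
  (forall i, is_derive z u (fun y => f y i 0) (df i 0)) ->
  (forall i, is_derive z u (fun y => g y i 0) (dg i 0)) ->
  is_derive z u (fun y => dot (f y) (g y)) (dot df (g z) + dot (f z) dg).
Proof.
move=> hf hg; rewrite (_ : (fun y => _) =
    \sum_i (fun y => f y i 0) * (fun y => g y i 0)); last first.
  by apply/funext => y; rewrite fct_sumE.
apply: is_derive_eq; rewrite /dot -big_split /=; apply: eq_bigr => i _.
by rewrite /GRing.scale /=; ring.
Qed.

Let smB (s : 'cV[R]_(m + m) -> R) z u : smooth_on B s -> B z ->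
  is_derive z u s ('D_u s z).
Proof.
move=> ss Bz; apply: DeriveDef => //; apply: diff_derivable.
exact: (smooth_differentiable ss Bz).
Qed.

(** Supplies the numbers and relations that [symplectic_identity] consumes. The derivative of the
    square root [sqP] is never expanded: all that is used of it is the derivative of its square. *)
Lemma frame_derive z u : B z -> exists uk1 uk2 ub uD uA : R,
  [/\ uD = fk1 z * uk2 + fk2 z * uk1 - 2 * fkb z * ub,
      uA = (fk1 z - 1) * uk2 + (fk2 z - 1) * uk1 - 2 * fkb z * ub,
      [/\ dot (usubmx z) (usubmx u) = (uk2 - uk1 - uA) / 2,
          dot (dsubmx z) (dsubmx u) = (uk1 - uk2 - uA) / 2 &
          dot (usubmx z) (dsubmx u) = 2 * ub - dot (dsubmx z) (usubmx u)],
      'D_u (@frameX R m) z = fvec uk1 (- ub) ((Num.sqrt (fkD z))^-1 *: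
        ((- 2^-1 * (fkD z)^-1 * uD) *: (fk1 z *: usubmx z - fkb z *: dsubmx z) +
         (uk1 *: usubmx z + fk1 z *: usubmx u -
          (ub *: dsubmx z + fkb z *: dsubmx u)))) &
      'D_u (@frameY R m) z = fvec (- ub) uk2 ((Num.sqrt (fkD z))^-1 *:
        ((- 2^-1 * (fkD z)^-1 * uD) *: (fk2 z *: dsubmx z - fkb z *: usubmx z) +
         (uk2 *: dsubmx z + fk2 z *: dsubmx u -
          (ub *: usubmx z + fkb z *: usubmx u))))].
Proof.
move=> Bz.
have duu : is_derive z u (fun y => dot (usubmx y) (usubmx y))
    (2 * dot (usubmx z) (usubmx u)).
  apply: is_derive_eq; first by apply: is_derive_dot => i; exact: derive_usubmx.
  by rewrite dotC; ring.
have ddd : is_derive z u (fun y => dot (dsubmx y) (dsubmx y))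
    (2 * dot (dsubmx z) (dsubmx u)).
  apply: is_derive_eq; first by apply: is_derive_dot => i; exact: derive_dsubmx.
  by rewrite dotC; ring.
have dud : is_derive z u (fun y => dot (usubmx y) (dsubmx y))
    (dot (dsubmx z) (usubmx u) + dot (usubmx z) (dsubmx u)).
  apply: is_derive_eq.
    by apply: is_derive_dot => i; [exact: derive_usubmx | exact: derive_dsubmx].
  by rewrite dotC.
pose uA := - (dot (usubmx z) (usubmx u) + dot (dsubmx z) (dsubmx u)).
pose uR := 2 * (dot (usubmx z) (usubmx u) - dot (dsubmx z) (dsubmx u)).
pose uI := 2 * (dot (dsubmx z) (usubmx u) + dot (usubmx z) (dsubmx u)).
have dA : is_derive z u (@sqA R m) uA.
  by rewrite /sqA; apply: is_derive_eq; rewrite /GRing.scale /= /uA; field.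
have dR : is_derive z u (@sqR R m) uR.
  by rewrite /sqR; apply: is_derive_eq; rewrite /GRing.scale /= /uR; ring.
have dI : is_derive z u (@sqI R m) uI.
  by rewrite /sqI; apply: is_derive_eq; rewrite /GRing.scale /= /uI; ring.
pose uP := 'D_u (@sqP R m) z.
have dP : is_derive z u (@sqP R m) uP by apply: smB => //; exact: smooth_sqP.
have P0 := sqP_gt0 Bz.
have uPE : 2 * sqP z * uP = uA + (sqR z * uR + sqI z * uI) / 8.
  rewrite /uP derive_sqrt_comp; [|exact: sqP_rad_gt0|]; last first.
    exact: (smooth_differentiable (@smooth_sqP_rad R m) Bz).
  rewrite -/(sqP z) mulrC mulfVK; last by rewrite mulf_neq0 // ?pnatr_eq0 // gt_eqF.
  have : is_derive z u (fun y => sqA y + (sqR y ^+ 2 + sqI y ^+ 2) / 16)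
      (uA + (sqR z * uR + sqI z * uI) / 8).
    by apply: is_derive_eq; rewrite /GRing.scale /=; field.
  by case.
have D0 := fkD_gt0 Bz.
pose uD := 2 * uP + uA.
have dD : is_derive z u (@fkD R m) uD.
  by rewrite /fkD; apply: is_derive_eq; rewrite /GRing.scale /= /uD; ring.
have dw : is_derive z u (fun y => (Num.sqrt (fkD y))^-1)
    (- 2^-1 * (Num.sqrt (fkD z))^-1 ^+ 3 * uD).
  have dfD := smooth_differentiable (@smooth_fkD R m) Bz.
  apply: DeriveDef; first exact/diff_derivable/(derive_rsqrt u D0 dfD).1.
  by rewrite (derive_rsqrt u D0 dfD).2; case: dD => _ ->.
have w3 : (Num.sqrt (fkD z))^-1 ^+ 3 = (Num.sqrt (fkD z))^-1 * (fkD z)^-1.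
  by rewrite exprS expr2 rsqrt2.
pose uk1 := uP - uR / 4; pose uk2 := uP + uR / 4; pose ub := uI / 4.
have dk1 : is_derive z u (@fk1 R m) uk1.
  by rewrite /fk1; apply: is_derive_eq; rewrite /GRing.scale /= /uk1; ring.
have dk2 : is_derive z u (@fk2 R m) uk2.
  by rewrite /fk2; apply: is_derive_eq; rewrite /GRing.scale /= /uk2; ring.
have db : is_derive z u (@fkb R m) ub.
  by rewrite /fkb; apply: is_derive_eq; rewrite /GRing.scale /= /ub; ring.
exists uk1, uk2, ub, uD, uA.
have E1 : uA = (fk1 z - 1) * uk2 + (fk2 z - 1) * uk1 - 2 * fkb z * ub.
  have -> : uA = 2 * sqP z * uP - (sqR z * uR + sqI z * uI) / 8 by rewrite uPE; ring.
  by rewrite /fk1 /fk2 /fkb /uk1 /uk2 /ub; field.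
have dX : derivable (@frameX R m) z u.
  exact/diff_derivable/(smooth_differentiable (@smooth_frameX R m) Bz).
have dY : derivable (@frameY R m) z u.
  exact/diff_derivable/(smooth_differentiable (@smooth_frameY R m) Bz).
split.
- by rewrite /uD {1}E1 /uk1 /uk2; ring.
- exact: E1.
- by rewrite /uk1 /uk2 /ub /uA /uR /uI; split; field.
- apply: fvec_eqP => [||i]; rewrite ?fvec0E ?fvec1E derive_coord //.
  + rewrite (_ : (fun y => _) = (fun y => fk1 y - 1)); last first.
      by apply/funext => y; rewrite fvec0E.
    by apply: derive_val; apply: is_derive_eq; rewrite subr0.
  + rewrite (_ : (fun y => _) = (fun y => - fkb y)); last first.
      by apply/funext => y; rewrite fvec1E.
    by apply: derive_val.
  rewrite (_ : (fun y => _) = (fun y => (Num.sqrt (fkD y))^-1 *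
      (fk1 y * usubmx y i 0 - fkb y * dsubmx y i 0))); last first.
    by apply/funext => y; rewrite fvec2E !mxE.
  have dpi := derive_usubmx z u i; have dqi := derive_dsubmx z u i.
  apply: derive_val; apply: is_derive_eq.
  by rewrite ?fvec2E w3 !mxE /GRing.scale /=; ring.
- apply: fvec_eqP => [||i]; rewrite ?fvec0E ?fvec1E ?fvec2E derive_coord //.
  + rewrite (_ : (fun y => _) = (fun y => - fkb y)); last first.
      by apply/funext => y; rewrite fvec0E.
    by apply: derive_val.
  + rewrite (_ : (fun y => _) = (fun y => fk2 y - 1)); last first.
      by apply/funext => y; rewrite fvec1E.
    by apply: derive_val; apply: is_derive_eq; rewrite subr0.
  rewrite (_ : (fun y => _) = (fun y => (Num.sqrt (fkD y))^-1 *
      (fk2 y * dsubmx y i 0 - fkb y * usubmx y i 0))); last first.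
    by apply/funext => y; rewrite fvec2E !mxE.
  have dpi := derive_usubmx z u i; have dqi := derive_dsubmx z u i.
  apply: derive_val; apply: is_derive_eq.
  by rewrite ?fvec2E w3 !mxE /GRing.scale /=; ring.
Qed.

Lemma std_formE u v :
  std_form u v = dot (usubmx u) (dsubmx v) - dot (dsubmx u) (usubmx v).
Proof.
rewrite /std_form /std_mx -mulmxA trmx_mulE mxE mulr1n.
rewrite -{1}(vsubmxK u) -{1}(vsubmxK v) mul_block_col !mul0mx mulNmx !mul1mx.
by rewrite add0r addr0 dot_col_mx dotNr.
Qed.

Lemma frame_symplectic z u v : B z ->
  dot ('D_u (@frameX R m) z) ('D_v (@frameY R m) z) -
  dot ('D_u (@frameY R m) z) ('D_v (@frameX R m) z) = std_form u v.
Proof.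
move=> Bz; have D0 := fkD_gt0 Bz; have DE := fkDE Bz; have AE := sqAE Bz.
have [uk1 [uk2 [ub [uD [uA [uDE uAE [u1 u2 u3] -> ->]]]]]] := frame_derive u Bz.
have [vk1 [vk2 [vb [vD [vA [vDE vAE [v1 v2 v3] -> ->]]]]]] := frame_derive v Bz.
have := @symplectic_identity R m (usubmx z) (dsubmx z) (usubmx u) (dsubmx u)
  (usubmx v) (dsubmx v) (fk1 z) (fk2 z) (fkb z) (Num.sqrt (fkD z))^-1
  uk1 uk2 ub uD uA vk1 vk2 vb vD vA.
rewrite /= -DE -AE rsqrt2 // dot_uuE dot_ddE dot_udE => H.
rewrite std_formE -H //; last by rewrite gt_eqF.
rewrite !dot_fvec.
set a := dot (_ *: _) (_ *: _); set b := dot (_ *: _) (_ *: _).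
ring.
Qed.

(** Derivative of the three orthonormality relations, which are constant on the open ball. *)
Lemma frame_velocityP z u : B z -> frame_velocity (frameX z) (frameY z)
  ('D_u (@frameX R m) z) ('D_u (@frameY R m) z).
Proof.
move=> Bz.
have oB : open B by exact: open_Cball.
have dX i : is_derive z u (fun y => frameX y i 0) ('D_u (@frameX R m) z i 0).
  have dX : derivable (@frameX R m) z u.
    by apply: (smooth_derivable (@smooth_frameX R m) Bz).
  by apply: DeriveDef; [move/derivable_mxP : dX | rewrite derive_coord].
have dY i : is_derive z u (fun y => frameY y i 0) ('D_u (@frameY R m) z i 0).
  have dY : derivable (@frameY R m) z u.
    by apply: (smooth_derivable (@smooth_frameY R m) Bz).
  by apply: DeriveDef; [move/derivable_mxP : dY | rewrite derive_coord].
have const (f : 'cV[R]_(m + m) -> R) c : (forall y, B y -> f y = c) -> 'D_u f z = 0.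
  move=> fc; rewrite (@derive_eq_on _ _ _ B f (cst c) u z oB _ Bz) ?derive_cst //.
  by move=> y; rewrite inE => /fc.
have oXY y : B y -> [/\ dot (frameX y) (frameX y) = 1,
    dot (frameY y) (frameY y) = 1 & dot (frameX y) (frameY y) = 0].
  by move=> /orthonormal_frame/orthonormal2P.
have eX := const (fun y => dot (frameX y) (frameX y)) 1
  (fun y By => let: And3 h _ _ := oXY y By in h).
have eY := const (fun y => dot (frameY y) (frameY y)) 1
  (fun y By => let: And3 _ h _ := oXY y By in h).
have eXY := const (fun y => dot (frameX y) (frameY y)) 0
  (fun y By => let: And3 _ _ h := oXY y By in h).
have [_ fX] := is_derive_dot dX dX; have [_ fY] := is_derive_dot dY dY.
have [_ fXY] := is_derive_dot dX dY.
rewrite eX (dotC _ (frameX z)) in fX; rewrite eY (dotC _ (frameY z)) in fY.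
rewrite eXY (dotC _ (frameY z)) in fXY.
have half (a : R) : 0 = a + a -> a = 0.
  by move/esym/eqP; rewrite -mulr2n mulrn_eq0 => /eqP.
split.
- exact: half fX.
- exact: half fY.
- by rewrite addrC -fXY.
Qed.

End FrameDerivative.

(** * The chart, its inverse and its image *)

Section Chart.
Variables (R : realType) (m : nat).
Implicit Types (z u v : 'cV[R]_(m + m)) (x y : 'cV[R]_(2 + m)).
Notation B := (@Cball R m (Num.sqrt 2)).

Definition chart z : 'M[R]_(2 + m) := wedge (frameX z) (frameY z).

Lemma chart_Gr z : B z -> Gr (chart z).
Proof.
move=> Bz; exists (frameX z), (frameY z).
by split=> //; exact: orthonormal_frame.
Qed.

Lemma smooth_chart : smooth_on B chart.
Proof.
have oB := @open_Cball R m (Num.sqrt 2).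
apply: smooth_mx => // i j.
apply: (@smooth_ext _ _ _ _ (fun z => frameX z i 0 * frameY z j 0
   - frameY z i 0 * frameX z j 0)) => //.
  by move=> z _; rewrite wedgeE.
have sX k : smooth_on B (fun z => @frameX R m z k 0).
  by apply: smooth_coord => //; exact: smooth_frameX.
have sY k : smooth_on B (fun z => @frameY R m z k 0).
  by apply: smooth_coord => //; exact: smooth_frameY.
by apply: smoothB => //; apply: smoothM.
Qed.

Lemma derive_chart z u : B z ->
  'D_u chart z = wedge ('D_u (@frameX R m) z) (frameY z)
               + wedge (frameX z) ('D_u (@frameY R m) z).
Proof.
move=> Bz.
have dX : derivable (@frameX R m) z u.
  by apply: (smooth_derivable (@smooth_frameX R m) Bz).
have dY : derivable (@frameY R m) z u.
  by apply: (smooth_derivable (@smooth_frameY R m) Bz).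
have dXi i : is_derive z u (fun t => frameX t i 0) ('D_u (@frameX R m) z i 0).
  by apply: DeriveDef; [move/derivable_mxP : dX | rewrite derive_coord].
have dYi i : is_derive z u (fun t => frameY t i 0) ('D_u (@frameY R m) z i 0).
  by apply: DeriveDef; [move/derivable_mxP : dY | rewrite derive_coord].
have dF : derivable chart z u by apply: (smooth_derivable smooth_chart Bz).
move: ('D_u (@frameX R m) z) ('D_u (@frameY R m) z) dXi dYi => a b dXi dYi.
apply/matrixP => i j; rewrite (derive_coord i j dF).
have [_] := is_deriveB (is_deriveM (dXi i) (dYi j)) (is_deriveM (dYi i) (dXi j)).
rewrite (_ : _ - _ = fun t => chart t i j); last first.
  by apply/funext => t; rewrite wedgeE.
move=> ->; rewrite /GRing.scale /=.
transitivity (wedge a (frameY z) i j + wedge (frameX z) b i j).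
  by rewrite !wedgeE; ring.
by rewrite [RHS]mxE.
Qed.

Lemma chart12 z : B z -> chart z (lshift m 0) (lshift m 1) = sqA z.
Proof.
by move=> Bz; rewrite wedgeE !fvec0E !fvec1E sqAE //; ring.
Qed.

(** The lower parts of the frame are the columns of Z (1 + N) / sqrt (det (1 + N)). Right
    multiplication by a 2 x 2 matrix multiplies p /\ q by its determinant, here 1. Vanishing of a
    lower entry is thus a quadratic equation in z. *)
Lemma chart_lower z i j : B z -> chart z (rshift 2 i) (rshift 2 j) =
  usubmx z i 0 * dsubmx z j 0 - dsubmx z i 0 * usubmx z j 0.
Proof.
move=> Bz; have D0 : fkD z != 0 by rewrite gt_eqF // fkD_gt0.
have XE k : frameX z (rshift 2 k) 0 = (Num.sqrt (fkD z))^-1 *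
    (fk1 z * usubmx z k 0 - fkb z * dsubmx z k 0) by rewrite fvec2E !mxE.
have YE k : frameY z (rshift 2 k) 0 = (Num.sqrt (fkD z))^-1 *
    (fk2 z * dsubmx z k 0 - fkb z * usubmx z k 0) by rewrite fvec2E !mxE.
rewrite /chart wedgeE !XE !YE.
set w := (Num.sqrt _)^-1; have ww : w * w = (fkD z)^-1 by exact/rsqrt2/fkD_gt0.
transitivity (w * w * ((fk1 z * fk2 z - fkb z ^+ 2) *
  (usubmx z i 0 * dsubmx z j 0 - dsubmx z i 0 * usubmx z j 0))); first by ring.
by rewrite ww -fkDE // mulKf.
Qed.

(** Solves the lower block for Z: the inverse of 1 + N is its adjugate over its determinant, whence
    the coefficients [k2], [b], [b], [k1] and the inverse square root. *)
Definition unframe x y : 'cV[R]_(m + m) :=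
  let k1 := 1 + x (lshift m 0) 0 in let k2 := 1 + y (lshift m 1) 0 in
  let b := - x (lshift m 1) 0 in
  (Num.sqrt (k1 * k2 - b ^+ 2))^-1 *:
  col_mx (k2 *: dsubmx x + b *: dsubmx y) (b *: dsubmx x + k1 *: dsubmx y).

Lemma frameK z : B z -> unframe (frameX z) (frameY z) = z.
Proof.
move=> Bz; have D0 := fkD_gt0 Bz; have ww := rsqrt2 D0.
have D1 : fk1 z * fk2 z - fkb z ^+ 2 != 0 by rewrite -fkDE // gt_eqF.
rewrite /unframe !fvec0E !fvec1E opprK !(addrC 1) !subrK -fkDE //.
rewrite !col_mxKd scale_col_mx -[RHS]vsubmxK.
set w := (Num.sqrt _)^-1 in ww *.
congr col_mx; apply/matrixP => i j; rewrite ord1.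
  transitivity (w * w * ((fk1 z * fk2 z - fkb z ^+ 2) * usubmx z i 0)).
    by rewrite !mxE; ring.
  by rewrite ww fkDE // mulKf.
transitivity (w * w * ((fk1 z * fk2 z - fkb z ^+ 2) * dsubmx z i 0)).
  by rewrite !mxE; ring.
by rewrite ww fkDE // mulKf.
Qed.

(* In the SO(2)-orbit of an oriented orthonormal basis of a plane A with
   A_12 > 0 there is exactly one with a symmetric positive upper 2 x 2 block. *)
Lemma frame_gauge x y : 0 < wedge x y (lshift m 0) (lshift m 1) ->
  exists a b : R, [/\ a ^+ 2 + b ^+ 2 = 1,
    (a *: x + b *: y) (lshift m 1) 0 = (- b *: x + a *: y) (lshift m 0) 0 &
    0 < (a *: x + b *: y) (lshift m 0) 0 + (- b *: x + a *: y) (lshift m 1) 0].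
Proof.
rewrite wedgeE; set x0 := x _ 0; set y1 := y _ 0; set y0 := y _ 0.
set x1 := x _ 0 => A0.
(* Symmetry of the rotated block reads a (y0 - x1) = b (x0 + y1), so (a, b) is proportional to (c,
   s); the positive multiple makes the trace equal to sqrt (c^2 + s^2). Positivity of A_12 keeps (c,
   s) away from 0. *)
pose c := x0 + y1; pose s := y0 - x1; pose r2 := c ^+ 2 + s ^+ 2.
have r20 : 0 < r2.
  have -> : r2 = 4 * (x0 * y1 - y0 * x1) + (x0 - y1) ^+ 2 + (y0 + x1) ^+ 2.
    by rewrite /r2 /c /s; ring.
  by rewrite !ltr_wpDr ?sqr_ge0 // mulr_gt0.
have r0 : Num.sqrt r2 != 0 by rewrite gt_eqF // sqrtr_gt0.
have rr : Num.sqrt r2 ^+ 2 = r2 by rewrite sqr_sqrtr // ltW.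
exists (c / Num.sqrt r2), (s / Num.sqrt r2); split.
- rewrite !expr_div_n -mulrDl rr divff //; exact: lt0r_neq0.
- by rewrite !mxE -/x0 -/x1 -/y0 -/y1 /c /s; field.
rewrite !mxE -/x0 -/x1 -/y0 -/y1.
rewrite (_ : _ + _ = Num.sqrt r2); first by rewrite sqrtr_gt0.
apply: (mulIf r0); rewrite -expr2 rr /r2 /c /s; field.
exact: r0.
Qed.

(** Two frames of an oriented plane differ by a rotation (a, b). Symmetry of both blocks gives b
    times the trace equal to 0, so the rotation is 1 or -1, and the positive traces exclude -1. *)
Lemma frame_gauge_unique x y x' y' :
  orthonormal2 x y -> orthonormal2 x' y' -> wedge x y = wedge x' y' ->
  x (lshift m 1) 0 = y (lshift m 0) 0 -> x' (lshift m 1) 0 = y' (lshift m 0) 0 ->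
  0 < x (lshift m 0) 0 + y (lshift m 1) 0 ->
  0 < x' (lshift m 0) 0 + y' (lshift m 1) 0 -> x' = x /\ y' = y.
Proof.
move=> oxy oxy' /(wedge_eqP oxy oxy')[a [b [ab -> ->]]].
rewrite !mxE => xy xy' t0 t0'.
have b0 : b = 0.
  have : b * (x (lshift m 0) 0 + y (lshift m 1) 0) = 0.
    by apply/eqP; rewrite -subr_eq0; move: xy'; rewrite xy => e; apply/eqP; lra.
  by move=> /eqP; rewrite mulf_eq0 (gt_eqF t0) orbF => /eqP.
move: ab t0'; rewrite b0 expr0n addr0 => /eqP; rewrite sqrf_eq1 => /orP[]/eqP -> t0'.
  by rewrite oppr0 !scale0r !scale1r addr0 add0r.
by exfalso; move: t0 t0'; rewrite oppr0; clear; lra.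
Qed.

Lemma frame_sym z :
  @frameX R m z (lshift m 1) 0 = @frameY R m z (lshift m 0) 0.
Proof. by rewrite fvec1E fvec0E. Qed.

Lemma frame_trace z : B z ->
  0 < @frameX R m z (lshift m 0) 0 + @frameY R m z (lshift m 1) 0.
Proof.
move=> /sqP_gt0 P0; rewrite fvec1E fvec0E /fk1 /fk2.
by lra.
Qed.

Lemma chart_inj z u : B z -> B u -> chart z = chart u -> z = u.
Proof.
move=> Bz Bu zu; rewrite -(frameK Bz) -(frameK Bu).
have [-> ->] := frame_gauge_unique (orthonormal_frame Bz) (orthonormal_frame Bu)
  zu (frame_sym z) (frame_sym u) (frame_trace Bz) (frame_trace Bu).
by [].
Qed.

End Chart.

Section ChartImage.
Variables (R : realType) (m : nat).
Implicit Types (z u v : 'cV[R]_(m + m)) (x y : 'cV[R]_(2 + m)).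
Notation B := (@Cball R m (Num.sqrt 2)).

(** Orthonormality expresses the inner products of [xi] and [eta] through the upper block, and so
    those of the two halves of [unframe x y]; these determine every coefficient of the frame at that
    point. *)
Lemma unframeK (n1 n2 b : R) (xi eta : 'cV[R]_m) :
  let x := fvec n1 b xi in let y := fvec b n2 eta in
  orthonormal2 x y -> 0 < n1 + n2 -> 0 < n1 * n2 - b ^+ 2 ->
  [/\ B (unframe x y), frameX (unframe x y) = x & frameY (unframe x y) = y].
Proof.
move=> x y /orthonormal2P[]; rewrite !dot_fvec => xx yy xy tr A0.
rewrite /unframe /x /y !fvec0E !fvec1E !col_mxKd.
pose A := n1 * n2 - b ^+ 2; pose D := (1 + n1) * (1 + n2) - (- b) ^+ 2.
rewrite -/D; set z := _ *: col_mx _ _.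
have DE : D = 1 + (n1 + n2) + A by rewrite /D /A; ring.
have D0 : 0 < D by rewrite DE; apply: addr_gt0 => //; apply: addr_gt0.
have ww := rsqrt2 D0; have Dn := lt0r_neq0 D0.
have xixi : dot xi xi = 1 - n1 * n1 - b * b by rewrite -xx; ring.
have etaeta : dot eta eta = 1 - n2 * n2 - b * b by rewrite -yy; ring.
have xieta : dot xi eta = - n1 * b - b * n2 by rewrite -[RHS]add0r -xy; ring.
have zu : usubmx z = (Num.sqrt D)^-1 *: ((1 + n2) *: xi - b *: eta).
  by rewrite /z scale_col_mx col_mxKu scaleNr.
have zd : dsubmx z = (Num.sqrt D)^-1 *: ((1 + n1) *: eta - b *: xi).
  by rewrite /z scale_col_mx col_mxKd scaleNr addrC.
have uu : dot (usubmx z) (usubmx z) = 1 - n1 + n2 - A.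
  rewrite zu !dotZl !dotZr mulrA ww !dotE (dotC eta xi) xixi etaeta xieta.
  by apply: (mulfI Dn); rewrite mulrA mulfV // /D /A; ring.
have dd : dot (dsubmx z) (dsubmx z) = 1 + n1 - n2 - A.
  rewrite zd !dotZl !dotZr mulrA ww !dotE (dotC eta xi) xixi etaeta xieta.
  by apply: (mulfI Dn); rewrite mulrA mulfV // /D /A; ring.
have ud : dot (usubmx z) (dsubmx z) = - (2 * b).
  rewrite zu zd !dotZl !dotZr mulrA ww !dotE (dotC eta xi) xixi etaeta xieta.
  by apply: (mulfI Dn); rewrite mulrA mulfV // /D /A; ring.
have zA : sqA z = A by rewrite /sqA uu dd; field.
have zR : sqR z = 2 * (n2 - n1) by rewrite /sqR uu dd; ring.
have zI : sqI z = - (4 * b) by rewrite /sqI ud; ring.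
(* The square root returns half the trace and not its opposite because n1 + n2 > 0. *)
have zP : sqP z = (n1 + n2) / 2.
  rewrite /sqP zA zR zI (_ : A + _ = ((n1 + n2) / 2) ^+ 2); last first.
    by rewrite /A; field.
  by rewrite sqrtr_sqr ger0_norm // divr_ge0 // ltW.
have z1 : fk1 z = 1 + n1 by rewrite /fk1 zP zR; field.
have z2 : fk2 z = 1 + n2 by rewrite /fk2 zP zR; field.
have zb : fkb z = - b by rewrite /fkb zI; field.
have zD : fkD z = D by rewrite /fkD zP zA DE; field.
split; first by apply/CballP; rewrite zA.
  rewrite /frameX z1 zb zD opprK addrC addKr; congr fvec.
  apply/matrixP => i j; rewrite ord1.
  transitivity (((Num.sqrt D)^-1 * (Num.sqrt D)^-1) * (D * xi i 0)).
    by rewrite zu zd /D !mxE; ring.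
  by rewrite ww mulKf.
rewrite /frameY z2 zb zD opprK addrC addKr; congr fvec.
apply/matrixP => i j; rewrite ord1.
transitivity (((Num.sqrt D)^-1 * (Num.sqrt D)^-1) * (D * eta i 0)).
  by rewrite zu zd /D !mxE; ring.
by rewrite ww mulKf.
Qed.

Lemma chart_surj (A : 'M[R]_(2 + m)) : Gr A ->
  0 < A (lshift m 0) (lshift m 1) -> exists2 z, B z & chart z = A.
Proof.
move=> [x0 [y0 [oxy0 ->]]] A0.
have [a [b [ab sym tr]]] := frame_gauge A0.
set x := a *: x0 + b *: y0 in sym tr; set y := - b *: x0 + a *: y0 in sym tr.
have xyE : wedge x y = wedge x0 y0 by exact: wedge_rot.
have oxy : orthonormal2 x y.
  have /orthonormal2P[xx yy xy] := oxy0.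
  apply/orthonormal2P; rewrite /x /y !dotE (dotC y0 x0) xx yy xy.
  by split; [rewrite -[RHS]ab | rewrite -[RHS]ab |]; ring.
have xE : x = fvec (x (lshift m 0) 0) (x (lshift m 1) 0) (dsubmx x).
  by apply: fvec_eqP => [||i]; rewrite ?fvec0E ?fvec1E ?fvec2E // [RHS]mxE.
have yE : y = fvec (x (lshift m 1) 0) (y (lshift m 1) 0) (dsubmx y).
  by apply: fvec_eqP => [||i]; rewrite ?fvec0E ?fvec1E ?fvec2E ?sym // [RHS]mxE.
rewrite -xyE wedgeE -sym in A0.
have := @unframeK (x (lshift m 0) 0) (y (lshift m 1) 0) (x (lshift m 1) 0)
  (dsubmx x) (dsubmx y).
rewrite /= -xE -yE => /(_ oxy tr)[|Bz zX zY]; first by rewrite expr2.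
by exists (unframe x y) => //; rewrite /chart zX zY.
Qed.

(** If the derivative vanishes, the frame only rotates inside its plane, so [frame_symplectic] gives
    [std_form u v] = 0 for all v. Testing on v = i u, which is [col_mx (- dsubmx u) (usubmx u)],
    gives |u|^2 = 0. *)
Lemma chart_immersion z u : B z -> 'D_u (@chart R m) z = 0 -> u = 0.
Proof.
move=> Bz; rewrite derive_chart // => du0.
have [xa yb xbya] := frame_velocityP u Bz.
have /orthonormal2P[xx yy xy] := orthonormal_frame Bz.
have std0 v : std_form u v = 0.
  rewrite -(frame_symplectic u v Bz).
  have [xa' yb' _] := frame_velocityP v Bz.
  move: ('D_u (@frameX R m) z) ('D_u (@frameY R m) z) du0 xa yb xbya
        ('D_v (@frameX R m) z) ('D_v (@frameY R m) z) xa' yb' => a b.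
  move: (frameX z) (frameY z) xx yy xy => x y xx yy xy du0 xa yb xbya a' b' xa' yb'.
  have wm s t r : wedge s t *m r = dot t r *: s - dot s r *: t.
    by rewrite /wedge mulmxBl -!mulmxA !trmx_mulE !mul_mx_scalar.
  (* Applying the vanishing bivector to [y], and below to [x], shows that [a] is a multiple of [y]
     and [b] one of [x]. *)
  have := congr1 (fun M => M *m y) du0; rewrite mul0mx mulmxDl !wm.
  rewrite yy xy (dotC b y) yb !scale0r scale1r subr0 addr0 => /eqP.
  rewrite subr_eq0 => /eqP ->.
  have := congr1 (fun M => M *m x) du0; rewrite mul0mx mulmxDl !wm.
  rewrite xx (dotC y x) xy (dotC a x) xa !scale0r scale1r subrr add0r => /eqP.
  rewrite subr_eq0 => /eqP <-.
  by rewrite !dotZl yb' xa' !mulr0 subrr.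
have := std0 (col_mx (- dsubmx u) (usubmx u)).
rewrite std_formE col_mxKu col_mxKd dotNr opprK => /eqP.
rewrite paddr_eq0 ?dot_ge0 // => /andP[/eqP/dot_eq0 u1 /eqP/dot_eq0 u2].
by rewrite -[u]vsubmxK u1 u2 col_mx0.
Qed.

Lemma chart_parametrization : parametrization (@Gr R (2 + m)) B (@chart R m).
Proof.
split; [exact: open_Cball | exact: smooth_chart | exact: chart_Gr
  | exact: chart_inj | by move=> z u Bz; exact: chart_immersion].
Qed.

End ChartImage.

(** * Invariant forms are multiples of the Kirillov form *)

Section Parametrizations.
Variable R : realType.

Lemma smooth_open_preimage (V : normedModType R) (p q : nat)
    (U : set V) (U' : set 'M[R]_(p, q)) (g : V -> 'M[R]_(p, q)) :
  open U -> open U' -> smooth_on U g -> open (U `&` g @^-1` U').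
Proof.
move=> oU oU' sg; rewrite openE => x [Ux U'gx].
have cg : {for x, continuous g} by exact: (sg 0%N).
have nU : nbhs x U by exact: open_nbhs_nbhs.
have nU' : nbhs (g x) U' by exact: open_nbhs_nbhs.
by apply: filterI => //; exact: cg.
Qed.

Lemma parametrization_comp (d p q : nat) (S : set 'M[R]_(p, q))
    (U U' : set 'cV[R]_d) (phi : 'cV[R]_d -> 'M[R]_(p, q))
    (psi : 'cV[R]_d -> 'cV[R]_d) :
  parametrization S U phi -> open U' -> smooth_on U' psi ->
  (forall x, U' x -> U (psi x)) ->
  (forall x y, U' x -> U' y -> psi x = psi y -> x = y) ->
  (forall x u, U' x -> 'D_u psi x = 0 -> u = 0) ->
  parametrization S U' (fun x => phi (psi x)).
Proof.
move=> [oU sphi Sphi iphi dphi] oU' spsi UU' ipsi dpsi; split=> //.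
- exact: smooth_comp sphi spsi.
- by move=> x /UU'; exact: Sphi.
- by move=> x y Ux Uy /iphi e; apply: ipsi => //; apply: e; exact: UU'.
move=> x u Ux; have dx := smooth_differentiable spsi Ux.
rewrite (derive_comp_diff u dx (smooth_differentiable sphi (UU' x Ux))).
by move=> /(dphi _ _ (UU' x Ux))/(dpsi _ _ Ux).
Qed.

Lemma derive_lin (V W : normedModType R) (f : V -> W) x c u v :
  differentiable f x -> 'D_(c *: u + v) f x = c *: 'D_u f x + 'D_v f x.
Proof. by move=> df; rewrite !deriveE // linearP. Qed.

Variables (d p q : nat) (S : set 'M[R]_(p, q)).
Variable omega : 'M[R]_(p, q) -> 'M[R]_(p, q) -> 'M[R]_(p, q) -> R.
Hypothesis omegaS : symplectic_form d S omega.

Lemma pullback_linl (U : set 'cV[R]_d) (phi : 'cV[R]_d -> 'M[R]_(p, q)) c u v w x :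
  parametrization S U phi -> U x ->
  (forall u, tangent S (phi x) ('D_u phi x)) ->
  pullback omega phi (c *: u + v) w x =
  c * pullback omega phi u w x + pullback omega phi v w x.
Proof.
move=> [_ sphi Sphi _ _] Ux tphi; have [olin _ _ _ _] := omegaS.
rewrite /pullback (derive_lin c u v (smooth_differentiable sphi Ux)) olin //.
exact: Sphi.
Qed.

(* A symplectic_form is only assumed to be linear on the left and to satisfy
   omega u u = 0, which does not imply linearity on the right; the latter has to
   be deduced from closedness.  The defect of right linearity is first shown to
   be locally constant. *)
Lemma pullback_defect (U : set 'cV[R]_d) (phi : 'cV[R]_d -> 'M[R]_(p, q))
    c v w w' u x :
  parametrization S U phi -> U x ->
  (forall x u, U x -> tangent S (phi x) ('D_u phi x)) ->
  'D_u (pullback omega phi v (c *: w + w')) x =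
  c * 'D_u (pullback omega phi v w) x + 'D_u (pullback omega phi v w') x.
Proof.
move=> pphi Ux tphi; have [_ _ _ osm oclosed] := omegaS.
have oU : open U by case: pphi.
have dO a b : differentiable (pullback omega phi a b) x.
  exact: (smooth_differentiable (osm U phi pphi a b) Ux).
have hO a b : is_derive x v (pullback omega phi a b)
    ('D_v (pullback omega phi a b) x).
  by apply: DeriveDef => //; exact: diff_derivable.
(* In the closedness identity for u, v and c w + w', the third term is linear in the direction of
   differentiation and the second by linearity on the left, so the first is linear too. *)
have h3 := derive_lin c w w' (dO u v).
have h2 : 'D_v (pullback omega phi (c *: w + w') u) x =
    c * 'D_v (pullback omega phi w u) x + 'D_v (pullback omega phi w' u) x.
  have [_ eD] := is_deriveD (is_deriveM (is_derive_cst c x v) (hO w u)) (hO w' u).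
  rewrite scaler0 addr0 in eD; rewrite -[RHS]eD.
  apply: (derive_eq_on v oU) Ux => y; rewrite inE => Uy.
  by rewrite (pullback_linl c w w' u pphi Uy) // => ?; exact: tphi.
have comb (A1 A2 A3 B1 B2 B3 C1 C2 C3 : R) : A1 + A2 + A3 = 0 ->
    B1 + B2 + B3 = 0 -> C1 + C2 + C3 = 0 ->
    A2 = c * B2 + C2 -> A3 = c * B3 + C3 -> A1 = c * B1 + C1.
  clear=> /eqP eA /eqP eB /eqP eC e2 e3; move: eA eB eC.
  rewrite -!addrA !addr_eq0 => /eqP-> /eqP-> /eqP->.
  by rewrite e2 e3; ring.
exact: comb (oclosed U phi pphi u v (c *: w + w') x Ux)
  (oclosed U phi pphi u v w x Ux) (oclosed U phi pphi u v w' x Ux) h2 h3.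
Qed.

End Parametrizations.

Section ChartOrigin.
Variables (R : realType) (m : nat).
Implicit Types (z u v w : 'cV[R]_(m + m)).
Notation B := (@Cball R m (Num.sqrt 2)).

Lemma Cball0 (r : R) : 0 < r -> @Cball R m r 0.
Proof.
move=> r0; rewrite /Cball /= big1 ?exprn_gt0 // => i _.
by rewrite mxE expr0n.
Qed.

Let B0 : B 0. Proof. by apply: Cball0; rewrite sqrtr_gt0. Qed.

Let sub0 : usubmx (0 : 'cV[R]_(m + m)) = 0 /\ dsubmx (0 : 'cV[R]_(m + m)) = 0.
Proof. by rewrite !linear0. Qed.

Lemma sq0 : [/\ fk1 (0 : 'cV[R]_(m + m)) = 2, fk2 (0 : 'cV[R]_(m + m)) = 2,
  fkb (0 : 'cV[R]_(m + m)) = 0 & fkD (0 : 'cV[R]_(m + m)) = 2 ^+ 2].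
Proof.
have [u0 d0] := sub0.
have A0 : sqA (0 : 'cV[R]_(m + m)) = 1.
  by rewrite /sqA u0 d0 !dot0l addr0 mul0r subr0.
have R0 : sqR (0 : 'cV[R]_(m + m)) = 0 by rewrite /sqR u0 d0 !dot0l subr0.
have I0 : sqI (0 : 'cV[R]_(m + m)) = 0 by rewrite /sqI u0 !dot0l mulr0.
have P0 : sqP (0 : 'cV[R]_(m + m)) = 1.
  by rewrite /sqP A0 R0 I0 expr0n addr0 mul0r addr0 sqrtr1.
by rewrite /fk1 /fk2 /fkb /fkD A0 R0 I0 P0 !mul0r; split; ring.
Qed.

Lemma frame0 : @frameX R m 0 = e1 R m /\ @frameY R m 0 = e2 R m.
Proof.
have [u0 d0] := sub0; have [k1 k2 kb _] := sq0.
rewrite /frameX /frameY k1 k2 kb u0 d0 !scaler0 subrr scaler0 oppr0 addrK.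
by split; rewrite ?e1E ?e2E /fvec; congr col_mx; apply/matrixP => i j;
  rewrite !mxE !ord1 eqxx andbT; case: i => [[|[|]]].
Qed.

(** At the origin Z = 0, so the differentiated constraints make the entries of N stationary, while N
    = 1 turns (1 + N) / sqrt (det (1 + N)) into the identity: the lower block moves exactly by the
    increment of z. *)
Lemma derive_chart0 u :
  'D_u (@chart R m) 0 = base_tangent (usubmx u) (dsubmx u).
Proof.
rewrite derive_chart //; have [-> ->] := frame0.
have [k1 k2 kb kD] := sq0.
have [uk1 [uk2 [ub [uD [uA [uDE uAE [h1 h2 h3] -> ->]]]]]] := frame_derive u B0.
have [u0 d0] := sub0; rewrite u0 d0 !dot0l in h1 h2 h3.
rewrite k1 k2 kb in uDE uAE *.
have ub0 : ub = 0 by move: h3; rewrite subr0; clear=> h; lra.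
have [uk10 uk20] : uk1 = 0 /\ uk2 = 0.
  by move: uAE h1 h2; rewrite ub0; clear=> *; split; lra.
rewrite uk10 uk20 ub0 oppr0 u0 d0 !(scaler0, scale0r, subr0, addr0, add0r).
rewrite kD sqrtr_sqr ger0_norm // !scalerA mulVf // !scale1r.
have fl (t : 'cV[R]_m) : fvec 0 0 t = lift2 t.
  by congr col_mx; apply/matrixP => i j; rewrite !mxE; case: (i == 0).
by rewrite !fl.
Qed.

Lemma tangent_chart z u : B z ->
  tangent (@Gr R (2 + m)) (chart z) ('D_u (@chart R m) z).
Proof.
move=> Bz; rewrite derive_chart //.
have [xa yb xbya] := frame_velocityP u Bz.
by apply: tangent_wedge => //; exact: orthonormal_frame.
Qed.

End ChartOrigin.

(** * Quadratic shears and right linearity of the form *)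

Section Shear.
Variables (R : realType) (d : nat).
Implicit Types (l v u y : 'cV[R]_d).

Lemma is_derive_coord y u i :
  is_derive y u (fun t : 'cV[R]_d => t i 0) (u i 0).
Proof.
apply: DeriveDef; first exact/diff_derivable/differentiable_coord.
by rewrite -(@derive_coord _ _ _ _ id) ?derive_id.
Qed.

Lemma smooth_dotl l (U : set 'cV[R]_d) : open U -> smooth_on U (dot l).
Proof.
move=> oU; apply: smooth_sum => // i; apply: smoothMl => //.
by apply: smooth_coord => //; exact: smooth_id.
Qed.

Lemma is_derive_dotl l y u : is_derive y u (dot l) (dot l u).
Proof.
rewrite [X in is_derive _ _ X _](_ : _ = \sum_i
    cst (l i 0) * (fun t : 'cV[R]_d => t i 0)); last first.
  by apply/funext => t; rewrite fct_sumE.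
have := is_derive_sum (fun i => is_deriveM (is_derive_cst (l i 0) y u)
  (is_derive_coord y u i)).
by rewrite (eq_bigr (fun i => l i 0 * u i 0)) // => i _; rewrite scaler0 addr0.
Qed.

Definition quad_shear l v y : 'cV[R]_d := y + (dot l y * dot l y / 2) *: v.

Lemma smooth_quad_shear l v (U : set 'cV[R]_d) :
  open U -> smooth_on U (quad_shear l v).
Proof.
move=> oU; have sl := smooth_dotl l oU.
apply: smoothD => //; first exact: smooth_id.
apply: smoothZ => //; apply: smoothM => //; last exact: smooth_cst.
exact: smoothM.
Qed.

Lemma derive_quad_shear l v y u :
  'D_u (quad_shear l v) y = u + (dot l y * dot l u) *: v.
Proof.
have dp : derivable (quad_shear l v) y u.
  by apply: (smooth_derivable (smooth_quad_shear _ _ openT)).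
apply/matrixP => i j; rewrite derive_coord // ord1.
have dl := is_derive_dotl l y u.
have -> : (fun t => quad_shear l v t i 0) = (fun t : 'cV[R]_d => t i 0)
    + ((dot l * dot l) * cst (v i 0 / 2)).
  by apply/funext => t; rewrite !mxE /= !fctE /=; field.
have [_ ->] := is_deriveD (is_derive_coord y u i)
  (is_deriveM (is_deriveM dl dl) (is_derive_cst (v i 0 / 2) y u)).
by rewrite !mxE /GRing.scale /=; field.
Qed.

End Shear.

Section RightLinearity.
Variables (R : realType) (m : nat).
Variable omega : 'M[R]_(2 + m) -> 'M[R]_(2 + m) -> 'M[R]_(2 + m) -> R.
Hypothesis omegaS : symplectic_form (m + m) (@Gr R (2 + m)) omega.
Implicit Types (u v w l : 'cV[R]_(m + m)).
Notation B := (@Cball R m (Num.sqrt 2)).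
Local Notation O u v := (pullback omega (@chart R m) u v 0).

Let B0 : B 0. Proof. by apply: Cball0; rewrite sqrtr_gt0. Qed.

Lemma form_linl c u v w : O (c *: u + v) w = c * O u w + O v w.
Proof.
apply: (pullback_linl omegaS c u v w (@chart_parametrization R m) B0).
by move=> x; exact: tangent_chart.
Qed.

(* In the parametrization chart \o psi, psi y = y + (l y)^2 / 2 v, the vector v
   is rescaled by 1 + l y while w and w' are not, although the defect of right
   linearity has to stay locally constant: hence it vanishes. *)
Lemma form_linr_aux c v w w' l : dot l v = 1 -> dot l w = 0 -> dot l w' = 0 ->
  O v (c *: w + w') = c * O v w + O v w'.
Proof.
move=> lv lw lw'; pose psi := quad_shear l v.
have oB : open B by exact: open_Cball.
(* On this half-space s + s^2 / 2 is injective in s = l y, hence so is psi, and 1 + l y does not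
   vanish, which makes psi an immersion. *)
pose U0 : set 'cV[R]_(m + m) := [set y | -1 < dot l y].
have oU0 : open U0.
  have cl : continuous (dot l : 'cV[R]_(m + m) -> R).
    by move=> y; exact: (smooth_dotl l openT 0%N).
  exact: (@open_comp _ _ (dot l : 'cV[R]_(m + m) -> R) _ (fun y _ => cl y)
           (@open_gt R (-1))).
pose U := U0 `&` psi @^-1` B.
have oU : open U by exact: smooth_open_preimage (smooth_quad_shear l v oU0).
have spsi : smooth_on U psi by exact: smooth_quad_shear.
have psiB y : U y -> B (psi y) by case.
have lpsi y : dot l (psi y) = dot l y + dot l y * dot l y / 2.
  by rewrite dotDr dotZr lv mulr1.
have pU : parametrization (@Gr R (2 + m)) U (fun y => chart (psi y)).
  apply: (parametrization_comp (@chart_parametrization R m) oU spsi psiB).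
    move=> x y [Ux _] [Uy _] xy; have := lpsi x; rewrite xy lpsi => e.
    have lxy : dot l x = dot l y.
      have : (dot l x - dot l y) * (2 + dot l x + dot l y) = 0.
        transitivity (2 * ((dot l x + dot l x * dot l x / 2) -
           (dot l y + dot l y * dot l y / 2))); first by field.
        by rewrite e subrr mulr0.
      move=> /eqP; rewrite mulf_eq0 subr_eq0 => /orP[/eqP //|/eqP e0].
      by move: Ux Uy e0; rewrite /U0 /=; clear=> *; exfalso; lra.
    by move: xy; rewrite /psi /quad_shear lxy => /addIr.
  move=> x u [Ux _]; rewrite derive_quad_shear => e.
  have := congr1 (dot l) e; rewrite dotDr dotZr lv mulr1 dot0r => /eqP.
  rewrite -[X in X + _]mul1r -mulrDl mulf_eq0 => /orP[/eqP e1|/eqP lu].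
    by move: Ux e1; rewrite /U0 /=; clear=> *; exfalso; lra.
  by move: e; rewrite lu mulr0 scale0r addr0.
have dpsiE y u : U y ->
    'D_u (fun t => chart (psi t)) y = 'D_('D_u psi y) (@chart R m) (psi y).
  move=> Uy; apply: derive_comp_diff; first exact: (smooth_differentiable spsi Uy).
  exact: (smooth_differentiable (@smooth_chart R m) (psiB y Uy)).
have tU y u : U y ->
    tangent (@Gr R (2 + m)) (chart (psi y)) ('D_u (fun t => chart (psi t)) y).
  by move=> Uy; rewrite dpsiE //; apply: tangent_chart; exact: psiB.
have psi0 : psi 0 = 0 by rewrite /psi /quad_shear dot0r !mul0r scale0r addr0.
have U00 : U 0.
  by split; rewrite /U0 /= ?psi0 // dot0r ltrN10.
pose K W (z : 'cV[R]_(m + m)) := pullback omega (@chart R m) v W z.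
have OU W y : dot l W = 0 -> U y ->
    pullback omega (fun t => chart (psi t)) v W y = (1 + dot l y) * K W (psi y).
  move=> lW Uy; have By := psiB y Uy.
  transitivity (pullback omega (@chart R m) ('D_v psi y) ('D_W psi y) (psi y)).
    exact: (congr2 (omega (chart (psi y))) (dpsiE y v Uy) (dpsiE y W Uy)).
  rewrite (derive_quad_shear l v y v) (derive_quad_shear l v y W) lv lW.
  rewrite mulr1 mulr0 scale0r addr0.
  have lin a b d := pullback_linl omegaS a b d W (@chart_parametrization R m)
    By (fun u => tangent_chart u By).
  by rewrite addrC lin /K mulrDl mul1r addrC.
(* The factor 1 + l y makes the product rule add the undifferentiated value [K W 0]. Both
   derivatives respect linear combinations of W by [pullback_defect], so their difference does as
   well for W in the kernel of [l]. *)
have dK W : dot l W = 0 ->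
    'D_v (pullback omega (fun t => chart (psi t)) v W) 0 =
    K W 0 + 'D_v (K W) 0.
  move=> lW; have sK : smooth_on B (K W).
    by case: omegaS => _ _ _ h _; apply: h; exact: chart_parametrization.
  transitivity ('D_v (fun y => (1 + dot l y) * K W (psi y)) 0).
    by apply: (derive_eq_on v oU _ U00) => y; rewrite inE => Uy; exact: OU.
  have dKpsi : differentiable (K W) (psi 0).
    by rewrite psi0; exact: (smooth_differentiable sK B0).
  have dpsi0 : differentiable psi 0 := smooth_differentiable spsi U00.
  have hK : is_derive 0 v (fun y => K W (psi y)) ('D_v (K W) 0).
    apply: DeriveDef.
      exact/diff_derivable/(@differentiable_comp _ _ _ _ psi (K W)).
    have dp0 : 'D_v psi 0 = v.
      by rewrite derive_quad_shear dot0r mul0r scale0r addr0.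
    by apply: etrans (derive_comp_diff v dpsi0 dKpsi) _; rewrite dp0 psi0.
  have [_ ] := is_deriveM (is_deriveD (is_derive_cst (1 : R) 0 v)
    (is_derive_dotl l 0 v)) hK.
  rewrite psi0 lv => e; apply: etrans e _.
  by rewrite !fctE dot0r addr0 add0r scale1r /GRing.scale /= mulr1 addrC.
have lc : dot l (c *: w + w') = 0 by rewrite dotDr dotZr lw lw' mulr0 addr0.
have comb (a1 a2 a3 b1 b2 b3 k1 k2 k3 : R) : a1 = c * a2 + a3 ->
    b1 = c * b2 + b3 -> a1 = k1 + b1 -> a2 = k2 + b2 -> a3 = k3 + b3 ->
    k1 = c * k2 + k3.
  clear=> e1 e2 e3 e4 e5; apply: (addIr b1).
  by rewrite -e3 e1 e2 e4 e5; ring.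
exact: comb (pullback_defect omegaS c v w w' v pU U00 tU)
  (pullback_defect omegaS c v w w' v (@chart_parametrization R m) B0
    (fun x u Bx => tangent_chart u Bx)) (dK _ lc) (dK _ lw) (dK _ lw').
Qed.

(** As 2 < m + m, some nonzero linear form [l] kills both [w] and [w']. The special case requires l
    v = 1, so [v] is split into a multiple of [v0] and a remainder, with [l] equal to 1 on [v0] and
    on the remainder, and left linearity recombines them. *)
Lemma form_linr c v w w' : (2 < m + m)%N ->
  O v (c *: w + w') = c * O v w + O v w'.
Proof.
move=> m2; pose M := row_mx w w'.
have /rowV0Pn[l0 lM l00] : kermx M != 0.
  rewrite -mxrank_eq0 mxrank_ker subn_eq0 -ltnNge.
  by apply: leq_ltn_trans (rank_leq_col M) _.
have {lM} : l0 *m M = 0 by apply/sub_kermxP.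
rewrite mul_mx_row -[0]row_mx0 => /eq_row_mx[lw lw'].
pose l := l0^T.
have lE x : l0 *m x = (dot l x)%:M by rewrite -trmx_mulE trmxK.
have dot0 x : l0 *m x = 0 -> dot l x = 0.
  by rewrite lE => /matrixP/(_ 0 0); rewrite !mxE mulr1n.
have {dot0} [lw0 lw0'] := (dot0 _ lw, dot0 _ lw').
have ll : dot l l != 0.
  apply/eqP => /dot_eq0 l0T; move: l00.
  by rewrite -[l0]trmxK -/l l0T trmx0 eqxx.
pose v0 := (dot l l)^-1 *: l.
have lv0 : dot l v0 = 1 by rewrite dotZr mulVf.
pose a := dot l v - 1.
have vE : v = a *: v0 + (v - a *: v0) by rewrite addrC subrK.
have lv1 : dot l (v - a *: v0) = 1.
  by rewrite dotBr dotZr lv0 mulr1 /a opprB addrC subrK.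
have comb (b A1 A2 B1 B2 C1 C2 : R) : A1 = c * B1 + C1 -> A2 = c * B2 + C2 ->
    b * A1 + A2 = c * (b * B1 + B2) + (b * C1 + C2).
  by clear=> -> ->; ring.
rewrite vE !form_linl.
exact: comb (form_linr_aux c lv0 lw0 lw0') (form_linr_aux c lv1 lw0 lw0').
Qed.

End RightLinearity.

(** * Invariant forms at the base plane and at every plane *)

Section KirillovForm.
Variables (R : realType) (m : nat).
Variable omega : 'M[R]_(2 + m) -> 'M[R]_(2 + m) -> 'M[R]_(2 + m) -> R.
Hypothesis omegaS : symplectic_form (m + m) (@Gr R (2 + m)) omega.
Hypothesis omega_inv : forall g A u v, SO g -> Gr A ->
  tangent (@Gr R (2 + m)) A u -> tangent (@Gr R (2 + m)) A v ->
  omega (SO_act g A) (SO_act g u) (SO_act g v) = omega A u v.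
Hypothesis m2 : (2 < m)%N.
Implicit Types (p q : 'cV[R]_m) (x y a b : 'cV[R]_(2 + m)).
Local Notation A0 := (wedge (e1 R m) (e2 R m)).
Local Notation W := (@base_tangent R m).

Let GA0 : Gr A0.
Proof. by exists (e1 R m), (e2 R m); split=> //; exact: orthonormal_e12. Qed.

Let OE u v : pullback omega (@chart R m) u v 0 =
  omega A0 (W (usubmx u) (dsubmx u)) (W (usubmx v) (dsubmx v)).
Proof.
rewrite /pullback !derive_chart0 /chart; have [-> ->] := frame0 R m.
by [].
Qed.

Let Wl c p q p' q' r s : omega A0 (W (c *: p + p') (c *: q + q')) (W r s) =
  c * omega A0 (W p q) (W r s) + omega A0 (W p' q') (W r s).
Proof.
have := form_linl omegaS c (col_mx p q) (col_mx p' q') (col_mx r s).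
rewrite scale_col_mx add_col_mx => e.
have := OE (col_mx (c *: p + p') (c *: q + q')) (col_mx r s).
by rewrite e !OE !col_mxKu !col_mxKd => <-.
Qed.

Let Wr c p q p' q' r s : omega A0 (W r s) (W (c *: p + p') (c *: q + q')) =
  c * omega A0 (W r s) (W p q) + omega A0 (W r s) (W p' q').
Proof.
have mm : (2 < m + m)%N by exact: ltn_addr.
have := form_linr omegaS c (col_mx r s) (col_mx p q) (col_mx p' q') mm.
rewrite scale_col_mx add_col_mx => e.
have := OE (col_mx r s) (col_mx (c *: p + p') (c *: q + q')).
by rewrite e !OE !col_mxKu !col_mxKd => <-.
Qed.

(** Block diagonal rotations fix [e1] and [e2]: this SO(m) inside the stabilizer of the base plane
    is what constrains the form there. *)
Lemma lower_rotation (t : 'M[R]_m) : SO t -> exists2 g : 'M[R]_(2 + m), SO g &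
  SO_act g A0 = A0 /\ forall p q, SO_act g (W p q) = W (t *m p) (t *m q).
Proof.
move=> [tt dt]; pose g : 'M[R]_(2 + m) := block_mx 1%:M 0 0 t.
have gl p : g *m lift2 p = lift2 (t *m p).
  by rewrite /g /lift2 mul_block_col !mulmx0 mul0mx !add0r.
have g1 : g *m e1 R m = e1 R m.
  by rewrite e1E /g mul_block_col !mulmx0 mul0mx mul1mx !addr0.
have g2 : g *m e2 R m = e2 R m.
  by rewrite e2E /g mul_block_col !mulmx0 mul0mx mul1mx !addr0.
exists g.
  split; last by rewrite det_ublock det1 mul1r.
  rewrite /g tr_block_mx mulmx_block !trmx0 trmx1 !mulmx0 !mul0mx mulmx1 tt.
  by rewrite !addr0 !add0r -scalar_mx_block.
split; first by rewrite SO_act_wedge g1 g2.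
move=> p q; rewrite /base_tangent /SO_act mulmxDr mulmxDl.
by rewrite -!/(SO_act g _) !SO_act_wedge g1 g2 !gl.
Qed.

(** On pairs (p, q) the form has four blocks, each a multiple of the dot product by invariance. In
    the diagonal blocks the multiple is a value of [omega] on equal arguments, that is 0, and
    alternation makes the off-diagonal blocks opposite. Were the remaining constant 0, the nonzero
    vector [W u0 0] would lie in the radical. *)
Lemma form_base : exists2 c : R, c != 0 & forall p q p' q',
  omega A0 (W p q) (W p' q') = c * (dot p q' - dot q p').
Proof.
have [_ oalt ondeg _ _] := omegaS.
have TW p q : tangent (@Gr R (2 + m)) A0 (W p q) by exact: base_tangentP.
have split4 p q p' q' : omega A0 (W p q) (W p' q') =
  (omega A0 (W p 0) (W p' 0) + omega A0 (W p 0) (W 0 q')) +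
  (omega A0 (W 0 q) (W p' 0) + omega A0 (W 0 q) (W 0 q')).
  have e r s : W r s = W (1 *: r + 0) (1 *: 0 + s).
    by rewrite !scale1r addr0 add0r.
  rewrite {1}(e p q) {1}(e p' q') (Wl 1 p 0 0 q) (Wr 1 p' 0 0 q' p 0).
  by rewrite (Wr 1 p' 0 0 q' 0 q) !mul1r.
have alt p q : omega A0 (W p q) (W p q) = 0 by exact: oalt.
have anti p q : omega A0 (W 0 q) (W p 0) = - omega A0 (W p 0) (W 0 q).
  have := alt p q; rewrite split4 !alt add0r addr0 => /eqP.
  by rewrite addrC addr_eq0 => /eqP.
have inv (t : 'M[R]_m) p q p' q' : SO t ->
    omega A0 (W (t *m p) (t *m q)) (W (t *m p') (t *m q')) =
    omega A0 (W p q) (W p' q').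
  move=> /lower_rotation[g gSO [gA gW]].
  by rewrite -!gW -{1}gA omega_inv.
have W0 (a : R) : 0 = a *: (0 : 'cV[R]_m) + 0 by rewrite scaler0 addr0.
(* [F] and [G] range over the two inclusions of R^m, as velocity of [e1] or of [e2], so that one
   argument serves all blocks. *)
have bil (F G : 'cV[R]_m -> 'M[R]_(2 + m)) :
    (F = W^~ 0 \/ F = W 0) -> (G = W^~ 0 \/ G = W 0) ->
    exists2 u0 : 'cV[R]_m, dot u0 u0 = 1 &
      forall u v, omega A0 (F u) (G v) = omega A0 (F u0) (G u0) * dot u v.
  move=> hF hG; apply: (@SO_invariant_bilinear R m
    (fun p q => omega A0 (F p) (G q)) m2).
  - move=> r u v w; have [s [s' ->]] : exists s s', G w = W s s'.
      by case: hG => ->; [exists w, 0 | exists 0, w].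
    by case: hF => ->; rewrite -Wl -W0.
  - move=> r u v w; have [s [s' ->]] : exists s s', F w = W s s'.
      by case: hF => ->; [exists w, 0 | exists 0, w].
    by case: hG => ->; rewrite -Wr -W0.
  move=> t u v tSO; have t0 : t *m (0 : 'cV[R]_m) = 0 by rewrite mulmx0.
  have := inv t u 0 v 0 tSO; have := inv t u 0 0 v tSO.
  have := inv t 0 u v 0 tSO; have := inv t 0 u 0 v tSO.
  rewrite !t0 => i4 i3 i2 i1.
  case: hF => ->; case: hG => ->;
    [exact: i1 | exact: i2 | exact: i3 | exact: i4].
have [p1 _ H11] := bil (W^~ 0) (W^~ 0) (or_introl erefl) (or_introl erefl).
have [p2 _ H22] := bil (W 0) (W 0) (or_intror erefl) (or_intror erefl).
have [u0 u01 H12] := bil (W^~ 0) (W 0) (or_introl erefl) (or_intror erefl).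
have WE p q p' q' : omega A0 (W p q) (W p' q') =
    omega A0 (W u0 0) (W 0 u0) * (dot p q' - dot q p').
  rewrite split4 anti H11 H12 (H12 p' q) H22 !alt !mul0r add0r addr0.
  by rewrite (dotC p' q) mulrBr.
exists (omega A0 (W u0 0) (W 0 u0)) => //.
apply/eqP => c0.
have Wu0 : W u0 0 = 0.
  apply: (ondeg _ GA0 _ (TW u0 0)) => v /tangent_e12[vE d1 d2 d3 d4].
  have lift0 w : dot (e1 R m) w = 0 -> dot (e2 R m) w = 0 -> w = lift2 (dsubmx w).
    by move=> w1 w2; rewrite {1}(lift2_split w) w1 w2 !scale0r !add0r.
  have n3 : dot (e1 R m) (- (v *m e1 R m)) = 0 by rewrite dotNr d3 oppr0.
  have n4 : dot (e2 R m) (- (v *m e1 R m)) = 0 by rewrite dotNr d4 oppr0.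
  rewrite vE (lift0 _ d1 d2) (lift0 _ n3 n4) -/(base_tangent _ _).
  by rewrite WE c0 mul0r.
have /orthonormal2P[_ e22 _] := orthonormal_e12 R m.
have lu0 : lift2 u0 = 0.
  have := congr1 (fun M => M *m e2 R m) Wu0.
  rewrite mul0mx /base_tangent /lift2 col_mx0 -/(lift2 u0) /wedge trmx0.
  rewrite mulmx0 mul0mx.
  rewrite subr0 addr0 mulmxBl -!mulmxA !trmx_mulE e22 (dotC (lift2 u0)) dot_e2_lift2.
  by rewrite mulmx1 mul_mx_scalar scale0r subr0.
by move: u01; rewrite -dot_lift2 lu0 dot0l => /esym/eqP; rewrite oner_eq0.
Qed.

(** A rotation carrying (e1, e2) to (x, y) pulls frame velocities back to frame velocities and keeps
    their dot products, so the constant is the same at every plane. Velocities may have in-plane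
    components, as those of the chart frame do. *)
Theorem invariant_form_wedge : exists2 c : R, c != 0 &
  forall x y a b a' b', orthonormal2 x y ->
    frame_velocity x y a b -> frame_velocity x y a' b' ->
    omega (wedge x y) (wedge a y + wedge x b) (wedge a' y + wedge x b') =
    c * (dot a b' - dot b a').
Proof.
have [c c0 cE] := form_base; exists c => // x y a b a' b' oxy ab ab'.
have [g gSO [g1 g2]] := SO_frame2 (ltnW (ltnW m2)) oxy.
have gg := SO_trmxK gSO.
have vel r s : frame_velocity x y r s ->
    frame_velocity (e1 R m) (e2 R m) (g^T *m r) (g^T *m s).
  by rewrite /frame_velocity -g1 -g2 !dot_mulmxl.
have gK r : g *m (g^T *m r) = r by rewrite mulmxA gSO.1 mul1mx.
have act r s : wedge r y + wedge x s =
    SO_act g (wedge (g^T *m r) (e2 R m) + wedge (e1 R m) (g^T *m s)).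
  by rewrite /SO_act mulmxDr mulmxDl -!/(SO_act g _) !SO_act_wedge g1 g2 !gK.
have [tE dE] := frame_velocity_e12 (vel _ _ ab).
have [tE' _] := frame_velocity_e12 (vel _ _ ab').
have gT r s : dot (g^T *m r) (g^T *m s) = dot r s.
  by rewrite dot_mulmx // trmxK gSO.1.
rewrite -(gT a) -(gT b) (dE _ _ (vel _ _ ab')) -cE !act -tE -tE'.
rewrite -{1}g1 -{1}g2 -SO_act_wedge omega_inv //.
  by rewrite tE; exact: base_tangentP.
by rewrite tE'; exact: base_tangentP.
Qed.

End KirillovForm.

(** * Null sets *)

Section NullSets.
Variables (R : realType) (m : nat) (E : normedModType R) (S : set E).
Variable omega : E -> E -> E -> R.

Definition flat_box (X : set E) : Prop :=
  exists (phi : 'cV[R]_(m + m) -> E) (U : set 'cV[R]_(m + m))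
         (a b : 'cV[R]_(m + m)) (i : 'I_(m + m)),
  [/\ parametrization S U phi, (forall j, a j 0 <= b j 0), box a b `<=` U,
      a i 0 = b i 0 & X = phi @` box a b].

Lemma liouville_volume_ge0 A : (0 <= liouville_volume m S omega A)%E.
Proof.
apply: le_ereal_inf_tmp => _ [phi [U [a [b [pphi ab bU cov ->]]]]].
apply: nneseries_ge0 => k _ _; apply: mule_ge0.
  by rewrite lee_fin; apply: prodr_ge0 => i _; rewrite subr_ge0.
(* The corner [a k] lies in the box, so the supremum is not taken over the empty set. *)
apply: le_trans (_ : (`|liouville_density omega (phi k) (a k)|%:E <= _)%E).
  by rewrite lee_fin.
apply: ereal_sup_ubound; exists (a k) => //.
by move=> i; rewrite lexx ab.
Qed.

(** The edge of length 0 makes the box volume 0, and 0 times the supremum is 0 even if the latter is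
    infinite, so the density never has to be estimated. *)
Lemma liouville_volume_flat (F : nat -> set E) A :
  (forall k, flat_box (F k)) -> A `<=` \bigcup_k F k ->
  liouville_volume m S omega A = 0%E.
Proof.
move=> /choice[phi /choice[U /choice[a /choice[b /choice[i H]]]]] AF.
apply/eqP; rewrite eq_le liouville_volume_ge0 andbT.
apply: ereal_inf_lbound; exists phi, U, a, b; split.
- by move=> k; case: (H k).
- by move=> k; case: (H k).
- by move=> k; case: (H k).
- by move=> x /AF[k _]; case: (H k) => _ _ _ _ -> Fx; exists k.
apply/esym/eseries0 => k _ _.
case: (H k) => _ _ _ aib _.
by rewrite /box_volume (bigD1 (i k)) //= aib subrr mul0r mul0e.
Qed.

(** Corners of boxes inside the hyperplane x_i = 0; rationality of the other coordinates makes the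
    family of boxes countable. *)
Definition flat_rat (i : 'I_(m + m)) (q : 'cV[rat]_(m + m)) : 'cV[R]_(m + m) :=
  \col_j if j == i then 0 else ratr (q j 0).

Lemma flat_rat_box (U : set 'cV[R]_(m + m)) x i : open U -> U x -> x i 0 = 0 ->
  exists q q', [/\ forall j, flat_rat i q j 0 <= flat_rat i q' j 0,
    box (flat_rat i q) (flat_rat i q') `<=` U &
    box (flat_rat i q) (flat_rat i q') x].
Proof.
move=> oU Ux xi.
have /nbhs_ballP[e /= e0 eU] : nbhs x U by exact: open_nbhs_nbhs.
have lo j : exists q : rat, x j 0 - e < ratr q < x j 0.
  have [|q] := @rat_in_itvoo R (x j 0 - e) (x j 0); first by rewrite ltrBlDr ltrDl.
  by rewrite in_itv; exists q.
have hi j : exists q : rat, x j 0 < ratr q < x j 0 + e.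
  have [|q] := @rat_in_itvoo R (x j 0) (x j 0 + e); first by rewrite ltrDl.
  by rewrite in_itv; exists q.
have [q qE] := choice lo; have [q' qE'] := choice hi.
exists (\col_j q j), (\col_j q' j).
have bnd j : [/\ flat_rat i (\col_j q j) j 0 <= x j 0,
    x j 0 <= flat_rat i (\col_j q' j) j 0,
    x j 0 - e < flat_rat i (\col_j q j) j 0 &
    flat_rat i (\col_j q' j) j 0 < x j 0 + e].
  rewrite !mxE; have [->|ji] := eqVneq j i.
    by rewrite xi sub0r add0r oppr_lt0.
  by have /andP[? ?] := qE j; have /andP[? ?] := qE' j; split=> //; exact: ltW.
split.
- by move=> j; have [h1 h2 _ _] := bnd j; exact: le_trans h1 h2.
- move=> y yb; apply: eU; split=> // j k; rewrite ord1 /ball /= ltr_norml.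
  have [_ _ h1 h2] := bnd j; have /andP[h3 h4] := yb j.
  by rewrite ltrBrDl ltrBlDl; apply/andP; split; lra.
by move=> j; have [-> -> _ _] := bnd j.
Qed.

Lemma liouville_volume_slices (T : countType)
    (phi : T -> 'cV[R]_(m + m) -> E) (U : T -> set 'cV[R]_(m + m))
    (i : T -> 'I_(m + m)) (t0 : T) A :
  (forall t, parametrization S (U t) (phi t)) -> U t0 0 ->
  A `<=` \bigcup_t (phi t @` (U t `&` [set x | x (i t) 0 = 0])) ->
  liouville_volume m S omega A = 0%E.
Proof.
move=> pphi U0 Acov.
pose I := (T * ('cV[rat]_(m + m) * 'cV[rat]_(m + m)))%type.
pose valid (k : I) :=
  (forall j, flat_rat (i k.1) k.2.1 j 0 <= flat_rat (i k.1) k.2.2 j 0) /\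
  box (flat_rat (i k.1) k.2.1) (flat_rat (i k.1) k.2.2) `<=` U k.1.
(* Default for the codes that name no admissible box: the box reduced to the origin, flat as well.
   It makes the sequence total and is the purpose of [U t0 0]. *)
pose F0 := phi t0 @` box 0 0.
have fF0 : flat_box F0.
  exists (phi t0), (U t0), 0, 0, (i t0); split=> //.
  move=> x x0; rewrite (_ : x = 0) //; apply/matrixP => j l.
  by rewrite ord1; have := x0 j; rewrite !mxE => /le_anti.
pose F n : set E := if (unpickle n : option I) is Some k then
    if pselect (valid k) then
      phi k.1 @` box (flat_rat (i k.1) k.2.1) (flat_rat (i k.1) k.2.2)
    else F0
  else F0.
apply: (@liouville_volume_flat F).
  move=> n; rewrite /F; case: unpickle => [k|] //; case: pselect => [[ab bU]|] //.
  exists (phi k.1), (U k.1), (flat_rat (i k.1) k.2.1),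
    (flat_rat (i k.1) k.2.2), (i k.1).
  by split=> //; rewrite !mxE eqxx.
move=> X /Acov[t _ [x [Ux xi] <-]].
have oU : open (U t) by case: (pphi t).
have [q [q' [qq' bU xb]]] := flat_rat_box oU Ux xi.
exists (pickle ((t, (q, q')) : I)) => //.
rewrite /F pickleK /=; case: pselect => [vk|nvk]; first by exists x.
by case: nvk; split.
Qed.

End NullSets.

(** * Straightening the quadratic cone *)

Section SplitShear.
Variables (R : realType) (d : nat) (a0 a1 b0 b1 : 'I_d).
Hypothesis uniq_idx : uniq [:: a0; a1; b0; b1].
Implicit Types (x y u : 'cV[R]_d).

(* parametrizes the cone x_a0 x_b1 = x_a1 x_b0, away from x_a0 = 0, by the
   hyperplane y_b1 = 0 *)
Definition cone_shear y : 'cV[R]_d :=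
  \col_k if k == a1 then y a0 0 * y a1 0
         else if k == b1 then y a1 0 * y b0 0 + y b1 0
         else y k 0.

Let idxE : [/\ (a0 == a1) = false, (a0 == b1) = false, (b0 == a1) = false,
  (b0 == b1) = false & (b1 == a1) = false].
Proof.
move: uniq_idx; rewrite /= !inE !negb_or !andbT.
move=> /andP[/and3P[/negbTE e1 /negbTE e2 /negbTE e3]].
move=> /andP[/andP[/negbTE e4 /negbTE e5] /negbTE e6].
by split=> //; rewrite eq_sym.
Qed.

Let sE y : [/\ cone_shear y a0 0 = y a0 0, cone_shear y b0 0 = y b0 0,
  cone_shear y a1 0 = y a0 0 * y a1 0 &
  cone_shear y b1 0 = y a1 0 * y b0 0 + y b1 0].
Proof.
by have [e1 e2 e3 e4 e5] := idxE; rewrite !mxE !eqxx e1 e2 e3 e4 e5.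
Qed.

Lemma smooth_cone_shear U : open U -> smooth_on U cone_shear.
Proof.
move=> oU; have sc k : smooth_on U (fun y : 'cV[R]_d => y k 0).
  by apply: smooth_coord => //; exact: smooth_id.
apply: smooth_mx => // k j; rewrite ord1.
pose f (y : 'cV[R]_d) : R := if k == a1 then y a0 0 * y a1 0
         else if k == b1 then y a1 0 * y b0 0 + y b1 0 else y k 0.
apply: (@smooth_ext _ _ _ _ f) => //; first by move=> y _; rewrite mxE.
rewrite /f; case: (k == a1); first exact: smoothM.
by case: (k == b1) => //; apply: smoothD => //; exact: smoothM.
Qed.

Lemma cone_shear_inj x y : x a0 0 != 0 -> cone_shear x = cone_shear y -> x = y.
Proof.
move=> x0 xy; have e k := congr1 (fun v : 'cV[R]_d => v k 0) xy.
have [xa0 xb0 xa1 xb1] := sE x; have [ya0 yb0 ya1 yb1] := sE y.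
have ea0 : x a0 0 = y a0 0 by have := e a0; rewrite /= xa0 ya0.
have eb0 : x b0 0 = y b0 0 by have := e b0; rewrite /= xb0 yb0.
have ea1 : x a1 0 = y a1 0.
  by have := e a1; rewrite /= xa1 ya1 -ea0; exact: mulfI.
have eb1 : x b1 0 = y b1 0.
  by have := e b1; rewrite /= xb1 yb1 ea1 eb0; exact: addrI.
apply/matrixP => k j; rewrite ord1.
have := e k; rewrite /= !mxE.
by case: (k =P a1) => [->|_] //; case: (k =P b1) => [->|_].
Qed.

Lemma derive_cone_shear y u k : 'D_u cone_shear y k 0 =
  if k == a1 then u a0 0 * y a1 0 + y a0 0 * u a1 0
  else if k == b1 then u a1 0 * y b0 0 + y a1 0 * u b0 0 + u b1 0
  else u k 0.
Proof.
have dp : derivable cone_shear y u.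
  by apply: (smooth_derivable (smooth_cone_shear openT)).
have dc := is_derive_coord y u.
have [_ e1] := is_deriveM (dc a0) (dc a1).
have [_ e2] := is_deriveD (is_deriveM (dc a1) (dc b0)) (dc b1).
rewrite derive_coord //; case: ifP => [/eqP ->|k1].
  rewrite (_ : (fun t => _) =
      (fun t : 'cV[R]_d => t a0 0) * (fun t => t a1 0)); last first.
    by apply/funext => t; case: (sE t).
  by apply: etrans e1 _; rewrite /GRing.scale /=; ring.
case: ifP => [/eqP ->|k2].
  rewrite (_ : (fun t => _) = (fun t : 'cV[R]_d => t a1 0) * (fun t => t b0 0)
     + (fun t => t b1 0)); last first.
    by apply/funext => t; case: (sE t).
  by apply: etrans e2 _; rewrite /GRing.scale /=; ring.
rewrite (_ : (fun t => _) = (fun t : 'cV[R]_d => t k 0)); last first.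
  by apply/funext => t; rewrite mxE k1 k2.
by have [_ ->] := dc k.
Qed.

Lemma cone_shear_immersion y u : y a0 0 != 0 -> 'D_u cone_shear y = 0 -> u = 0.
Proof.
move=> y0 D0; have e k : 'D_u cone_shear y k 0 = 0 by rewrite D0 mxE.
have [i1 i2 i3 i4 i5] := idxE.
have ua0 : u a0 0 = 0 by have := e a0; rewrite derive_cone_shear i1 i2.
have ub0 : u b0 0 = 0 by have := e b0; rewrite derive_cone_shear i3 i4.
have ua1 : u a1 0 = 0.
  have /eqP := e a1; rewrite derive_cone_shear eqxx ua0 mul0r add0r.
  by rewrite mulf_eq0 (negbTE y0) => /eqP.
have ub1 : u b1 0 = 0.
  have := e b1; rewrite derive_cone_shear i5 eqxx ua1 ub0 mul0r mulr0.
  by rewrite !add0r.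
apply/matrixP => k j; rewrite ord1 [RHS]mxE.
have := e k; rewrite derive_cone_shear.
by case: (k =P a1) => [->|_] //; case: (k =P b1) => [->|_].
Qed.

Lemma cone_shear_onto x : x a0 0 != 0 -> x a0 0 * x b1 0 = x a1 0 * x b0 0 ->
  exists y, [/\ cone_shear y = x, y a0 0 != 0 & y b1 0 = 0].
Proof.
move=> x0 cone; have [i1 i2 i3 i4 i5] := idxE.
(* The coordinate y_a1 is the slope x_a1 / x_a0. For the image x of any y one has x_a0 x_b1 - x_a1
   x_b0 = y_a0 y_b1, so off y_a0 = 0 the cone is y_b1 = 0. *)
pose y : 'cV[R]_d := \col_k if k == a1 then x a1 0 / x a0 0
  else if k == b1 then 0 else x k 0.
have ya0 : y a0 0 = x a0 0 by rewrite mxE i1 i2.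
have yb0 : y b0 0 = x b0 0 by rewrite mxE i3 i4.
have ya1 : y a1 0 = x a1 0 / x a0 0 by rewrite mxE eqxx.
have yb1 : y b1 0 = 0 by rewrite mxE i5 eqxx.
exists y; split; rewrite ?ya0 //; apply/matrixP => k j; rewrite ord1.
have [sa0 sb0 sa1 sb1] := sE y.
have [->|k1] := eqVneq k a1; first by rewrite sa1 ya0 ya1 mulrC divfK.
have [->|k2] := eqVneq k b1.
  rewrite sb1 ya1 yb0 yb1 addr0; apply: (mulfI x0); rewrite cone.
  by rewrite mulrA (mulrC (x a0 0)) divfK.
by rewrite !mxE (negbTE k1) (negbTE k2).
Qed.

End SplitShear.

(** * The hypersurface A_12 = 0 is a null set *)

Section Equator.
Variables (R : realType) (m : nat).
Hypothesis m2 : (2 < m)%N.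
Notation B := (@Cball R m (Num.sqrt 2)).
Notation G := (@Gr R (2 + m)).

Let i0 : 'I_m := Ordinal (ltnW (ltnW m2)).
Let i1 : 'I_m := Ordinal (ltnW m2).
Let r0 : 'I_(2 + m) := lshift m 0.
Let r1 : 'I_(2 + m) := lshift m 1.
Let r2 : 'I_(2 + m) := rshift 2 i0.
Let r3 : 'I_(2 + m) := rshift 2 i1.

(** Since m > 2, prescribing four columns still leaves one to correct the orientation. *)
Lemma SO_frame4 (i j k l : 'I_(2 + m)) : uniq [:: i; j; k; l] ->
  exists2 g : 'M[R]_(2 + m), SO g &
    [/\ g *m delta_mx r0 0 = delta_mx i 0 :> 'cV_(2 + m),
        g *m delta_mx r1 0 = delta_mx j 0 :> 'cV_(2 + m),
        g *m delta_mx r2 0 = delta_mx k 0 :> 'cV_(2 + m) &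
        g *m delta_mx r3 0 = delta_mx l 0 :> 'cV_(2 + m)].
Proof.
move=> u4.
have [||g gSO gx] := @SO_frame R (2 + m) 4
  (fun t => delta_mx (nth i [:: i; j; k; l] t) 0).
- by rewrite -[4%N]/(2 + 2)%N ltn_add2l.
- by move=> s t s4 t4; rewrite dot_delta nth_uniq.
by exists g => //; split; rewrite gx.
Qed.

Lemma SO_act_entry n (g A : 'M[R]_n) (a b i j : 'I_n) : Gr A ->
  g *m delta_mx a 0 = delta_mx i 0 :> 'cV_n ->
  g *m delta_mx b 0 = delta_mx j 0 :> 'cV_n -> SO_act g^T A a b = A i j.
Proof.
move=> [x [y [_ ->]]] ga gb; rewrite SO_act_wedge !wedgeE.
by rewrite -!(dot_deltal _ (g^T *m _)) -!dot_mulmxl ga gb !dot_deltal.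
Qed.

Lemma parametrization_SO_act n d (U : set 'cV[R]_d) phi (g : 'M[R]_n) : SO g ->
  parametrization (@Gr R n) U phi ->
  parametrization (@Gr R n) U (fun x => SO_act g (phi x)).
Proof.
move=> gSO [oU sphi Gphi iphi dphi].
pose L : {linear 'M[R]_n -> 'M[R]_n} := mulmxr g^T \o mulmx g.
split=> //.
- exact: (smooth_linear_mx L oU sphi).
- by move=> x Ux; apply: Gr_SO_act => //; exact: Gphi.
- move=> x y Ux Uy e; apply: iphi => //.
  by rewrite -(SO_actK (phi x) gSO) e SO_actK.
move=> x u Ux e; apply: (dphi x) => //.
have dx := smooth_differentiable sphi Ux.
have Le : L ('D_u phi x) = 0 by rewrite -(derive_linear_mx L u dx); exact: e.
have LE : L ('D_u phi x) = SO_act g ('D_u phi x) by [].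
rewrite -(SO_actK ('D_u phi x) gSO) -LE Le.
by rewrite /SO_act mulmx0 mul0mx.
Qed.

Lemma lower_index (k : 'I_m) : exists l l' : 'I_m, uniq [:: k; l; l'].
Proof.
pose i2 : 'I_m := Ordinal m2.
have [->|k0] := eqVneq k i0; first by exists i1, i2.
have [->|k1] := eqVneq k i1; first by exists i0, i2.
by exists i0, i1; rewrite /= !inE negb_or k0 k1.
Qed.

(** If some entry of the lower block is nonzero, the vanishing A_12 serves as the second entry.
    Otherwise a nonzero entry must have one index in each block, and any two further lower indices,
    available as m >= 3, give a vanishing one. *)
Lemma equator_entries (A : 'M[R]_(2 + m)) : G A -> A r0 r1 = 0 ->
  exists i j k l, [/\ uniq [:: i; j; k; l], 0 < A i j & A k l = 0].
Proof.
move=> GA A01.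
have skew i j : A j i = - A i j.
  by apply/eqP; rewrite -addr_eq0 addrC; apply/eqP; exact: Gr_skew.
have diag i : A i i = 0.
  by have /eqP := Gr_skew i i GA; rewrite -mulr2n mulrn_eq0 => /eqP.
have A10 : A r1 r0 = 0 by rewrite skew A01 oppr0.
(* The sign is corrected by exchanging the indices; the symmetric predicate [P] retains which blocks
   they come from. *)
have pos (P : 'I_(2 + m) -> 'I_(2 + m) -> Prop) :
    (forall i j, P i j -> P j i) -> (exists i j, P i j /\ A i j != 0) ->
    exists i j, P i j /\ 0 < A i j.
  move=> Psym [i [j [Pij Aij]]]; case: (ltrgtP (A i j) 0) => A0.
  - by exists j, i; rewrite skew oppr_gt0; split=> //; exact: Psym.
  - by exists i, j.
  - by rewrite A0 eqxx in Aij.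
have [low|nlow] := pselect (exists k l : 'I_m, A (rshift 2 k) (rshift 2 l) != 0).
  have [||i [j [[[k ->] [l ->]] Akl]]] := pos (fun i j =>
    (exists k, i = rshift 2 k) /\ (exists l, j = rshift 2 l)).
  - by move=> i j [].
  - move: low => [k [l Akl]]; exists (rshift 2 k), (rshift 2 l); split=> //.
    by split; [exists k | exists l].
  exists (rshift 2 k), (rshift 2 l), r0, r1; split=> //.
  have kl : k != l by apply: contraTneq Akl => ->; rewrite diag ltxx.
  by rewrite /= !inE !negb_or !eq_rlshift (inj_eq (@rshift_inj _ _)) kl.
have low0 k l : A (rshift 2 k) (rshift 2 l) = 0.
  by apply/eqP; apply: contraPT nlow => Akl; apply; exists k, l.
have [||i [j [Pij Aij]]] := pos (fun _ _ => True); first by [].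
  apply: contrapT => A0; have := Gr_norm GA.
  rewrite big1 => [|i _]; first by move=> /esym/eqP; rewrite pnatr_eq0.
  rewrite big1 // => j _; have [->|Aij] := eqVneq (A i j) 0; first by rewrite mul0r.
  by case: A0; exists i, j.
have up (a b : 'I_2) : A (lshift m a) (lshift m b) = 0.
  have I2 (c : 'I_2) : c = 0 \/ c = 1.
    by case: c => [[|[|//]] hc]; [left | right]; exact: val_inj.
  by case: (I2 a) => ->; case: (I2 b) => ->; rewrite ?diag.
have mixed (a : 'I_2) (k : 'I_m) : exists l l',
    [/\ uniq [:: lshift m a; rshift 2 k; l; l'],
    uniq [:: rshift 2 k; lshift m a; l; l'] & A l l' = 0].
  have [l [l']] := lower_index k.
  rewrite /= !inE !negb_or !andbT => /andP[/andP[kl kl'] ll'].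
  exists (rshift 2 l), (rshift 2 l'); rewrite low0; split=> //=;
    by rewrite !inE !negb_or ?eq_rlshift ?eq_lrshift !(inj_eq (@rshift_inj _ _))
      kl kl' ll'.
move: Aij; case: (split_ordP i) => a ->; case: (split_ordP j) => b ->.
- by rewrite up ltxx.
- move=> Aab; have [l [l' [u _ Al]]] := mixed a b.
  by exists (lshift m a), (rshift 2 b), l, l'.
- move=> Aab; have [l [l' [_ u Al]]] := mixed b a.
  by exists (rshift 2 a), (lshift m b), l, l'.
by rewrite low0 ltxx.
Qed.

Lemma equator_null (omega : 'M[R]_(2 + m) -> 'M[R]_(2 + m) -> 'M[R]_(2 + m) -> R) X :
  X `<=` [set A | G A /\ A (lshift m 0) (lshift m 1) = 0] ->
  liouville_volume m G omega X = 0%E.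
Proof.
move=> XH.
pose a0 : 'I_(m + m) := lshift m i0; pose a1 : 'I_(m + m) := lshift m i1.
pose b0 : 'I_(m + m) := rshift m i0; pose b1 : 'I_(m + m) := rshift m i1.
have u4 : uniq [:: a0; a1; b0; b1].
  rewrite /= !inE !negb_or !eq_lrshift.
  by rewrite (inj_eq (@lshift_inj _ _)) (inj_eq (@rshift_inj _ _)).
pose psi : 'cV[R]_(m + m) -> 'cV[R]_(m + m) := cone_shear a0 a1 b0 b1.
pose T := ('I_(2 + m) * 'I_(2 + m) * 'I_(2 + m) * 'I_(2 + m))%type.
have frames (t : T) : exists g : 'M[R]_(2 + m), SO g /\
   (let: (i, j, k, l) := t in uniq [:: i; j; k; l] ->
    [/\ g *m delta_mx r0 0 = delta_mx i 0 :> 'cV_(2 + m),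
        g *m delta_mx r1 0 = delta_mx j 0 :> 'cV_(2 + m),
        g *m delta_mx r2 0 = delta_mx k 0 :> 'cV_(2 + m) &
        g *m delta_mx r3 0 = delta_mx l 0 :> 'cV_(2 + m)]).
  move: t => [[[i j] k] l]; have [u|nu] := boolP (uniq [:: i; j; k; l]).
    by have [g gSO gE] := SO_frame4 u; exists g.
  by exists 1%:M; split=> //; split; rewrite ?det1 // trmx1 mulmx1.
have [g gP] := choice frames.
have oB : open B by exact: open_Cball.
pose V0 : set 'cV[R]_(m + m) := [set y | y a0 0 != 0].
have oV0 : open V0.
  exact: (@open_comp _ _ (fun y : 'cV[R]_(m + m) => y a0 0) _
    (fun y _ => @coord_continuous _ _ _ a0 0 y) (@open_neq R 0)).
have oV : open (V0 `&` psi @^-1` B).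
  exact: smooth_open_preimage (smooth_cone_shear _ _ _ _ oV0).
(* The flag separates two flat pieces of the cone p_0 q_1 = p_1 q_0: [false] is the slice p_0 = 0,
   read directly in the chart, and [true] the part with p_0 nonzero, straightened by [psi]. *)
pose phi (t : T * bool) y := SO_act (g t.1) (chart (if t.2 then psi y else y)).
pose U (t : T * bool) := if t.2 then V0 `&` psi @^-1` B else B.
apply: (@liouville_volume_slices R m _ G omega (T * bool)%type phi U
  (fun t => if t.2 then b1 else a0) ((r0, r0, r0, r0), false)).
- move=> [t [|]]; apply: parametrization_SO_act; try exact: (gP t).1.
    apply: (parametrization_comp (@chart_parametrization R m) oV).
    + exact: smooth_cone_shear.
    + by move=> y [].
    + by move=> x y [x0 _] _; exact: cone_shear_inj.
    + by move=> x u [x0 _]; exact: cone_shear_immersion.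
  exact: chart_parametrization.
- by apply: Cball0; rewrite sqrtr_gt0.
move=> A /XH[GA A01].
have [i [j [k [l [u Aij Akl]]]]] := equator_entries GA A01.
have [gSO /(_ u)[gi gj gk gl]] := gP (i, j, k, l).
set h := g (i, j, k, l) in gSO gi gj gk gl.
have [||z Bz zA] := @chart_surj R m (SO_act h^T A).
- by apply: Gr_SO_act => //; exact: SO_trmx.
- by rewrite (SO_act_entry GA gi gj).
have hz : SO_act h (chart z) = A by rewrite zA SO_actVK.
have cone : z a0 0 * z b1 0 = z a1 0 * z b0 0.
  have := chart_lower i0 i1 Bz; rewrite zA (SO_act_entry GA gk gl) Akl !mxE.
  by move=> /esym/eqP; rewrite subr_eq0 => /eqP ->; rewrite mulrC.
have [z0|z0] := eqVneq (z a0 0) 0.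
  by exists ((i, j, k, l), false) => //; exists z.
have [y [yz y0 yb]] := cone_shear_onto u4 z0 cone.
exists ((i, j, k, l), true) => //; exists y; last by rewrite /phi /= /psi yz.
by split=> //; split=> //; rewrite /= /psi yz.
Qed.

End Equator.

(** * Torus action *)

Section Torus.
Variable R : realType.

Definition rot2 (c s : R) : 'M[R]_2 :=
  \matrix_(i, j) if i == j then c else if i == 0 then - s else s.

Lemma rot2E c s (x : 'cV[R]_2) :
  (rot2 c s *m x) 0 0 = c * x 0 0 - s * x 1 0 /\
  (rot2 c s *m x) 1 0 = s * x 0 0 + c * x 1 0.
Proof.
by rewrite !mxE !big_ord_recl !big_ord0 !mxE /= !addr0 mulNr; split;
  congr (_ * x _ _ + _ * x _ _) || congr (_ * x _ _ - _ * x _ _); apply: val_inj.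
Qed.

Lemma mx2P (A C : 'M[R]_2) : A 0 0 = C 0 0 -> A 0 1 = C 0 1 ->
  A 1 0 = C 1 0 -> A 1 1 = C 1 1 -> A = C.
Proof.
move=> e00 e01 e10 e11; apply/matrixP => i j.
have I2 (k : 'I_2) : k = 0 \/ k = 1.
  by case: k => [[|[|//]] hk]; [left | right]; exact: val_inj.
by case: (I2 i) => ->; case: (I2 j) => ->.
Qed.

Lemma mulmx2E (A C : 'M[R]_2) i j : (A *m C) i j = A i 0 * C 0 j + A i 1 * C 1 j.
Proof.
rewrite !mxE !big_ord_recl big_ord0 addr0.
by congr (_ + A _ _ * C _ _); apply: val_inj.
Qed.

Lemma rot2_mul c s c' s' :
  rot2 c s *m rot2 c' s' = rot2 (c * c' - s * s') (s * c' + c * s').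
Proof. by apply: mx2P; rewrite mulmx2E !mxE /=; ring. Qed.

Lemma rot2_orth c s : c ^+ 2 + s ^+ 2 = 1 -> rot2 c s *m (rot2 c s)^T = 1%:M.
Proof.
by move=> e; apply: mx2P; rewrite mulmx2E !mxE /= -?e; ring.
Qed.

Definition block_rot m (c s : R) (t : 'M[R]_m) : 'M[R]_(2 + m) :=
  block_mx (rot2 c s) 0 0 t.

Lemma torus_mx_block m (theta : nat -> R) : torus_mx (2 + m) theta =
  block_rot (cos (theta 0%N)) (sin (theta 0%N)) (torus_mx m (theta \o succn)).
Proof.
apply/matrixP => i j; rewrite mxE.
case: (split_ordP i) => k ->; case: (split_ordP j) => l ->.
- rewrite block_mxEul mxE (inj_eq (@lshift_inj _ _)).
  by case: k l => [[|[|//]] hk] [[|[|//]] hl].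
- rewrite block_mxEur mxE eq_lrshift.
  by case: k => [[|[|//]] hk].
- rewrite block_mxEdl mxE eq_rlshift.
  by case: l => [[|[|//]] hl].
by rewrite block_mxEdr mxE (inj_eq (@rshift_inj _ _)).
Qed.

Lemma torus_mx_orth m theta :
  torus_mx m theta *m (torus_mx m theta)^T = 1%:M :> 'M[R]_m.
Proof.
elim/ltn_ind: m theta => -[|[|m]] IH theta.
- by apply/matrixP => -[].
- apply/matrixP => i j; rewrite !ord1 !mxE big_ord1 !mxE eqxx /= mulr1.
  by [].
have := torus_mx_block m theta; rewrite -[m.+2]/(2 + m)%N => ->.
rewrite /block_rot tr_block_mx mulmx_block !trmx0 !mulmx0 !mul0mx.
rewrite rot2_orth ?cos2Dsin2 // IH //.
by rewrite !addr0 !add0r -scalar_mx_block.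
Qed.

Variable m : nat.
Implicit Types (t : 'M[R]_(2 + m)) (z : 'cV[R]_(m + m)).

(** An angle-free enlargement of the torus to SO(2) x O(m). It is visibly stable under conjugation
    by the [flip] used for the second ball. *)
Definition block_rotation t := exists (c s : R) (a : 'M[R]_m),
  [/\ c ^+ 2 + s ^+ 2 = 1, a *m a^T = 1%:M & t = block_rot c s a].

Lemma torus_block_rotation t : torus t -> block_rotation t.
Proof.
move=> [theta _ <-]; exists (cos (theta 0%N)), (sin (theta 0%N)).
exists (torus_mx m (theta \o succn)); split; first exact: cos2Dsin2.
  exact: torus_mx_orth.
exact: torus_mx_block.
Qed.

(* The rotation by theta_0 in the first two coordinates becomes multiplication
   by exp (i theta_0) on C^m. *)
Definition ball_rep t : 'M[R]_(m + m) :=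
  let c := t (lshift m 0) (lshift m 0) in
  let s := t (lshift m 1) (lshift m 0) in
  block_mx (c *: drsubmx t) (- s *: drsubmx t)
           (s *: drsubmx t) (c *: drsubmx t).

Lemma ball_rep_block c s (a : 'M[R]_m) : ball_rep (block_rot c s a) =
  block_mx (c *: a) (- s *: a) (s *: a) (c *: a).
Proof. by rewrite /ball_rep /block_rot block_mxKdr !block_mxEul !mxE. Qed.

Lemma block_rot_mul c s (a : 'M[R]_m) c' s' a' :
  block_rot c s a *m block_rot c' s' a' =
  block_rot (c * c' - s * s') (s * c' + c * s') (a *m a').
Proof.
by rewrite /block_rot mulmx_block !mulmx0 !mul0mx !addr0 !add0r rot2_mul.
Qed.

Lemma ball_rep_mul t t' : block_rotation t -> block_rotation t' ->
  ball_rep (t *m t') = ball_rep t *m ball_rep t'.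
Proof.
move=> [c [s [a [_ _ ->]]]] [c' [s' [a' [_ _ ->]]]].
rewrite block_rot_mul !ball_rep_block mulmx_block.
rewrite -!scalemxAl -!scalemxAr !scalerA -!scalerDl.
by congr block_mx; congr (_ *: _); ring.
Qed.

Lemma ball_rep_unitary t : block_rotation t -> unitary_mx (ball_rep t).
Proof.
move=> [c [s [a [cs aa ->]]]]; have {}aa := mulmx1C aa.
have K (k l : R) : (k *: a)^T *m (l *: a) = (k * l)%:M.
  have -> : (k *: a)^T = k *: a^T by rewrite linearZ.
  by rewrite -scalemxAl -scalemxAr scalerA aa scale_scalar_mx mulr1.
rewrite ball_rep_block /unitary_mx /std_mx tr_block_mx !mulmx_block; split.
  rewrite !K -!raddfD /= [1%:M]scalar_mx_block; congr block_mx.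
  - by congr (_%:M); rewrite -cs; ring.
  - by rewrite (_ : _ + _ = 0) ?raddf0 //; ring.
  - by rewrite (_ : _ + _ = 0) ?raddf0 //; ring.
  - by congr (_%:M); rewrite -cs; ring.
rewrite !mulmx0 !mulmx1 !mulmxN !mulmx1 !addr0 !add0r !mulNmx !K.
rewrite -!raddfN -!raddfD /=; congr block_mx.
- by rewrite (_ : _ + _ = 0) ?raddf0 //; ring.
- by congr (_%:M); rewrite -cs; ring.
- by congr (_%:M); rewrite -cs; ring.
- by rewrite (_ : _ + _ = 0) ?raddf0 //; ring.
Qed.

Lemma ball_rep_continuous : continuous ball_rep.
Proof.
move=> t.
have sc i j : smooth_on setT (fun t : 'M[R]_(2 + m) => t i j).
  by apply: smooth_coord; [exact: openT | exact: smooth_id].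
suff : smooth_on setT ball_rep by move=> /(_ 0%N); apply.
apply: smooth_mx; first exact: openT.
pose e (x y : 'I_2) k l (t : 'M[R]_(2 + m)) : R :=
  t (lshift m x) (lshift m y) * t (rshift 2 k) (rshift 2 l).
have se x y k l : smooth_on setT (e x y k l).
  by apply: smoothM => //; exact: openT.
have oT := @openT 'M[R]_(2 + m).
move=> i j; case: (split_ordP i) => k ->; case: (split_ordP j) => l ->.
- apply: (@smooth_ext _ _ _ _ (e 0 0 k l)) => // y _.
  by rewrite block_mxEul !mxE.
- apply: (@smooth_ext _ _ _ _ (fun y => - e 1 0 k l y)) => //.
    by move=> y _; rewrite block_mxEur !mxE mulNr.
  exact: smoothN.
- apply: (@smooth_ext _ _ _ _ (e 1 0 k l)) => // y _.
  by rewrite block_mxEdl !mxE.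
apply: (@smooth_ext _ _ _ _ (e 0 0 k l)) => // y _.
by rewrite block_mxEdr !mxE.
Qed.

Lemma torus_unitary_rep : unitary_rep (@torus R (2 + m)) ball_rep.
Proof.
split; last exact/continuous_subspaceT/ball_rep_continuous.
  by move=> t /torus_block_rotation; exact: ball_rep_unitary.
by move=> s t /torus_block_rotation hs /torus_block_rotation; exact: ball_rep_mul.
Qed.

(** R' + i I' is (c + i s)^2 (Rz + i Iz), the effect of z -> (c + i s) z on the sum of the z_k^2.
    The identities are invariance of the modulus and the product with the conjugate c - i s. *)
Lemma rotated_sums (c s Rz Iz : R) : c ^+ 2 + s ^+ 2 = 1 ->
  let R' := (c ^+ 2 - s ^+ 2) * Rz - 2 * c * s * Iz in
  let I' := 2 * c * s * Rz + (c ^+ 2 - s ^+ 2) * Iz in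
  [/\ R' ^+ 2 + I' ^+ 2 = Rz ^+ 2 + Iz ^+ 2,
      c * R' + s * I' = c * Rz - s * Iz & c * I' - s * R' = s * Rz + c * Iz].
Proof.
move=> cs R' I'; split.
- transitivity ((c ^+ 2 + s ^+ 2) ^+ 2 * (Rz ^+ 2 + Iz ^+ 2)).
    by rewrite /R' /I'; ring.
  by rewrite cs expr1n mul1r.
- transitivity ((c ^+ 2 + s ^+ 2) * (c * Rz - s * Iz)).
    by rewrite /R' /I'; ring.
  by rewrite cs mul1r.
transitivity ((c ^+ 2 + s ^+ 2) * (s * Rz + c * Iz)).
    by rewrite /R' /I'; ring.
by rewrite cs mul1r.
Qed.

(** Applying t to the frame turns the upper block N into g N, where g is the rotation (c, s).
    Rotating the frame inside its plane by the inverse gives g N g^T, again symmetric, and this is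
    the block at [ball_rep t *m z], since det N and tr N are unchanged while the sum of the z_k^2
    turns by twice the angle. *)
Lemma frame_rotation t z : block_rotation t -> exists c s : R,
  [/\ c ^+ 2 + s ^+ 2 = 1,
      frameX (ball_rep t *m z) = c *: (t *m frameX z) - s *: (t *m frameY z) &
      frameY (ball_rep t *m z) = s *: (t *m frameX z) + c *: (t *m frameY z)].
Proof.
move=> [c [s [a [cs aa ->]]]]; exists c, s; have {}aa := mulmx1C aa.
rewrite ball_rep_block; set z' := _ *m z.
pose p := usubmx z; pose q := dsubmx z.
have z'E : z' = col_mx (c *: (a *m p) - s *: (a *m q))
                       (s *: (a *m p) + c *: (a *m q)).
  by rewrite /z' -[z]vsubmxK mul_block_col -!scalemxAl scaleNr.
have pz : usubmx z' = c *: (a *m p) - s *: (a *m q) by rewrite z'E col_mxKu.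
have qz : dsubmx z' = s *: (a *m p) + c *: (a *m q) by rewrite z'E col_mxKd.
have uu : dot (usubmx z') (usubmx z') =
    c ^+ 2 * dot p p - 2 * c * s * dot p q + s ^+ 2 * dot q q.
  by rewrite pz !dotE !dot_mulmx // (dotC q p); ring.
have dd : dot (dsubmx z') (dsubmx z') =
    s ^+ 2 * dot p p + 2 * c * s * dot p q + c ^+ 2 * dot q q.
  by rewrite qz !dotE !dot_mulmx // (dotC q p); ring.
have ud : dot (usubmx z') (dsubmx z') =
    c * s * dot p p + (c ^+ 2 - s ^+ 2) * dot p q - c * s * dot q q.
  by rewrite pz qz !dotE !dot_mulmx // (dotC q p); ring.
have A' : sqA z' = sqA z.
  rewrite /sqA uu dd -/p -/q; congr (1 - _ / 2).
  transitivity ((c ^+ 2 + s ^+ 2) * (dot p p + dot q q)); first by ring.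
  by rewrite cs mul1r.
have R' : sqR z' = (c ^+ 2 - s ^+ 2) * sqR z - 2 * c * s * sqI z.
  by rewrite /sqR /sqI uu dd -/p -/q; ring.
have I' : sqI z' = 2 * c * s * sqR z + (c ^+ 2 - s ^+ 2) * sqI z.
  by rewrite /sqR /sqI ud -/p -/q; ring.
have [h0 h1 h2] := rotated_sums (sqR z) (sqI z) cs; rewrite -R' -I' in h0 h1 h2.
have P' : sqP z' = sqP z by rewrite /sqP A' h0.
have D' : fkD z' = fkD z by rewrite /fkD P' A'.
set w := (Num.sqrt (fkD z))^-1.
have t2 x y (v : 'cV[R]_m) : block_rot c s a *m fvec x y v =
    fvec (c * x - s * y) (s * x + c * y) (a *m v).
  rewrite /block_rot /fvec mul_block_col !mul0mx addr0 add0r; congr col_mx.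
  set f := \col_i _; have [f0 f1] := rot2E c s f.
  apply/matrixP => i j; rewrite ord1 [RHS]mxE.
  have [->|->] : i = 0 \/ i = 1.
    by case: i => [[|[|//]] hi]; [left | right]; exact: val_inj.
    by rewrite f0 !mxE.
  by rewrite f1 !mxE.
have fkE : [/\ fk1 z = 1 + sqP z - sqR z / 4, fk2 z = 1 + sqP z + sqR z / 4,
    fkb z = sqI z / 4 & fk1 z' = 1 + sqP z - sqR z' / 4] by rewrite /fk1 P'.
have [k1E k2E kbE k1E'] := fkE.
have [k2E' kbE'] : fk2 z' = 1 + sqP z + sqR z' / 4 /\ fkb z' = sqI z' / 4.
  by rewrite /fk2 P'.
have aX : a *m (w *: (fk1 z *: p - fkb z *: q)) =
    w *: (fk1 z *: (a *m p) - fkb z *: (a *m q)).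
  by rewrite -scalemxAr mulmxBr -!scalemxAr.
have aY : a *m (w *: (fk2 z *: q - fkb z *: p)) =
    w *: (fk2 z *: (a *m q) - fkb z *: (a *m p)).
  by rewrite -scalemxAr mulmxBr -!scalemxAr.
have mxEZ (k : R) (x : 'cV[R]_(2 + m)) i : (k *: x) i 0 = k * x i 0 by rewrite mxE.
have mxED (x y : 'cV[R]_(2 + m)) i : (x + y) i 0 = x i 0 + y i 0 by rewrite mxE.
have mxEN (x : 'cV[R]_(2 + m)) i : (- x) i 0 = - x i 0 by rewrite mxE.
(* Inserting c^2 + s^2 makes the diagonal entries of g N g^T match as polynomials, without a side
   relation. *)
have Pcs : sqP z = (c ^+ 2 + s ^+ 2) * sqP z by rewrite cs mul1r.
rewrite /frameX /frameY !t2 D' -/w -/p -/q aX aY pz qz.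
split=> //; apply: fvec_eqP => [||i];
  rewrite ?(mxED, mxEZ, mxEN) ?fvec0E ?fvec1E ?fvec2E.
- by rewrite k1E k2E kbE k1E' R' {1}Pcs; field.
- by rewrite k1E k2E kbE kbE' I'; field.
- move: (a *m p) (a *m q) => pa qa; rewrite !mxE k1E k2E kbE k1E' kbE'.
  transitivity (w * ((1 + sqP z) * (c * pa i 0 - s * qa i 0) -
    ((c * sqR z' + s * sqI z') * pa i 0 +
     (c * sqI z' - s * sqR z') * qa i 0) / 4)); first by field.
  by rewrite h1 h2; field.
- by rewrite k1E k2E kbE kbE' I'; field.
- by rewrite k1E k2E kbE k2E' R' {1}Pcs; field.
move: (a *m p) (a *m q) => pa qa; rewrite !mxE k1E k2E kbE k2E' kbE'.
transitivity (w * ((1 + sqP z) * (s * pa i 0 + c * qa i 0) -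
  ((c * sqI z' - s * sqR z') * pa i 0 -
   (c * sqR z' + s * sqI z') * qa i 0) / 4)); first by field.
by rewrite h1 h2; field.
Qed.

Lemma chart_ball_rep t z : block_rotation t ->
  chart (ball_rep t *m z) = SO_act t (chart z).
Proof.
move=> /(frame_rotation z)[c [s [cs eX eY]]].
rewrite /chart eX eY SO_act_wedge -(@wedge_rot _ _ (t *m frameX z) _ c (- s)).
  by rewrite opprK scaleNr.
by rewrite sqrrN.
Qed.

End Torus.

(** * The packing *)

Section Packing.
Variables (R : realType) (m : nat).
Hypothesis m2 : (2 < m)%N.
Variable omega : 'M[R]_(2 + m) -> 'M[R]_(2 + m) -> 'M[R]_(2 + m) -> R.
Hypothesis omegaS : symplectic_form (m + m) (@Gr R (2 + m)) omega.
Hypothesis omega_inv : forall g A u v, SO g -> Gr A ->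
  tangent (@Gr R (2 + m)) A u -> tangent (@Gr R (2 + m)) A v ->
  omega (SO_act g A) (SO_act g u) (SO_act g v) = omega A u v.
Notation G := (@Gr R (2 + m)).
Notation B := (@Cball R m (Num.sqrt 2)).

Let i0 : 'I_m := Ordinal (ltnW (ltnW m2)).
Let r0 : 'I_(2 + m) := lshift m 0.
Let r1 : 'I_(2 + m) := lshift m 1.

Definition reflection n (i : 'I_n) : 'M[R]_n :=
  diag_mx (\row_j if j == i then -1 else 1).

Lemma reflectionT n (i : 'I_n) : (reflection i)^T = reflection i.
Proof. exact: tr_diag_mx. Qed.

Lemma reflectionK n (i : 'I_n) : reflection i *m reflection i = 1%:M.
Proof.
rewrite mulmx_diag; apply/matrixP => j k; rewrite !mxE.
by case: (j == i); rewrite ?mulrNN mulr1.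
Qed.

Lemma det_reflection n (i : 'I_n) : \det (reflection i) = -1.
Proof.
rewrite det_diag (bigD1 i) //= mxE eqxx big1 ?mulr1 // => j /negbTE ji.
by rewrite mxE ji.
Qed.

(* an element of SO(n) normalizing the torus and reversing the orientation of
   the plane (e_1, e_2) *)
Definition flip : 'M[R]_(2 + m) :=
  block_mx (reflection (1 : 'I_2)) 0 0 (reflection i0).

Lemma flipT : flip^T = flip.
Proof. by rewrite /flip tr_block_mx !trmx0 !reflectionT. Qed.

Lemma flipK : flip *m flip = 1%:M.
Proof.
rewrite /flip mulmx_block !mulmx0 !mul0mx !reflectionK !addr0 !add0r.
by rewrite -scalar_mx_block.
Qed.

Lemma flip_SO : SO flip.
Proof.
by split; [rewrite flipT flipK | rewrite det_ublock !det_reflection mulrNN mulr1].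
Qed.

Lemma flip_actK A : SO_act flip (SO_act flip A) = A.
Proof. by rewrite -{1}flipT SO_actK //; exact: flip_SO. Qed.

Lemma flip_block_rotation t : block_rotation t -> block_rotation (flip *m t *m flip).
Proof.
move=> [c [s [a [cs aa ->]]]].
exists c, (- s), (reflection i0 *m a *m reflection i0); split.
- by rewrite sqrrN.
- rewrite !trmx_mul reflectionT !mulmxA -(mulmxA _ (reflection i0) (reflection i0)).
  by rewrite reflectionK mulmx1 -(mulmxA _ a) aa mulmx1 reflectionK.
rewrite /flip /block_rot !mulmx_block !mulmx0 !mul0mx !addr0 !add0r !mul0mx.
congr (block_mx _ 0 0 _).
by apply: mx2P; rewrite /reflection mul_mx_diag mul_diag_mx !mxE /=; ring.
Qed.

Lemma flip_entry A : G A -> SO_act flip A r0 r1 = - A r0 r1.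
Proof.
move=> [x [y [_ ->]]]; rewrite SO_act_wedge !wedgeE.
have fE (v : 'cV[R]_(2 + m)) :
    (flip *m v) r0 0 = v r0 0 /\ (flip *m v) r1 0 = - v r1 0.
  rewrite -[v in flip *m v]vsubmxK /flip mul_block_col !mul0mx addr0 add0r.
  rewrite !col_mxEu /reflection !mul_diag_mx !mxE /= mul1r mulN1r.
  by [].
have [-> ->] := fE x; have [-> ->] := fE y; ring.
Qed.

Theorem two_ball_packing : exists (r : R)
    (f : 'I_2 -> 'cV[R]_(m + m) -> 'M[R]_(2 + m))
    (rho : 'I_2 -> 'M[R]_(2 + m) -> 'M[R]_(m + m)),
  [/\ ball_packing G omega r f,
      (forall i, unitary_rep (@torus R (2 + m)) (rho i)),
      (forall i t z, torus t -> Cball r z ->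
         f i (rho i t *m z) = SO_act t (f i z)) &
      liouville_volume m G omega (packing_complement G r f) = 0%E].
Proof.
have [c c0 cE] := invariant_form_wedge omegaS omega_inv m2.
(* Scaling z by [lam] multiplies the pulled back form by lam^2, and lam^2 |c| = 1; hence the radius
   sqrt 2 * sqrt |c|. *)
pose sg := Num.sg c; pose k := Num.sqrt `|c|; pose lam := k^-1.
have k0 : 0 < k by rewrite sqrtr_gt0 normr_gt0.
have kk : k ^+ 2 = `|c| by rewrite sqr_sqrtr.
have kn : k != 0 by rewrite gt_eqF.
have sg2 : sg * sg = 1 by rewrite -expr2 sqr_sg c0.
have sg0 : sg != 0 by rewrite sgr_eq0.
have sgE : sg = 1 \/ sg = -1.
  by rewrite /sg; case: sgrP c0 => //; rewrite ?eqxx; [left | right].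
have sglam : sg * c * lam ^+ 2 = 1.
  by rewrite /lam exprVn kk /sg -normrEsg divff // normr_eq0.
have lam0 : lam != 0 by rewrite invr_eq0.
pose r := Num.sqrt 2 * k; have r0' : 0 < r by rewrite mulr_gt0 // sqrtr_gt0.
have CB z : Cball r z <-> B (lam *: z).
  rewrite /Cball /= exprMn kk !sqr_sqrtr //.
  under [X in _ <-> X < _]eq_bigr => i _ do rewrite mxE exprMn.
  rewrite -mulr_sumr /lam exprVn kk [X in _ <-> is_true (X < _)]mulrC.
  by rewrite ltr_pdivrMr ?normr_gt0.
pose f0 (z : 'cV[R]_(m + m)) := sg *: chart (lam *: z).
pose f1 z := SO_act flip (f0 z).
have GN A : G A -> G (sg *: A).
  case: sgE => ->; first by rewrite scale1r.
  move=> [x [y [/orthonormal2P[xx yy xy] ->]]]; exists y, x.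
  by split; [apply/orthonormal2P; rewrite dotC | rewrite scaleN1r -wedgeC].
have f0G z : Cball r z -> G (f0 z) by move=> /CB Bz; apply: GN; exact: chart_Gr.
have f0_entry z : Cball r z -> 0 < sg * f0 z r0 r1.
  move=> /CB Bz; rewrite /f0 mxE mulrA sg2 mul1r chart12 //.
  exact/CballP.
have f0_onto A : G A -> 0 < sg * A r0 r1 -> exists2 z, Cball r z & f0 z = A.
  move=> GA A0; have [|z Bz zA] := chart_surj (GN A GA); first by rewrite mxE.
  exists (lam^-1 *: z); first by apply/CB; rewrite scalerA divff // scale1r.
  by rewrite /f0 scalerA divff // scale1r zA scalerA sg2 scale1r.
have oC : open (@Cball R m r) by exact: open_Cball.
have sl : smooth_on (@Cball R m r) (fun z : 'cV[R]_(m + m) => lam *: z).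
  by apply: (smooth_linear_mx ( *:%R lam)) => //; exact: smooth_id.
have sfc : smooth_on (@Cball R m r) (fun z => chart (lam *: z)).
  apply: smooth_comp (@smooth_chart R m) sl => //; first exact: open_Cball.
  by move=> z /CB.
have sf0 : smooth_on (@Cball R m r) f0 by exact: (smooth_linear_mx ( *:%R sg)).
have df0 z u : Cball r z ->
    'D_u f0 z = sg *: 'D_(lam *: u) (@chart R m) (lam *: z).
  move=> Cz; have Bz : B (lam *: z) by apply/CB.
  have dc := smooth_differentiable sfc Cz.
  have dl := smooth_differentiable sl Cz.
  have dch := smooth_differentiable (@smooth_chart R m) Bz.
  have lamu : 'D_u (fun z : 'cV[R]_(m + m) => lam *: z) z = lam *: u.
    have di := smooth_differentiable (@smooth_id _ _ setT) (I : setT z).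
    by rewrite (derive_linear_mx ( *:%R lam) u di) derive_id.
  have e := derive_comp_diff u dl dch; rewrite lamu in e.
  rewrite (derive_linear_mx ( *:%R sg) u dc).
  by apply: (congr1 ( *:%R sg)); apply: etrans e _.
have swap (x y : 'cV[R]_(2 + m)) : orthonormal2 x y -> orthonormal2 y x.
  by move=> /orthonormal2P[xx yy xy]; apply/orthonormal2P; rewrite dotC.
have swapv (x y p q : 'cV[R]_(2 + m)) :
    frame_velocity x y p q -> frame_velocity y x q p.
  by case=> h1 h2 h3; split=> //; rewrite addrC.
have neg1 (x y : 'cV[R]_(2 + m)) : -1 *: wedge x y = wedge y x.
  by rewrite scaleN1r -wedgeC.
have neg2 (x y p q : 'cV[R]_(2 + m)) :
    -1 *: (wedge p y + wedge x q) = wedge q x + wedge y p.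
  by rewrite scalerDr !neg1 addrC.
(* If sg = -1, the bivector - (x /\ y) has the frame (y, x); exchanging the frame vectors exchanges
   the roles of a and b and reverses the pairing. Both signs thus yield the factor sg * c = |c|. *)
have signed x y a b a' b' : orthonormal2 x y ->
    frame_velocity x y a b -> frame_velocity x y a' b' ->
    omega (sg *: wedge x y) (sg *: (wedge a y + wedge x b))
      (sg *: (wedge a' y + wedge x b')) = sg * c * (dot a b' - dot b a').
  move=> oxy ab ab'; case: sgE => ->; first by rewrite !scale1r mul1r cE.
  rewrite neg1 !neg2.
  rewrite (cE _ _ _ _ _ _ (swap _ _ oxy) (swapv _ _ _ _ ab) (swapv _ _ _ _ ab')).
  ring.
have pb0 z u v : Cball r z -> pullback omega f0 u v z = std_form u v.
  move=> Cz; have Bz : B (lam *: z) by apply/CB.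
  rewrite /pullback !df0 // !derive_chart // signed.
  - rewrite frame_symplectic // !std_formE !linearZ /= !dotZl !dotZr.
    rewrite -[RHS]mul1r -sglam; ring.
  - exact: orthonormal_frame.
  - exact: frame_velocityP.
  - exact: frame_velocityP.
have f0_tangent z u : Cball r z -> tangent G (f0 z) ('D_u f0 z).
  move=> Cz; have Bz : B (lam *: z) by apply/CB.
  rewrite df0 // /f0 derive_chart // /chart.
  have oxy := orthonormal_frame Bz; have v := frame_velocityP (lam *: u) Bz.
  case: sgE => ->.
    by rewrite !scale1r; case: v => v1 v2 v3; exact: tangent_wedge.
  rewrite neg1 neg2; case: (swapv _ _ _ _ v) => v1 v2 v3.
  by apply: tangent_wedge => //; exact: swap.
have f0_inj z w : Cball r z -> Cball r w -> f0 z = f0 w -> z = w.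
  move=> /CB Bz /CB Bw e; apply: (scalerI lam0); apply: (chart_inj Bz Bw).
  exact: (scalerI sg0) e.
have emb0 : symplectic_ball_embedding G omega r f0 by split.
pose L : {linear 'M[R]_(2 + m) -> 'M[R]_(2 + m)} := mulmxr flip^T \o mulmx flip.
have emb1 : symplectic_ball_embedding G omega r f1.
  split.
  - exact: (smooth_linear_mx L oC sf0).
  - by move=> z Cz; apply: Gr_SO_act; [exact: flip_SO | exact: f0G].
  - move=> z w Cz Cw e; apply: (f0_inj z w Cz Cw).
    rewrite -(flip_actK (f0 z)) -(flip_actK (f0 w)).
    exact: (congr1 (SO_act flip) e).
  move=> z u v Cz; rewrite -(pb0 z u v Cz).
  have df w : 'D_w f1 z = SO_act flip ('D_w f0 z).
    exact: (derive_linear_mx L w (smooth_differentiable sf0 Cz)).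
  apply: etrans (congr2 (omega (f1 z)) (df u) (df v)) _.
  exact: (omega_inv flip_SO (f0G z Cz) (f0_tangent z u Cz) (f0_tangent z v Cz)).
pose f (i : 'I_2) := if i == 0 then f0 else f1.
(* As [f1] is [f0] followed by the involution [flip], conjugating t by [flip] inside the
   representation makes [f1] equivariant for t itself. *)
pose rho (i : 'I_2) (t : 'M[R]_(2 + m)) :=
  if i == 0 then ball_rep t else ball_rep (flip *m t *m flip).
have f1_entry z : Cball r z -> sg * f1 z r0 r1 < 0.
  move=> Cz; rewrite /f1 flip_entry ?mulrN ?oppr_lt0 ?f0_entry //.
  exact: f0G.
have I2 (i : 'I_2) : i = 0 \/ i = 1.
  by case: i => [[|[|//]] hi]; [left | right]; exact: val_inj.
have f0_equi t z : block_rotation t -> f0 (ball_rep t *m z) = SO_act t (f0 z).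
  move=> ht; rewrite /f0 scalemxAr chart_ball_rep //.
  by rewrite /SO_act -scalemxAr -scalemxAl.
exists r, f, rho; split.
- split=> //; first by move=> i; rewrite /f; case: (i == 0).
  have sep z w : Cball r z -> Cball r w -> f0 z <> f1 w.
    move=> Cz Cw e; have := f0_entry z Cz; have := f1_entry w Cw.
    by rewrite -e => h1 h2; have := lt_trans h1 h2; rewrite ltxx.
  move=> i j _ _; case: (I2 i) => ->; case: (I2 j) => -> //;
    move=> [_ [[z Cz <-] [w Cw e]]].
    by case: (sep z w Cz Cw).
  by case: (sep w z Cw Cz).
- move=> i; rewrite /rho; case: (i == 0); first exact: torus_unitary_rep.
  split.
  + move=> t /torus_block_rotation/flip_block_rotation; exact: ball_rep_unitary.
  + move=> s t /torus_block_rotation/flip_block_rotation hs.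
    move=> /torus_block_rotation/flip_block_rotation ht.
    rewrite -ball_rep_mul //; congr ball_rep.
    by rewrite !mulmxA -(mulmxA _ flip flip) flipK mulmx1.
  apply: continuous_subspaceT.
  pose L' : {linear 'M[R]_(2 + m) -> 'M[R]_(2 + m)} := mulmxr flip \o mulmx flip.
  move=> t; apply: (@continuous_comp _ _ _ L' (@ball_rep R m)).
    exact: linear_mx_continuous.
  exact: ball_rep_continuous.
- move=> i t z /torus_block_rotation ht Cz; rewrite /f /rho.
  case: (i == 0); first exact: f0_equi.
  rewrite /f1 f0_equi; last exact: flip_block_rotation.
  by rewrite -!SO_act_mul !mulmxA flipK mul1mx.
apply: (equator_null m2) => A [GA nA]; split=> //.
(* Positive values are reached by [f0], negative ones by [f1] after applying [flip]; only A_12 = 0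
   remains. *)
case: (ltgtP 0 (sg * A r0 r1)) => A0.
- have [z Cz zA] := f0_onto A GA A0; case: nA.
  by exists 0 => //; exists z.
- have [||z Cz zA] := f0_onto (SO_act flip A).
  + by apply: Gr_SO_act => //; exact: flip_SO.
  + by rewrite flip_entry // mulrN oppr_gt0.
  case: nA; exists 1 => //; exists z => //.
  by rewrite /f /= /f1 zA flip_actK.
by apply: (mulfI sg0); rewrite mulr0 -A0.
Qed.

End Packing.

Lemma null_complement_full_packing (R : realType) (m k : nat)
    (E : normedModType R) (S : set E) (omega : E -> E -> E -> R) (r : R)
    (f : 'I_k -> 'cV[R]_(m + m) -> E) :
  ball_packing S omega r f ->
  liouville_volume m S omega (packing_complement S r f) = 0%E ->
  full_packing m S omega k.
Proof.
by move=> pf vf eps eps0; exists r, f; split=> //; rewrite vf lte_fin.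
Qed.

Theorem theorem3 (R : realType) (n : nat) (hn : n = 5%N \/ n = 6%N)
    (omega : 'M[R]_n -> 'M[R]_n -> 'M[R]_n -> R)
    (homega : invariant_symplectic_form omega) :
  (exists (r : R) (f : 'I_2 -> 'cV[R]_((n - 2) + (n - 2)) -> 'M[R]_n)
          (rho : 'I_2 -> 'M[R]_n -> 'M[R]_((n - 2) + (n - 2))),
    [/\ ball_packing (@Gr R n) omega r f,
        (forall i, unitary_rep (@torus R n) (rho i)),
        (forall i t z, torus t -> Cball r z ->
           f i (rho i t *m z) = SO_act t (f i z)) &
        liouville_volume (n - 2) (@Gr R n) omega
          (packing_complement (@Gr R n) r f) = 0%E])
  /\ full_packing (n - 2) (@Gr R n) omega 2.
Proof.
case: hn omega homega => -> omega [omegaS omega_inv].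
  (* By conversion 5 is 2 + 3 and 5 - 2 is 3, so the result for m = 3 applies as it stands; m = 4 is
     used likewise below. *)
  have [r [f [rho [pf rf ef vf]]]] :=
    @two_ball_packing R 3 isT omega omegaS omega_inv.
  by split; [exists r, f, rho | exact: null_complement_full_packing pf vf].
have [r [f [rho [pf rf ef vf]]]] :=
  @two_ball_packing R 4 isT omega omegaS omega_inv.
by split; [exists r, f, rho | exact: null_complement_full_packing pf vf].
Qed.
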